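(* Let $p>3$ and let $\bar H$ be an ordinary CY3 crystal over $\bar A_0$, with $\bar H=\bar H^0\oplus\bar H^1\oplus\bar H^2\oplus\bar H^3$, $\mathrm{rank}\,\bar H^0=\mathrm{rank}\,\bar H^3=1$, $\mathrm{rank}\,\bar H^1=\mathrm{rank}\,\bar H^2=h$. Then there is an $\bar A$-basis $e_0,\ldots,e_{2h+1}$ of $\bar H$ with $$e_0\in\bar H^0,\quad e_1,\ldots,e_h\in\bar H^1,\quad e_{h+1},\ldots,e_{2h}\in\bar H^2,\quad e_{2h+1}\in\bar H^3$$ such that the Gram matrix of $\langle\,,\,\rangle$ is $$(\langle e_i,e_j\rangle)_{0\le i,j\le 2h+1}=\begin{pmatrix}0&0&0&-1\\0&0&I_h&0\\0&-I_h&0&0\\1&0&0&0\end{pmatrix}.$$ Moreover there is a matrix $\mathcal T$ such that the matrix of the connection $\nabla$ with respect to $e_0,\ldots,e_{2h+1}$ is $\mathcal T^{-1}\cdot d\mathcal T$, and such that for every lift of Frobenius $\psi$ the matrix of $F(\psi)\psi^*$ with respect to $e_0,\ldots,e_{2h+1}$ is $\mathcal T^{-1}\cdot P\cdot\psi(\mathcal T)$ with $P=\mathrm{diag}(1,pI_h,p^2I_h,p^3)$. This matrix $\mathcal T$ factors as $$\mathcal T=\begin{pmatrix}1&\tau_{23}^\star&0&0\\0&I_h&0&0\\0&0&I_h&\tau_{23}\\0&0&0&1\end{pmatrix}\begin{pmatrix}1&0&-\tau_{13}^\star&Z\\0&I_h&\tau_{12}&\tau_{13}\\0&0&I_h&0\\0&0&0&1\end{pmatrix}$$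 where $Z,\tau_{23},\tau_{13},\tau_{12}$ are matrices with entries in $K^{\mathrm u}[[t_1,\ldots,t_n]]$ of respective sizes $1\times1$, $h\times1$, $h\times1$, $h\times h$. Assume in addition that the $\bar A$-linear map $T_{\bar A/\bar W}\to\mathrm{Hom}(\bar H^3,\bar H^2)$ induced by $\nabla$ is an isomorphism, and hence $n=h$. Let $\tau_1,\ldots,\tau_h\in K^{\mathrm u}[[t_1,\ldots,t_h]]$ be the components of $\tau_{23}=(\tau_1,\ldots,\tau_h)^\star$. Then the matrix $\left(\frac{\partial\tau_i}{\partial t_j}\right)_{1\le i,j\le h}$ is invertible over $K^{\mathrm u}[[t_1,\ldots,t_h]]$ and $$\tau_{13}=-\frac12\left(\frac{\partial Z}{\partial\tau_1},\ldots,\frac{\partial Z}{\partial\tau_h}\right)^\star,\qquad \tau_{12}=-\frac12\left(\frac{\partial^2Z}{\partial\tau_i\partial\tau_j}\right)_{1\le i,j\le h}.$$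
   Context: Rings. $p$ is a prime, $\bar k$ an algebraically closed field of characteristic $p$, $\bar W$ its ring of Witt vectors, $K^{\mathrm u}=\bar W[1/p]$, $\sigma$ the Frobenius automorphism of $\bar W$ (lifting $x\mapsto x^p$ on $\bar k$), $\bar A_0=\bar k[[t_1,\ldots,t_n]]$, $\bar A=\bar W[[t_1,\ldots,t_n]]$. $\Omega^1_{\bar A/\bar W}$ denotes the module of (continuous) differentials, free over $\bar A$ on $dt_1,\ldots,dt_n$; $T_{\bar A/\bar W}=\mathrm{Hom}(\Omega^1_{\bar A/\bar W},\bar A)$. A lift of Frobenius is a ring endomorphism $\phi$ of $\bar A$ that restricts to $\sigma$ on $\bar W$ and reduces modulo $p$ to $x\mapsto x^p$ on $\bar A_0$. For an $\bar A$-module $H$, $\phi^*H=\bar A\otimes_{\phi,\bar A}H$ and $\phi^*:H\to\phi^*H$, $h\mapsto 1\otimes h$, is $\phi$-linear. Crystals. A crystal over $\bar A_0$ is a finitely generated free $\bar A$-module $H$ with a connection $\nabla:H\to\Omega^1_{\bar A/\bar W}\otimes_{\bar A} H$ such that the operators $D_i=(\frac{d}{dt_i}\otimes1)\circ\nabla$ satisfy $D_iD_j=D_jD_i$ and $\lim_{m\to\infty}D_i^m=0$ in the $p$-adic topology of $\mathrm{End}_{\bar W}(H)$. For two lifts of Frobenius $\phi,\psi$ there is a canonical isomorphism $\chi(\phi,\psi):\phi^*H\to\psi^*H$ given by $$\chi(\phi,\psi)\phi^*(x)=\sum_{m_1,\ldots,m_n\ge0}\ \prod_{j=1}^n\frac{p^{m_j}}{m_j!}\Big(\frac{\phi(t_j)-\psi(t_j)}{p}\Big)^{m_j}\psi^*(D_1^{m_1}\circ\cdots\circ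 D_n^{m_n}(x)).$$ $F$-crystals. An $F$-crystal over $\bar A_0$ is a crystal $(H,\nabla)$ together with, for every lift of Frobenius $\phi$, an $\bar A$-linear map $F(\phi):\phi^*H\to H$ such that: $\nabla\circ F(\phi)\phi^*=(\phi\otimes F(\phi)\phi^* )\circ\nabla$, where $\phi(b\,da)=\phi(b)\,d(\phi(a))$ on forms; $F(\psi)\circ\chi(\phi,\psi)=F(\phi)$ for all lifts $\phi,\psi$; and $F(\phi)\otimes\mathbb Q_p$ is an isomorphism. It is a unit $F$-crystal if $F(\phi)$ is an isomorphism for one (equivalently every) $\phi$. For a unit $F$-crystal $V$, the Tate twist $V(-i)$ is the same module with connection, with $F(\phi)\phi^*$ replaced by $p^iF(\phi)\phi^*$. Filtrations. Let $H_0=H\otimes_{\bar A}\bar A_0$. Put $\mathrm{Fil}_iH_0=\{x\in H_0\mid \exists y\in H\text{ lifting }x\text{ with }p^iy\in\mathrm{Im}\,F(\phi)\}$ (conjugate filtration) and $\mathrm{Fil}^iH_0=\{x\in H_0\mid\exists y\in H\text{ lifting }x\text{ with }F(\phi)\phi^*y\in p^iH\}$ (Hodge filtration); these are independent of $\phi$. $H$ is of level $\le N$ if $\mathrm{Fil}_NH_0=H_0$ and $\mathrm{Fil}^{N+1}H_0=0$. A Hodge $F$-crystal over $\bar A_0$ is an $F$-crystal $H$ with a decreasing filtration $H=\mathrm{Fil}^0H\supset\mathrm{Fil}^1H\supset\cdots$ by free $\bar A$-submodules such that for all $i$: $\mathrm{Fil}^iH\otimes_{\bar A}\bar A_0=\mathrm{Fil}^iH_0$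 (via the natural map to $H_0$) and $\nabla\mathrm{Fil}^iH\subset\Omega^1_{\bar A/\bar W}\otimes\mathrm{Fil}^{i-1}H$. An $F$-crystal $H$ is ordinary if the graded module $\mathrm{gr}_\bullet H_0$ of the conjugate filtration is a free $\bar A_0$-module and $H_0=\mathrm{Fil}_iH_0\oplus\mathrm{Fil}^{i+1}H_0$ for every $i$. An ordinary $F$-crystal has a unique filtration by sub-$F$-crystals $0=U_{-1}\subset U_0\subset U_1\subset\cdots$ with $U_i\otimes_{\bar A}\bar A_0=\mathrm{Fil}_iH_0$ and $U_i/U_{i-1}\simeq V_i(-i)$ for unit $F$-crystals $V_i$; an ordinary Hodge $F$-crystal decomposes as $H=\bigoplus_iH^i$, $H^i=U_i\cap\mathrm{Fil}^iH$. A Hodge $F$-crystal of level $\le N$ is divisible if for some lift of Frobenius $\phi$ one has $F(\phi)\phi^*\mathrm{Fil}^iH\subset p^iH$ for $i=0,\ldots,N$ (if $p>N$ this then holds for every lift). Ordinary CY3 crystals ($p>3$). An ordinary CY3 crystal over $\bar A_0$ is a divisible ordinary Hodge $F$-crystal $\bar H$ of level $3$ over $\bar A_0$ (with filtrations $0\subset\bar U_0\subset\bar U_1\subset\bar U_2\subset\bar U_3=\bar H$ and $\bar H=\mathrm{Fil}^0\bar H\supset\cdots\supset\mathrm{Fil}^3\bar H\supset0$, and $\bar H^i=\bar U_i\cap\mathrm{Fil}^i\bar H$) with a non-degenerate (i.e. perfect over $\bar A$) alternating bilinear form $\langle\,,\,\rangle:\bar H\times\bar H\to\bar A$ such that: $\mathrm{rank}\,\bar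 H^0=\mathrm{rank}\,\bar H^3=1$ and $\mathrm{rank}\,\bar H^1=\mathrm{rank}\,\bar H^2=h$; for all $x,y\in\bar H$ and every lift of Frobenius $\phi$, $\langle\nabla x,y\rangle+\langle x,\nabla y\rangle=d\langle x,y\rangle$ and $\langle F(\phi)\phi^*(x),F(\phi)\phi^*(y)\rangle=p^3\phi(\langle x,y\rangle)$; and $(\mathrm{Fil}^3\bar H)^\perp=\mathrm{Fil}^1\bar H$, $(\mathrm{Fil}^2\bar H)^\perp=\mathrm{Fil}^2\bar H$. By Griffiths transversality $\nabla$ induces an $\bar A$-linear map $T_{\bar A/\bar W}\to\mathrm{Hom}(\bar H^3,\bar H^2)$ (contract $\nabla:\mathrm{Fil}^3\bar H\to\Omega^1\otimes\mathrm{Fil}^2\bar H$ with a derivation and project to $\mathrm{Fil}^2\bar H/\mathrm{Fil}^3\bar H\simeq\bar H^2$; $\mathrm{Fil}^3\bar H=\bar H^3$). Conventions. $I_h$ is the $h\times h$ identity matrix; $M^\star$ is the transpose of $M$; block matrices have blocks of sizes $1,h,h,1$. Columns give images of basis vectors: $\nabla e_b=\sum_aM_{ab}\otimes e_a$, $F(\psi)\psi^*e_b=\sum_aM_{ab}e_a$. For a matrix over $K^{\mathrm u}[[t_1,\ldots,t_n]]$, $d$ is applied entrywise, and $\psi(\mathcal T)$ is obtained by applying $\psi$ to the entries, i.e. applying $\sigma$ to the coefficients and substituting $\psi(t_i)$ for $t_i$ (the resulting sums converging $p$-adically coefficient by coefficient). When $(\partial\tau_i/\partial t_j)$ is invertible,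 $\frac{\partial}{\partial\tau_1},\ldots,\frac{\partial}{\partial\tau_h}$ are the derivations $\frac{\partial}{\partial\tau_i}=\sum_j\frac{\partial t_j}{\partial\tau_i}\frac{\partial}{\partial t_j}$, where $\left(\frac{\partial t_j}{\partial\tau_i}\right)_{j,i}$ is the inverse matrix of $\left(\frac{\partial\tau_i}{\partial t_j}\right)_{i,j}$. *)

(* Defs.v *)
From HB Require Import structures.
From mathcomp Require Import all_boot all_order all_algebra boolp mpoly.

Set Implicit Arguments.
Unset Strict Implicit.
Unset Printing Implicit Defensive.

Import GRing.Theory VectorInternalTheory.
Local Open Scope ring_scope.

(* R[[t_1, ..., t_n]]: a series is its family of coefficients. *)
Definition mfps (n : nat) (R : Type) : Type := 'X_{1.. n} -> R.

Section PowerSeriesRing.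
Variables (n : nat) (R : comNzRingType).
Local Notation S := (mfps n R).
Implicit Types f g : S.

HB.instance Definition _ := gen_eqMixin S.
HB.instance Definition _ := gen_choiceMixin S.

Definition mfps_const (c : R) : S := fun m => c *+ (m == 0%MM).
Definition mfps_var (i : 'I_n) : S := fun m => (m == U_(i)%MM)%:R.
Definition mfps_add f g : S := fun m => f m + g m.
Definition mfps_opp f : S := fun m => - f m.
Definition mfps_mul f g : S := fun m =>
  \sum_(k : 'X_{1..n < (mdeg m).+1, (mdeg m).+1} | m == (k.1 + k.2)%MM)
     f k.1 * g k.2.

Fact mfps_addA : associative mfps_add.
Proof. by move=> f g h; apply: funext => m; apply: addrA. Qed.
Fact mfps_addC : commutative mfps_add.
Proof. by move=> f g; apply: funext => m; apply: addrC. Qed.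
Fact mfps_add0 : left_id (mfps_const 0) mfps_add.
Proof. by move=> f; apply: funext => m; rewrite /mfps_add /mfps_const mul0rn add0r. Qed.
Fact mfps_addN : left_inverse (mfps_const 0) mfps_opp mfps_add.
Proof.
by move=> f; apply: funext => m; rewrite /mfps_add /mfps_const mul0rn; apply: addNr.
Qed.

HB.instance Definition _ :=
  GRing.isZmodule.Build S mfps_addA mfps_addC mfps_add0 mfps_addN.

(* The ring axioms are inherited from {mpoly R[n]} by truncation. *)
Definition mfps_trunc (d : nat) f : {mpoly R[n]} :=
  \sum_(m : 'X_{1..n < d}) f m *: 'X_[m].

Lemma mfps_truncE d f m : (mdeg m < d)%N -> (mfps_trunc d f)@_m = f m.
Proof. exact: mcoeff_mpoly. Qed.

Lemma mfps_mulE (P Q : {mpoly R[n]}) f g m :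
  (forall m', (mdeg m' <= mdeg m)%N -> P@_m' = f m') ->
  (forall m', (mdeg m' <= mdeg m)%N -> Q@_m' = g m') ->
  mfps_mul f g m = (P * Q)@_m.
Proof.
move=> Pf Qg; rewrite mcoeffM; apply: eq_bigr => k _.
by rewrite Pf ?Qg // -ltnS bmdeg.
Qed.

Lemma mfps_mul_trunc d f g m : (mdeg m < d)%N ->
  mfps_mul f g m = (mfps_trunc d f * mfps_trunc d g)@_m.
Proof.
by move=> md; apply: mfps_mulE => m' m'm; rewrite mfps_truncE // (leq_ltn_trans m'm).
Qed.

Fact mfps_mulA : associative mfps_mul.
Proof.
move=> f g h; apply: funext => m; set d := (mdeg m).+1.
pose F := mfps_trunc d f; pose G := mfps_trunc d g; pose H := mfps_trunc d h.
rewrite (@mfps_mulE F (G * H)) => [|m' m'm|m' m'm]; last 2 first.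
- exact: mfps_truncE.
- by rewrite [RHS](@mfps_mul_trunc d).
rewrite (@mfps_mulE (F * G) H) => [|m' m'm|m' m'm]; first by rewrite mulrA.
- by rewrite [RHS](@mfps_mul_trunc d).
- exact: mfps_truncE.
Qed.

Fact mfps_mulC : commutative mfps_mul.
Proof.
by move=> f g; apply: funext => m; rewrite !(@mfps_mul_trunc (mdeg m).+1) // mulrC.
Qed.

Fact mfps_mul1 : left_id (mfps_const 1) mfps_mul.
Proof.
move=> f; apply: funext => m; set d := (mdeg m).+1.
rewrite (@mfps_mulE 1 (mfps_trunc d f)) => [|m' m'm|m' m'm].
- by rewrite mul1r mfps_truncE.
- exact: mcoeff1.
- exact: mfps_truncE.
Qed.

Fact mfps_mulD : left_distributive mfps_mul mfps_add.
Proof.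
move=> f g h; apply: funext => m; set d := (mdeg m).+1.
rewrite (@mfps_mulE (mfps_trunc d f + mfps_trunc d g) (mfps_trunc d h))
  => [|m' m'm|m' m'm].
- by rewrite mulrDl mcoeffD -!mfps_mul_trunc.
- by rewrite mcoeffD !mfps_truncE.
- exact: mfps_truncE.
Qed.

Fact mfps_1neq0 : mfps_const 1 != 0 :> S.
Proof.
apply/eqP => /(congr1 (fun f : S => f 0%MM)) /eqP.
by rewrite /mfps_const eqxx [X in _ == X]mul0rn oner_eq0.
Qed.

HB.instance Definition _ := GRing.Zmodule_isComNzRing.Build S
  mfps_mulA mfps_mulC mfps_mul1 mfps_mulD mfps_1neq0.

(* Inversion, by choice: it makes invmx available for matrices of series. *)
Definition mfps_unit : {pred S} := fun f => `[< exists g : S, g * f = 1 >].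
Definition mfps_inv f : S :=
  if pselect (exists g : S, g * f = 1) is left e then projT1 (cid e) else f.

Fact mfps_mulVf : {in mfps_unit, left_inverse 1 mfps_inv *%R}.
Proof.
move=> f /asboolP ex; rewrite /mfps_inv.
by case: pselect => // e; case: (cid e).
Qed.
Fact mfps_unitPl f g : g * f = 1 -> mfps_unit f.
Proof. by move=> gf; apply/asboolP; exists g. Qed.
Fact mfps_inv_out : {in [predC mfps_unit], mfps_inv =1 id}.
Proof.
move=> f; rewrite inE => /negP nf; rewrite /mfps_inv.
by case: pselect => // e; case: nf; apply/asboolP.
Qed.

HB.instance Definition _ := GRing.ComNzRing_hasMulInverse.Build S
  mfps_mulVf mfps_unitPl mfps_inv_out.

Definition mfps_deriv (i : 'I_n) f : S :=
  fun m => f (m + U_(i))%MM *+ (m i).+1.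

End PowerSeriesRing.

Arguments mfps_const n {R} c.
Arguments mfps_var {n} R i.

Definition mfps_map (n : nat) (R R' : Type) (g : R -> R') (f : mfps n R) :
  mfps n R' := fun m => g (f m).

(* The quotient x / y when y divides x (it is unique in a domain), else 0. *)
Definition exact_div (R : comNzRingType) (x y : R) : R :=
  if pselect (exists q, q * y = x) is left e then projT1 (cid e) else 0.

Definition in_pV (p N : nat) (V : zmodType) (L : V -> Prop) (x : V) :=
  exists2 y, L y & x = y *+ p ^ N.

(* [p_sum p L u s]: the family u, indexed by the monomials in n variables, is
   (unconditionally) summable with sum s for the topology in which the p ^ N L
   form a basis of neighbourhoods of 0. *)
Definition p_sum (p n : nat) (V : zmodType) (L : V -> Prop)
    (u : 'X_{1.. n} -> V) (s : V) :=
  forall N : nat, exists d : nat, forall I : seq 'X_{1.. n}, uniq I ->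
    (forall m, (mdeg m < d)%N -> m \in I) ->
    in_pV p N L (s - \sum_(m <- I) u m).

Definition everything (V : Type) : V -> Prop := fun _ => True.
Definition zero_sub (V : zmodType) : V -> Prop := fun x => x = 0.

Section Submodules.
Variables (R : comNzRingType) (V : lmodType R).

(* e is a basis of the submodule S, everything being taken modulo the
   submodule S' of S: the classes of the e_j form a basis of S / S'. *)
Definition basis_mod (S S' : V -> Prop) (r : nat) (e : 'I_r -> V) :=
  [/\ forall j, S (e j),
      forall x, S x -> exists c : 'I_r -> R, S' (x - \sum_j c j *: e j)
    & forall c : 'I_r -> R, S' (\sum_j c j *: e j) -> forall j, c j = 0].

Definition is_basis (S : V -> Prop) (r : nat) (e : 'I_r -> V) :=
  (forall x, S x <-> exists c : 'I_r -> R, x = \sum_j c j *: e j) /\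
  (forall c : 'I_r -> R, \sum_j c j *: e j = 0 -> forall j, c j = 0).

Definition free_of_rank (S : V -> Prop) (r : nat) :=
  exists e : 'I_r -> V, is_basis S e.

Definition free_submodule (S : V -> Prop) := exists r, free_of_rank S r.

Definition linear_on (V' : lmodType R) (S : V -> Prop) (g : V -> V') :=
  forall a x y, S x -> S y -> g (a *: x + y) = a *: g x + g y.

Definition is_direct_sum (S1 S2 : V -> Prop) :=
  (forall x, exists x1 x2, [/\ S1 x1, S2 x2 & x = x1 + x2]) /\
  (forall x, S1 x -> S2 x -> x = 0).

End Submodules.

(* The ring of Witt vectors of a perfect field k of characteristic p, as the
   strict p-ring with residue field k (unique up to unique isomorphism): p is
   not a zero divisor, W is p-adically separated and complete, and W / pW = k.
   [witt_frob] is the (unique) lift of the Frobenius of k. *)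
Record wittRing (p : nat) (k : fieldType) := WittRing {
  witt_ring :> idomainType;
  witt_red : {rmorphism witt_ring -> k};
  witt_red_surj : forall a : k, exists x, witt_red x = a;
  witt_red_ker : forall x, witt_red x = 0 <-> exists y, x = y *+ p;
  witt_p_neq0 : p%:R != 0 :> witt_ring;
  witt_separated : forall x : witt_ring,
    (forall N, exists y, x = y *+ p ^ N) -> x = 0;
  witt_complete : forall u : nat -> witt_ring,
    (forall N, exists M, forall i j, (M <= i)%N -> (M <= j)%N ->
       exists y, u i - u j = y *+ p ^ N) ->
    exists l, forall N, exists M, forall i, (M <= i)%N ->
       exists y, u i - l = y *+ p ^ N;
  witt_frob : {rmorphism witt_ring -> witt_ring};
  witt_frobP : forall x, witt_red (witt_frob x) = witt_red x ^+ p
}.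

Arguments witt_red {p k w}.
Arguments witt_frob {p k w}.

Section Crystals.
Variables (p : nat) (k : fieldType) (W : wittRing p k) (n : nat).

Local Notation A := (mfps n W).
Local Notation A0 := (mfps n k).
(* W[1/p] is the fraction field of W. *)
Local Notation K := {fraction W}.
Local Notation KT := (mfps n K).

Definition redA : A -> A0 := mfps_map (@witt_red p k W).

Record frobLift := FrobLift {
  frobl :> {rmorphism A -> A};
  frobl_const : forall w : W,
    frobl (mfps_const n w) = mfps_const n (witt_frob w);
  frobl_red : forall a : A, redA (frobl a) = redA a ^+ p
}.

(* The module of continuous differentials, in the basis dt_1, ..., dt_n. *)
Local Notation Omega := 'rV[A]_n.
Definition dform (a : A) : Omega := \row_i mfps_deriv i a.

(* Omega (x) H is identified with H ^ n by the basis dt_1, ..., dt_n. *)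
Section Tensor.
Variable H : lmodType A.
Local Notation OmegaH := {ffun 'I_n -> H}.

Definition tens (w : Omega) (x : H) : OmegaH := [ffun i => w 0 i *: x].

(* theta (x) 1, for theta in T = Hom(Omega, A) *)
Definition contract (theta : {scalar Omega}) (w : OmegaH) : H :=
  \sum_i theta (delta_mx 0 i) *: w i.

(* phi (x) f, where phi (b da) = phi b d(phi a) on forms *)
Definition frob_tens (phi : frobLift) (f : H -> H) (w : OmegaH) : OmegaH :=
  \sum_i tens (dform (phi (mfps_var W i))) (f (w i)).

End Tensor.

(* H (x) A0, and phi^* H = A (x)_{phi} H, with the canonical maps from H; for
   a free module they are read in the coordinates v2r of H. *)
Definition special (H : vectType A) := 'rV[A0]_(dim H).
Definition to_special (H : vectType A) (x : H) : 'rV[A0]_(dim H) :=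
  map_mx redA (v2r x).
Definition pullback (H : vectType A) := 'rV[A]_(dim H).
Definition pull (H : vectType A) (phi : frobLift) (x : H) : 'rV[A]_(dim H) :=
  map_mx phi (v2r x).

(* D_i = (d/dt_i (x) 1) o nabla is [fun x => nabla x i]. *)
Record crystal := Crystal {
  cr_mod :> vectType A;
  nabla : cr_mod -> {ffun 'I_n -> cr_mod};
  nablaD : forall x y, nabla (x + y) = nabla x + nabla y;
  nabla_leibniz : forall a x,
    nabla (a *: x) = tens (dform a) x + a *: nabla x;
  nabla_comm : forall i j x, nabla (nabla x j) i = nabla (nabla x i) j;
  nabla_nilp : forall i (N : nat), exists M, forall m, (M <= m)%N ->
    forall x, in_pV p N (@everything _) (iter m (fun y => nabla y i) x)
}.

Definition nabla_pow (H : crystal) (m : 'X_{1.. n}) (x : H) : H :=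
  foldr (fun i y => iter (m i) (fun z => nabla z i) y) x (enum 'I_n).

Definition chi_coef (phi psi : frobLift) (m : 'X_{1.. n}) : A :=
  \prod_j (exact_div (p%:R ^+ m j) (m j)`!%:R *
           exact_div (phi (mfps_var W j) - psi (mfps_var W j)) p%:R ^+ m j).

Definition is_chi (H : crystal) (phi psi : frobLift)
    (chi : {linear pullback H -> pullback H}) :=
  forall x : H,
    p_sum p (@everything _)
      (fun m => chi_coef phi psi m *: pull psi (nabla_pow m x))
      (chi (pull phi x)).

(* [frob_isog] says that F(phi) (x) Q_p is bijective: phi^* H and H being
   without p-torsion, that F(phi) is injective with p-power torsion cokernel. *)
Record fcrystal := FCrystal {
  fcr_cr :> crystal;
  frob : forall phi : frobLift, {linear pullback fcr_cr -> fcr_cr};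
  frob_horizontal : forall phi x,
    nabla (frob phi (pull phi x)) =
      frob_tens phi (fun y => frob phi (pull phi y)) (nabla x);
  frob_chi : forall phi psi,
    exists2 chi : {linear pullback fcr_cr -> pullback fcr_cr},
      is_chi phi psi chi & forall z, frob psi (chi z) = frob phi z;
  frob_isog : forall phi,
    injective (frob phi) /\
    (forall y, exists N z, frob phi z = y *+ p ^ N)
}.

Arguments frob {f} phi.

(* F(phi) phi^* *)
Definition Frob (H : fcrystal) (phi : frobLift) (x : H) : H :=
  frob phi (pull phi x).

Definition unit_fcrystal (V : fcrystal) :=
  forall phi, bijective (frob (f := V) phi).

Section Filtrations.
Variable H : fcrystal.

(* The conjugate and Hodge filtrations do not depend on phi. *)
Definition conj_fil (i : nat) (x0 : special H) :=
  exists (phi : frobLift) (y : H) (z : pullback H),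
    to_special y = x0 /\ y *+ p ^ i = frob phi z.

Definition hodge_fil (i : nat) (x0 : special H) :=
  exists (phi : frobLift) (y : H),
    to_special y = x0 /\ in_pV p i (@everything _) (Frob phi y).

Definition level_le (N : nat) :=
  (forall x0, conj_fil N x0) /\ (forall x0, hodge_fil N.+1 x0 -> x0 = 0).

(* S (x) A0 -> H0 is injective with image S0 *)
Definition specializes (S : H -> Prop) (S0 : special H -> Prop) :=
  (forall x0, S0 x0 <-> exists2 x, S x & to_special x = x0) /\
  (forall x, S x -> to_special x = 0 -> in_pV p 1 S x).

Record hodge_fcrystal (Fil : nat -> H -> Prop) : Prop := HodgeFCrystal {
  hf_free : forall i, free_submodule (Fil i);
  hf_full : forall x, Fil 0%N x;
  hf_decr : forall i x, Fil i.+1 x -> Fil i x;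
  hf_special : forall i, specializes (Fil i) (hodge_fil i);
  hf_transverse : forall i x, Fil i.+1 x -> forall j, Fil i (nabla x j)
}.

Definition pred_fil (V : zmodType) (U : nat -> V -> Prop) (i : nat) :
  V -> Prop := if i is j.+1 then U j else @zero_sub V.

Definition ordinary :=
  (forall i, exists (r : nat) (e : 'I_r -> special H),
     basis_mod (conj_fil i) (pred_fil conj_fil i) e) /\
  (forall i, is_direct_sum (conj_fil i) (hodge_fil i.+1)).

Definition sub_fcrystal (S : H -> Prop) :=
  [/\ free_submodule S,
      forall x, S x -> forall j, S (nabla x j)
    & forall phi x, S x -> S (Frob phi x)].

(* S / S' is isomorphic to the Tate twist V(-i), via f *)
Definition quot_iso_twist (S S' : H -> Prop) (V : fcrystal) (i : nat)
    (f : H -> V) :=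
  [/\ linear_on S f,
      forall v, exists2 x, S x & f x = v,
      forall x, S x -> (f x = 0 <-> S' x),
      forall x, S x -> forall j, f (nabla x j) = nabla (f x) j
    & forall phi x, S x -> f (Frob phi x) = Frob phi (f x) *+ p ^ i].

Record slope_filtration (U : nat -> H -> Prop) : Prop := SlopeFiltration {
  sf_sub : forall i, sub_fcrystal (U i);
  sf_incr : forall i x, U i x -> U i.+1 x;
  sf_special : forall i, specializes (U i) (conj_fil i);
  sf_graded : forall i, exists (V : fcrystal) (f : H -> V),
    unit_fcrystal V /\ quot_iso_twist (U i) (pred_fil U i) i f
}.

Definition divisible (N : nat) (Fil : nat -> H -> Prop) :=
  level_le N /\
  exists phi : frobLift, forall i x, (i <= N)%N -> Fil i x ->
    in_pV p i (@everything _) (Frob phi x).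

Definition perp (B : {biscalar H}) (S : H -> Prop) (x : H) :=
  forall y, S y -> B x y = 0.

Definition hodge_part (U Fil : nat -> H -> Prop) (i : nat) (x : H) :=
  U i x /\ Fil i x.

Record ordinary_CY3 (h : nat) (U Fil : nat -> H -> Prop) (B : {biscalar H}) :
    Prop := OrdinaryCY3 {
  cy_hodge : hodge_fcrystal Fil;
  cy_ordinary : ordinary;
  cy_slope : slope_filtration U;
  cy_divisible : divisible 3 Fil;
  cy_rank0 : free_of_rank (hodge_part U Fil 0) 1;
  cy_rank1 : free_of_rank (hodge_part U Fil 1) h;
  cy_rank2 : free_of_rank (hodge_part U Fil 2) h;
  cy_rank3 : free_of_rank (hodge_part U Fil 3) 1;
  cy_alternating : forall x, B x x = 0;
  cy_perfect : forall l : {scalar H}, exists! x, forall y, B x y = l y;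
  cy_nabla : forall x y,
    \row_i (B (nabla x i) y + B x (nabla y i)) = dform (B x y);
  cy_frob : forall (phi : frobLift) x y,
    B (Frob phi x) (Frob phi y) = phi (B x y) *+ p ^ 3;
  cy_perp3 : forall x, perp B (Fil 3) x <-> Fil 1 x;
  cy_perp2 : forall x, perp B (Fil 2) x <-> Fil 2 x
}.

(* The map T -> Hom(H^3, Fil^2 / Fil^3) = Hom(H^3, H^2) induced by nabla is
   bijective; the identification H^2 = Fil^2 / Fil^3 is the projection. *)
Definition kodaira_spencer_iso (U Fil : nat -> H -> Prop) :=
  (forall theta : {scalar Omega},
     (forall x, hodge_part U Fil 3 x -> Fil 3 (contract theta (nabla x))) ->
     forall w, theta w = 0) /\
  (forall g : H -> H, linear_on (hodge_part U Fil 3) g ->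
     (forall x, hodge_part U Fil 3 x -> hodge_part U Fil 2 (g x)) ->
     exists theta : {scalar Omega}, forall x, hodge_part U Fil 3 x ->
       Fil 3 (contract theta (nabla x) - g x)).

Definition is_matrix_of (r : nat) (e : 'I_r -> H) (f : H -> H) (M : 'M[A]_r) :=
  forall b, f (e b) = \sum_a M a b *: e a.

End Filtrations.

Definition toKT : A -> KT := mfps_map (@tofrac W).

(* The extension of sigma to K, computed on a representing fraction. *)
Definition frobK (x : K) : K :=
  let r := generic_quotient.repr x in
  tofrac (witt_frob (frac r).1) / tofrac (witt_frob (frac r).2).

(* g is the image psi(f) of f in K[[t]]: each coefficient of g is the p-adic
   sum, in K, of the corresponding coefficients of sigma(f_m) psi(t)^m. *)
Definition frob_image (psi : frobLift) (f g : KT) :=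
  forall l : 'X_{1.. n},
    p_sum p (fun x : K => exists w : W, x = tofrac w)
      (fun m => frobK (f m) *
                tofrac ((\prod_i psi (mfps_var W i) ^+ m i : A) l))
      (g l).

End Crystals.

Definition block4 (R : Type) (h : nat)
  (a11 : 'M[R]_1) (a12 : 'rV[R]_h) (a13 : 'rV[R]_h) (a14 : 'M[R]_1)
  (a21 : 'cV[R]_h) (a22 : 'M[R]_h) (a23 : 'M[R]_h) (a24 : 'cV[R]_h)
  (a31 : 'cV[R]_h) (a32 : 'M[R]_h) (a33 : 'M[R]_h) (a34 : 'cV[R]_h)
  (a41 : 'M[R]_1) (a42 : 'rV[R]_h) (a43 : 'rV[R]_h) (a44 : 'M[R]_1) :
  'M[R]_((1 + h) + (h + 1)) :=
  block_mx (block_mx a11 a12 a21 a22) (block_mx a13 a14 a23 a24)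
           (block_mx a31 a32 a41 a42) (block_mx a33 a34 a43 a44).

(* Main.v *)
(* Let phi be the lift t_i -> t_i^p. By Lang's theorem over k, lifted to W and
   then to W[[t]], a unit F-crystal has a basis fixed by phi, and phi-fixed
   vectors are horizontal. Since H = U_i (+) Fil^(i+1), these bases lift to a
   basis e of H adapted to the H^i; the entries of its Gram matrix are zero or
   phi-fixed, hence constant, and a change of e_0, ..., e_h by a constant matrix
   gives the Gram matrix G.

   The slopes of Frobenius being distinct, the equation T0 F0 = P sigma(T0) at
   the origin t = 0 has a solution T0 over K that is unipotent for the degree,
   with T0 G T0^T = G. The rows of T0 are functionals on the fibre at 0; their
   Taylor series extend them to horizontal functionals, whose values on e are
   the entries of T. They are eigenvectors of Frobenius for phi, and for every
   other lift psi by the expansion of chi(psi, phi). Finally dT = T w and the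
   symmetry of w for G make T G T^T constant, so T G T^T = G, which forces the
   shape of T.

   The last column of dT = T w says that d(T e_3) is a combination of the
   columns of index 2, with coefficients d tau_23; the symmetry of tau_12 then
   gives dZ = -2 tau_13 . d tau_23 and d tau_13 = tau_12 d tau_23. *)

Require Import Defs.
From HB Require Import structures.
From mathcomp Require Import all_boot all_order all_algebra boolp mpoly.
From mathcomp Require Import zify ring.

Set Implicit Arguments.
Unset Strict Implicit.
Unset Printing Implicit Defensive.

Import GRing.Theory VectorInternalTheory.
Local Open Scope ring_scope.

(** * Power series *)

(** The entries of [T] are Taylor series at the origin with coefficients ev(D^m e_b) / m!, where ev
    is given by a row of T0. They are integral up to a factor p^C m!, and these denominators shape
    the proof. For the standard lift they do no harm: each coefficient of the image of a series is 0
    or the conjugate of a single coefficient, so Frobenius identities follow by comparing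
    derivatives, by induction on the degree. For another lift psi, a coefficient of psi(f) is a
    genuine infinite sum. Expanding psi(t)^m around t^p gives a double series whose terms carry
    powers of p coming from psi(t) - t^p; against them the bound v_p(m!) <= |m| / 2, valid for p >
    2, leaves enough room to exchange the summations. Existence results (inverses in W, Lang's
    theorem, H = U_i + Fil^(i+1), equations in K) come from solving modulo p and correcting the
    error p-adically or t-adically. Vanishing results come from the opposite phenomenon: sigma
    preserves valuations, so sigma(x) p^a = x p^b with a <> b forces x = 0. *)

Section Series.
Variables (n : nat) (R : comNzRingType).
Implicit Types (f g : mfps n R) (m k l : 'X_{1.. n}).

Lemma mfpsD f g m : (f + g) m = f m + g m. Proof. by []. Qed.
Lemma mfpsN f m : (- f) m = - f m. Proof. by []. Qed.
Lemma mfpsB f g m : (f - g) m = f m - g m. Proof. by []. Qed.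
Lemma mfps0 m : (0 : mfps n R) m = 0.
Proof. exact: mul0rn. Qed.
Lemma mfps1 m : (1 : mfps n R) m = (m == 0%MM)%:R. Proof. by []. Qed.
Lemma mfpsMn f c m : (f *+ c) m = f m *+ c.
Proof. by elim: c => [|c IH]; rewrite ?mulr0n ?mfps0 // !mulrS mfpsD IH. Qed.
Lemma mfps_sum (I : Type) (r : seq I) (P : pred I) (F : I -> mfps n R) m :
  (\sum_(i <- r | P i) F i) m = \sum_(i <- r | P i) F i m.
Proof. by apply: (big_morph (fun f : mfps n R => f m)) => //; apply: mfps0. Qed.
Lemma mfps_constE (c : R) m : mfps_const n c m = c *+ (m == 0%MM).
Proof. by []. Qed.

Lemma mfps_mul_ind (P : R -> Prop) f g m :
  P 0 -> (forall x y, P x -> P y -> P (x + y)) ->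
  (forall k l, (k + l)%MM = m -> P (f k * g l)) -> P ((f * g) m).
Proof.
move=> P0 PD Pfg; apply: (big_ind P) => // -[k l] /= /eqP eq_m.
by apply: Pfg; apply: esym.
Qed.

Lemma eq_mfps_mul f f' g g' m :
  (forall k, (mdeg k <= mdeg m)%N -> f k = f' k) ->
  (forall k, (mdeg k <= mdeg m)%N -> g k = g' k) ->
  (f * g) m = (f' * g') m.
Proof.
move=> ff gg; apply: eq_bigr => -[k l] _ /=.
by rewrite ff ?gg // -ltnS bmdeg.
Qed.

Definition mfps_of_mpoly (P : {mpoly R[n]}) : mfps n R := fun m => P@_m.

Fact mfps_of_mpoly_is_zmod_morphism : zmod_morphism mfps_of_mpoly.
Proof. by move=> P Q; apply: funext => m; rewrite /mfps_of_mpoly mcoeffB. Qed.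
HB.instance Definition _ := GRing.isZmodMorphism.Build {mpoly R[n]} (mfps n R)
  mfps_of_mpoly mfps_of_mpoly_is_zmod_morphism.
Fact mfps_of_mpoly_is_monoid_morphism : monoid_morphism mfps_of_mpoly.
Proof.
split=> [|P Q]; apply: funext => m; first by rewrite /mfps_of_mpoly mcoeff1.
by rewrite [RHS](@mfps_mulE _ _ P Q).
Qed.
HB.instance Definition _ := GRing.isMonoidMorphism.Build {mpoly R[n]} (mfps n R)
  mfps_of_mpoly mfps_of_mpoly_is_monoid_morphism.

Definition mfps_mon m : mfps n R := mfps_of_mpoly 'X_[m].

Lemma mfps_monE m k : mfps_mon m k = (m == k)%:R.
Proof. exact: mcoeffX. Qed.
Lemma mfps_varE i : mfps_var R i = mfps_mon U_(i).
Proof. by apply: funext => m; rewrite mfps_monE eq_sym. Qed.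
Lemma mfps_var_prod m : \prod_i mfps_var R i ^+ m i = mfps_mon m.
Proof.
rewrite /mfps_mon mpolyXE_id rmorph_prod; apply: eq_bigr => i _.
by rewrite mfps_varE rmorphXn.
Qed.

Lemma mfps_const_mpoly (c : R) : mfps_const n c = mfps_of_mpoly c%:MP.
Proof. by apply: funext => m; rewrite /mfps_of_mpoly mcoeffC mulr_natr. Qed.
Fact mfps_const_is_zmod_morphism : zmod_morphism (@mfps_const n R).
Proof. by move=> a b; rewrite !mfps_const_mpoly mpolyCB rmorphB. Qed.
HB.instance Definition _ := GRing.isZmodMorphism.Build R (mfps n R)
  (@mfps_const n R) mfps_const_is_zmod_morphism.
Fact mfps_const_is_monoid_morphism : monoid_morphism (@mfps_const n R).
Proof. by split=> [//|a b]; rewrite !mfps_const_mpoly mpolyCM rmorphM. Qed.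
HB.instance Definition _ := GRing.isMonoidMorphism.Build R (mfps n R)
  (@mfps_const n R) mfps_const_is_monoid_morphism.

Lemma mfps_constM (c : R) f m : (mfps_const n c * f) m = c * f m.
Proof.
rewrite [LHS](@mfps_mulE _ _ c%:MP (mfps_trunc (mdeg m).+1 f)) ?mcoeffCM.
- by rewrite mfps_truncE.
- by move=> k _; rewrite mfps_const_mpoly.
- by move=> k km; rewrite mfps_truncE.
Qed.

Lemma mfps_monM m k f :
  (mfps_mon m * f) k = if (m <= k)%MM then f (k - m)%MM else 0.
Proof.
rewrite [LHS](@mfps_mulE _ _ 'X_[m] (mfps_trunc (mdeg k).+1 f)) //; last first.
  by move=> l lk; rewrite mfps_truncE.
rewrite mulrC; case: ifPn => [mk|mk].
  rewrite -{1}(submK mk) addmC mcoeffMX mfps_truncE //.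
  by rewrite ltnS mdegB.
rewrite mcoeffM big1 // => -[k1 k2] /= /eqP eq_k; rewrite mcoeffX.
case: eqP => [e|]; last by rewrite mulr0.
by case/negP: mk; rewrite eq_k e lem_addl.
Qed.

Definition mfps_coef0 f : R := f 0%MM.
Fact mfps_coef0_is_zmod_morphism : zmod_morphism mfps_coef0.
Proof. by []. Qed.
HB.instance Definition _ := GRing.isZmodMorphism.Build (mfps n R) R
  mfps_coef0 mfps_coef0_is_zmod_morphism.
Fact mfps_coef0_is_monoid_morphism : monoid_morphism mfps_coef0.
Proof.
split=> [|f g]; first by rewrite /mfps_coef0 mfps1 eqxx.
rewrite /mfps_coef0 [LHS](@mfps_mul_trunc _ _ 1%N) ?mdeg0 //.
by rewrite rmorphM /= !mfps_truncE ?mdeg0.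
Qed.
HB.instance Definition _ := GRing.isMonoidMorphism.Build (mfps n R) R
  mfps_coef0 mfps_coef0_is_monoid_morphism.

Lemma mfps_natM c f m : (c%:R * f) m = c%:R * f m.
Proof. by rewrite !mulr_natl mfpsMn. Qed.

Lemma mfps_derivE i f m : mfps_deriv i f m = f (m + U_(i))%MM *+ (m i).+1.
Proof. by []. Qed.
Fact mfps_deriv_is_zmod_morphism i : zmod_morphism (@mfps_deriv n R i).
Proof.
by move=> f g; apply: funext => m; rewrite mfpsB !mfps_derivE mfpsB mulrnBl.
Qed.
HB.instance Definition _ i := GRing.isZmodMorphism.Build (mfps n R) (mfps n R)
  (@mfps_deriv n R i) (mfps_deriv_is_zmod_morphism i).

Lemma mfps_deriv_mpoly i P :
  mfps_deriv i (mfps_of_mpoly P) = mfps_of_mpoly P^`M(i).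
Proof. by apply: funext => m; rewrite /mfps_of_mpoly mcoeff_deriv. Qed.

Lemma mfps_deriv_const i c : mfps_deriv i (mfps_const n c) = 0 :> mfps n R.
Proof. by rewrite mfps_const_mpoly mfps_deriv_mpoly mderivC rmorph0. Qed.

Lemma mfps_deriv_var j i : mfps_deriv j (mfps_var R i) = (i == j)%:R :> mfps n R.
Proof.
apply: funext => m; rewrite mfps_derivE /mfps_var.
have [->|ne_ij] := eqVneq i j.
  rewrite -[X in _ == X]add0m eqm_add2r mulr1n mfps1; case: eqP => [->|//].
    by rewrite mnm0E.
  by rewrite mul0rn.
rewrite mulr0n mfps0; case: eqP => [e|_]; last by rewrite mul0rn.
have := congr1 (fun l : 'X_{1..n} => l j) e.
by rewrite mnmDE !mnm1E eqxx (negPf ne_ij) addn1.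
Qed.

Lemma mfps_derivM i f g :
  mfps_deriv i (f * g) = mfps_deriv i f * g + f * mfps_deriv i g.
Proof.
(* The derivative reads coefficients of degree [mdeg m + 1], so the truncation keeps one degree more
   than for products. *)
apply: funext => m; set d := (mdeg m).+2.
pose F := mfps_trunc d f; pose G := mfps_trunc d g.
have EF h k : (mdeg k <= mdeg m)%N -> (mfps_trunc d h)@_k = h k.
  by move=> km; rewrite mfps_truncE // ltnS (leq_trans km).
have ED h k : (mdeg k <= mdeg m)%N -> (mfps_trunc d h)^`M(i)@_k = mfps_deriv i h k.
  by move=> km; rewrite mcoeff_deriv mfps_truncE // mdegD mdeg1 addn1 !ltnS.
rewrite mfps_derivE [X in X *+ _](@mfps_mul_trunc _ _ d) ?mdegD ?mdeg1 ?addn1 //.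
rewrite -mcoeff_deriv mderivM mcoeffD mfpsD.
by congr (_ + _); symmetry; apply: mfps_mulE => k km; rewrite ?EF ?ED.
Qed.

End Series.

Section Map.
Variables (n : nat) (R R' : comNzRingType) (s : {rmorphism R -> R'}).

Fact mfps_map_is_zmod_morphism : zmod_morphism (@mfps_map n R R' s).
Proof. by move=> f g; apply: funext => m; rewrite /mfps_map !mfpsB rmorphB. Qed.
HB.instance Definition _ := GRing.isZmodMorphism.Build (mfps n R) (mfps n R')
  (@mfps_map n R R' s) mfps_map_is_zmod_morphism.
Fact mfps_map_is_monoid_morphism : monoid_morphism (@mfps_map n R R' s).
Proof.
split=> [|f g]; apply: funext => m; rewrite /mfps_map.
  by rewrite !mfps1 rmorph_nat.
rewrite rmorph_sum; apply: eq_bigr => -[k l] _ /=; exact: rmorphM.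
Qed.
HB.instance Definition _ := GRing.isMonoidMorphism.Build (mfps n R) (mfps n R')
  (@mfps_map n R R' s) mfps_map_is_monoid_morphism.

Lemma mfps_map_deriv i (f : mfps n R) :
  mfps_map s (mfps_deriv i f) = mfps_deriv i (mfps_map s f).
Proof. by apply: funext => m; rewrite /mfps_map !mfps_derivE rmorphMn. Qed.
End Map.

(** * The substitution t_i -> t_i^p, semilinear on coefficients *)

Section StandardFrobenius.
Variables (n p : nat) (R : comNzRingType) (s : {rmorphism R -> R}).
Hypothesis p_gt0 : (0 < p)%N.
Implicit Types (f g : mfps n R) (m k l : 'X_{1.. n}).

Definition mnm_div m : 'X_{1.. n} := [multinom (m i %/ p)%N | i < n].
Definition mnm_dvd m := (mnm_div m *+ p)%MM == m.

Lemma mnm_divK m : mnm_div (m *+ p)%MM = m.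
Proof. by apply/mnmP => i; rewrite mnmE mulmnE mulnK. Qed.
Lemma mnm_dvdP m : reflect (exists k, m = (k *+ p)%MM) (mnm_dvd m).
Proof.
apply: (iffP eqP) => [<-|[k ->]]; first by eexists.
by rewrite mnm_divK.
Qed.
Lemma mdeg_div m : (mdeg (mnm_div m) <= mdeg m)%N.
Proof. by rewrite !mdegE leq_sum // => i _; rewrite mnmE leq_div. Qed.

(** This is the sum of the s(f_m) t^(p m), given by its coefficients so that no convergence is
    involved. *)
Definition mfps_frob f : mfps n R :=
  fun m => if mnm_dvd m then s (f (mnm_div m)) else 0.

Lemma mfps_frobMp f m : mfps_frob f (m *+ p)%MM = s (f m).
Proof. by rewrite /mfps_frob /mnm_dvd mnm_divK eqxx. Qed.

Lemma mfps_frob_coef0 f : mfps_frob f 0%MM = s (f 0%MM).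
Proof.
rewrite -[in LHS](_ : (0 *+ p)%MM = 0%MM) ?mfps_frobMp //.
by apply/mnmP => i; rewrite mulmnE !mnm0E.
Qed.

(** On polynomials the substitution is a ring morphism by [mmap]; multiplicativity of [mfps_frob] is
    inherited by truncation. *)
Let Phi : {mpoly R[n]} -> {mpoly R[n]} :=
  mmap ((@mpolyC n R) \o s) (fun i => 'X_i ^+ p).

Let PhiE P m : (Phi P)@_m = mfps_frob (mfps_of_mpoly P) m.
Proof.
elim/mpolyind: P m => [|c k P _ _ IH] m.
  by rewrite /Phi mmap0 /mfps_frob /mfps_of_mpoly !mcoeff0 rmorph0 if_same.
rewrite /Phi mmapD mcoeffD -/(Phi P) IH mmapZ mmapX mcoeffCM.
rewrite /mmap1 (eq_bigr (fun i => 'X_i ^+ (k *+ p)%MM i)); last first.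
  by move=> i _; rewrite -exprM mulmnE mulnC.
rewrite -mpolyXE_id mcoeffX /mfps_frob /mfps_of_mpoly.
rewrite mcoeffD mcoeffZ mcoeffX rmorphD rmorphM rmorph_nat /=.
case: ifPn => [/mnm_dvdP[l ->]|nd].
  rewrite mnm_divK; congr (s c * _%:R + _); congr nat_of_bool.
  by apply/eqP/eqP => [/(congr1 mnm_div)|->//]; rewrite !mnm_divK.
rewrite addr0; case: eqP nd => [<-|]; last by rewrite mulr0.
by case/negP; apply/mnm_dvdP; exists k.
Qed.

Let PhiT f d m : (mdeg m < d)%N -> (Phi (mfps_trunc d f))@_m = mfps_frob f m.
Proof.
move=> md; rewrite PhiE /mfps_frob /mfps_of_mpoly; case: ifP => // _.
by rewrite mfps_truncE // (leq_ltn_trans (mdeg_div m)).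
Qed.

Fact mfps_frob_is_zmod_morphism : zmod_morphism mfps_frob.
Proof.
move=> f g; apply: funext => m; rewrite mfpsB /mfps_frob.
by case: ifP => _; rewrite ?subr0 // mfpsB rmorphB.
Qed.
HB.instance Definition _ := GRing.isZmodMorphism.Build (mfps n R) (mfps n R)
  mfps_frob mfps_frob_is_zmod_morphism.
Fact mfps_frob_is_monoid_morphism : monoid_morphism mfps_frob.
Proof.
split=> [|f g]; apply: funext => m.
  rewrite /mfps_frob !mfps1 rmorph_nat; case: ifPn => [/mnm_dvdP[l ->]|].
    rewrite mnm_divK; congr (nat_of_bool _)%:R.
    by rewrite -!mdeg_eq0 mdegMn muln_eq0 (gtn_eqF p_gt0) orbF.
  case: eqP => // -> /negP[]; apply/mnm_dvdP; exists 0%MM.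
  by apply/mnmP => i; rewrite mulmnE !mnm0E.
set d := (mdeg m).+1.
rewrite [RHS](@mfps_mulE _ _ (Phi (mfps_trunc d f)) (Phi (mfps_trunc d g)));
  try by move=> k km; apply: PhiT.
have -> : Phi (mfps_trunc d f) * Phi (mfps_trunc d g)
          = Phi (mfps_trunc d f * mfps_trunc d g).
  by rewrite /Phi rmorphM.
rewrite PhiE /mfps_frob; case: ifP => // _; congr (s _).
by rewrite [LHS](@mfps_mul_trunc _ _ d) // ltnS mdeg_div.
Qed.

(** Chain rule for t_j -> t_j^p. The factor p is what makes Frobenius contract derivatives. *)
Lemma mfps_frob_deriv j f :
  mfps_deriv j (mfps_frob f)
  = p%:R * mfps_mon R (U_(j) *+ p.-1)%MM * mfps_frob (mfps_deriv j f).
Proof.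
apply: funext => m; rewrite -mulrA mfps_natM mfps_monM mfps_derivE.
have pP : p = p.-1.+1 by rewrite prednK.
have eqU k : ((k + U_(j)) *+ p = k *+ p + U_(j) *+ p.-1 + U_(j))%MM.
  apply/mnmP => i; rewrite !(mulmnE, mnmDE, mnm1E).
  by rewrite mulnDl [in X in (_ + X)%N = _]pP mulnS addnA addnAC.
case dvd_m: (mnm_dvd (m + U_(j))%MM); last first.
  rewrite {1}/mfps_frob dvd_m mul0rn; case: ifP => [le_m|]; last by rewrite mulr0.
  rewrite /mfps_frob; case: ifP => [/mnm_dvdP[k eq_k]|]; last by rewrite mulr0.
  case/mnm_dvdP: dvd_m; exists (k + U_(j))%MM.
  by rewrite eqU -eq_k submK.
have /mnm_dvdP[k eq_k] := dvd_m.
have kj : (U_(j) <= k)%MM.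
  rewrite lep1mP; apply/eqP => kj0; move/mnmP/(_ j): eq_k.
  by rewrite mnmDE mnm1E eqxx mulmnE kj0 addn1.
move: eq_k; rewrite -(submK kj); set k' := (k - _)%MM.
rewrite eqU => /addIm ->; rewrite lem_addl addmK -eqU !mfps_frobMp mfps_derivE.
rewrite rmorphMn /= mulr_natl -mulrnA; congr (_ *+ _).
by rewrite !(mulmnE, mnmDE, mnm1E) eqxx mul1n -addnS prednK // mulSn addnC.
Qed.

End StandardFrobenius.

(** * p-adic completeness and Witt vectors *)

Section PadicModules.
Variable p : nat.

(** Only series of the form sum of u_i p^i are required to converge. This is what successive
    approximation produces, and it passes to series and matrices entry by entry. *)
Definition p_complete (V : zmodType) := forall u : nat -> V, exists s, forall N,
  exists y, s - \sum_(i < N) u i *+ p ^ i = y *+ p ^ N.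
Definition p_separated (V : zmodType) := forall x : V,
  (forall N, exists y, x = y *+ p ^ N) -> x = 0.
Definition p_torsionfree (V : zmodType) := forall x : V, x *+ p = 0 -> x = 0.

Lemma p_torsionfreeX (V : zmodType) N (x y : V) :
  p_torsionfree V -> x *+ p ^ N = y *+ p ^ N -> x = y.
Proof.
move=> tf; elim: N x y => [|N IH] x y; first by rewrite expn0.
rewrite expnSr !mulrnA => /eqP; rewrite -subr_eq0 -mulrnBl => /eqP /tf /eqP.
by rewrite subr_eq0 => /eqP /IH.
Qed.

(* Correct the error at precision p^N, for N = 0, 1, 2, ..., and pass to the
   limit. *)
Lemma p_adic_surj (V V' : zmodType) (E : {additive V -> V'}) :
  p_complete V -> p_separated V' ->
  (forall c, exists y c', c = E y + c' *+ p) -> forall c, exists y, E y = c.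
Proof.
move=> compl sep surj c.
have /choice[step stepP] : forall c, exists yc : V * V', c = E yc.1 + yc.2 *+ p.
  by move=> d; have [y [d' ->]] := surj d; exists (y, d').
pose cs i := iter i (fun d => (step d).2) c.
have csP N : c = E (\sum_(i < N) (step (cs i)).1 *+ p ^ i) + cs N *+ p ^ N.
  elim: N => [|N IH]; first by rewrite big_ord0 raddf0 add0r.
  rewrite big_ord_recr raddfD /= raddfMn -addrA expnS mulrnA -mulrnDl.
  by rewrite -stepP -IH.
have [s sP] := compl (fun i => (step (cs i)).1).
exists s; apply: subr0_eq; apply: sep => N.
have [y yP] := sP N; exists (E y - cs N).
rewrite {1}(csP N) opprD addrA -raddfB yP.
by rewrite raddfMn mulrnBl.
Qed.

Lemma mfps_complete n (R : comNzRingType) :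
  p_complete R -> p_complete (mfps n R).
Proof.
move=> compl u.
have /choice[s sP] : forall m, exists c, forall N, exists y,
    c - \sum_(i < N) u i m *+ p ^ i = y *+ p ^ N by move=> m; apply: (compl (fun i => u i m)).
exists (s : mfps n R) => N.
have /choice[y yP] := fun m => sP m N; exists (y : mfps n R).
apply: funext => m; rewrite mfpsB mfpsMn -yP mfps_sum.
by congr (_ - _); apply: eq_bigr => i _; rewrite mfpsMn.
Qed.

Lemma mfps_separated n (R : comNzRingType) :
  p_separated R -> p_separated (mfps n R).
Proof.
move=> sep f fP; apply: funext => m; rewrite mfps0; apply: sep => N.
by have [g ->] := fP N; exists (g m); rewrite mfpsMn.
Qed.

Lemma mfps_torsionfree n (R : comNzRingType) :
  p_torsionfree R -> p_torsionfree (mfps n R).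
Proof.
move=> tf f fP; apply: funext => m; rewrite mfps0; apply: tf.
by rewrite -mfpsMn fP mfps0.
Qed.

Lemma mx_complete r r' (V : zmodType) : p_complete V -> p_complete 'M[V]_(r, r').
Proof.
move=> compl u.
have /choice[s sP] : forall ij : 'I_r * 'I_r', exists c, forall N, exists y,
    c - \sum_(i < N) u i ij.1 ij.2 *+ p ^ i = y *+ p ^ N.
  by move=> ij; apply: (compl (fun i => u i ij.1 ij.2)).
exists (\matrix_(i, j) s (i, j)) => N.
have /choice[y yP] := fun ij => sP ij N; exists (\matrix_(i, j) y (i, j)).
apply/matrixP => i j; rewrite !mxE mulmxnE mxE -yP /= summxE.
by congr (_ - _); apply: eq_bigr => l _; rewrite mulmxnE.
Qed.

Lemma mx_separated r r' (V : zmodType) :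
  p_separated V -> p_separated 'M[V]_(r, r').
Proof.
move=> sep f fP; apply/matrixP => i j; rewrite mxE; apply: sep => N.
by have [g ->] := fP N; exists (g i j); rewrite mulmxnE.
Qed.

Lemma mx_torsionfree r r' (V : zmodType) :
  p_torsionfree V -> p_torsionfree 'M[V]_(r, r').
Proof.
move=> tf f fP; apply/matrixP => i j; rewrite mxE; apply: tf.
by rewrite -mulmxnE fP mxE.
Qed.

End PadicModules.

Section Witt.
Variables (p : nat) (p_prime : prime p).
Variables (k : fieldType) (char_k : p \in [pchar k]) (W : wittRing p k).
Local Notation K := {fraction W}.
Let p_gt0 : (0 < p)%N := prime_gt0 p_prime.

Lemma witt_torsionfree : p_torsionfree p W.
Proof.
move=> x /eqP; rewrite -mulr_natr mulf_eq0 (negPf (witt_p_neq0 W)) orbF.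
by move/eqP.
Qed.

Lemma witt_p_separated : p_separated p W.
Proof. exact: witt_separated. Qed.

Lemma witt_p_complete : p_complete p W.
Proof.
move=> u; pose v N := \sum_(i < N) u i *+ p ^ i.
have vP N i : (N <= i)%N -> exists y, v i - v N = y *+ p ^ N.
  elim: i => [|i IH]; rewrite leq_eqVlt => /orP[/eqP ->|].
  - by exists 0; rewrite subrr mul0rn.
  - by [].
  - by exists 0; rewrite subrr mul0rn.
  rewrite ltnS => Ni; have [y yP] := IH Ni; exists (y + u i *+ p ^ (i - N)).
  rewrite /v big_ord_recr /= addrAC yP mulrnDl -mulrnA -expnD.
  by rewrite subnK.
have [|l lP] := @witt_complete p k W v.
  move=> N; exists N => i j Ni Nj.
  have [[y yP] [z zP]] := (vP _ _ Ni, vP _ _ Nj); exists (y - z).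
  by rewrite mulrnBl -yP -zP opprB addrA addrNK.
exists l => N; have [M MP] := lP N.
have [y yP] := MP _ (leq_maxl M N); have [z zP] := vP _ _ (leq_maxr M N).
exists (z - y); rewrite mulrnBl -yP -zP opprB addrC.
by rewrite [RHS]addrC addrA addrNK addrC.
Qed.

Lemma witt_red_p (x : W) : witt_red (x *+ p) = 0 :> k.
Proof. by rewrite rmorphMn /= mulrn_pchar. Qed.

(** W is local: multiplication by x is onto modulo p, hence onto by [p_adic_surj]. *)
Lemma witt_unitP (x : W) : witt_red x != 0 -> exists y, y * x = 1.
Proof.
move=> x0; pose E y := y * x.
have addE : zmod_morphism E by move=> a b; rewrite /E mulrBl.
pose addEM := GRing.isZmodMorphism.Build _ _ E addE.
pose EA : {additive W -> W} := HB.pack E addEM.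
apply: (@p_adic_surj p _ _ EA witt_p_complete witt_p_separated) => c.
have [y yP] := witt_red_surj W (witt_red c / witt_red x).
have [c'] : exists c', c - E y = c' *+ p.
  by apply/witt_red_ker; rewrite rmorphB rmorphM yP divfK // subrr.
by move=> c'P; exists y, c'; rewrite -c'P addrC subrK.
Qed.

Lemma witt_decomp (x : W) : x != 0 -> exists v u u', u' * u = 1 /\ x = u *+ p ^ v.
Proof.
move=> x0.
have ex : exists N, ~~ `[< exists y, x = y *+ p ^ N >].
  apply/not_existsP => all; case/eqP: x0; apply: witt_separated => N.
  by have /negP := all N; rewrite negbK => /asboolP.
(* The least N such that p^N does not divide x is positive; its predecessor v is the valuation of
   x. *)
case: (ex_minnP ex) => -[|v] /asboolPn vP vmin; first by case: vP; exists x; rewrite expn0.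
have /asboolP[y yP] : `[< exists y, x = y *+ p ^ v >].
  by apply: contraT => /vmin; rewrite ltnn.
have [|u' u'P] := @witt_unitP y.
  apply/eqP => /witt_red_ker[z zP]; case: vP; exists z.
  by rewrite yP zP expnS mulrnA.
by exists v, y, u'.
Qed.

Lemma witt_natP N : coprime N p -> exists y : W, y * N%:R = 1.
Proof.
move=> cop; apply: witt_unitP; rewrite rmorph_nat.
by rewrite -(dvdn_pcharf char_k) -prime_coprime // coprime_sym.
Qed.

(** The prime-to-p part of N is invertible in W, so dividing by N costs at most p^(v_p N). *)
Lemma witt_nat_decomp N : (0 < N)%N -> exists w : W, w * N%:R = p%:R ^+ logn p N.
Proof.
move=> N0; have [y yP] : exists y : W, y * (N`_p^')%:R = 1.
  apply: witt_natP; rewrite coprime_sym prime_coprime //.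
  by rewrite -p'natE // part_pnat.
exists y; rewrite -{1}(partnC p N0) mulnC natrM mulrA yP mul1r p_part.
by rewrite natrX.
Qed.

Lemma witt_nat_neq0 N : (0 < N)%N -> N%:R != 0 :> W.
Proof.
move=> /witt_nat_decomp[w wP]; apply/eqP => N0; move/eqP: wP.
by rewrite N0 mulr0 eq_sym expf_eq0 (negPf (witt_p_neq0 W)) andbF.
Qed.

Lemma fracK_nat_neq0 N : (0 < N)%N -> N%:R != 0 :> K.
Proof. by move=> /witt_nat_neq0; rewrite -tofrac_eq0 rmorph_nat. Qed.

(** If sigma(x) = 0 then x is 0 modulo p and x / p is again killed by sigma; so x is divisible by
    all powers of p. *)
Lemma witt_frob_inj : injective (@witt_frob p k W).
Proof.
apply: raddf_inj => x x0; apply: witt_separated => N.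
elim: N x x0 => [|N IH] x x0; first by exists x; rewrite expn0.
have [y yP] : exists y, x = y *+ p.
  apply/witt_red_ker; have /eqP := witt_frobP x.
  by rewrite x0 rmorph0 eq_sym expf_eq0 => /andP[_ /eqP].
have [|z zP] := IH y; last by exists z; rewrite yP zP expnS mulnC mulrnA.
by apply: witt_torsionfree; rewrite -rmorphMn -yP.
Qed.

Lemma frac_reprE (x : K) : let r := generic_quotient.repr x in
  x = FracField.tofrac (frac r).1 / FracField.tofrac (frac r).2.
Proof.
move=> r; rewrite -[LHS]generic_quotient.reprK -/r.
have eq_r : FracField.mulf (Ratio (frac r).1 1) (FracField.invf (Ratio (frac r).2 1)) = r.
  rewrite /FracField.mulf /FracField.invf !numden_Ratio ?oner_neq0 ?denom_ratioP //.
  by rewrite mulr1 mul1r Ratio_numden.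
unlock FracField.tofrac.
by rewrite -[X in _ = _ * X]FracField.pi_inv -[RHS]FracField.pi_mul eq_r.
Qed.

(** K = W[1/p], since every nonzero denominator is a unit times a power of p. *)
Lemma frac_pE (x : K) : exists N (w : W), x *+ p ^ N = FracField.tofrac w.
Proof.
rewrite [x]frac_reprE; set r := generic_quotient.repr x.
have [v [u [u' [uu' ->]]]] := witt_decomp (denom_ratioP r).
have uu : FracField.tofrac u != 0.
  rewrite tofrac_eq0; apply: contra_eq_neq uu' => ->.
  by rewrite mulr0 eq_sym oner_neq0.
exists v, ((frac r).1 * u'); have eq_u : FracField.tofrac u' = (FracField.tofrac u)^-1.
  by apply: (mulIf uu); rewrite mulVf // -rmorphM uu' rmorph1.
rewrite -[LHS]mulr_natr tofracM eq_u tofracMn -[FracField.tofrac u *+ _]mulr_natr.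
rewrite -mulrA invfM -mulrA mulVf ?mulr1 //.
by rewrite fracK_nat_neq0 // expn_gt0 p_gt0.
Qed.

(** Independence of the representative chosen in [frobK]; injectivity of sigma keeps the
    denominators nonzero. *)
Lemma frobK_frac (a b : W) : b != 0 ->
  frobK (FracField.tofrac a / FracField.tofrac b)
  = FracField.tofrac (witt_frob a) / FracField.tofrac (witt_frob b).
Proof.
move=> b0; pose x := FracField.tofrac a / FracField.tofrac b.
rewrite -/x /frobK; set r := generic_quotient.repr x.
have fr0 (c : W) : c != 0 -> FracField.tofrac (witt_frob c) != 0.
  by move=> c0; rewrite tofrac_eq0 raddf_eq0 //; apply: witt_frob_inj.
have d0 := denom_ratioP r.
have : x = _ := frac_reprE x; rewrite -/r => /eqP.
rewrite /x eqr_div ?tofrac_eq0 // -!tofracM tofrac_eq => /eqP e.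
apply/eqP; rewrite eqr_div ?fr0 // -!tofracM tofrac_eq -!rmorphM /=.
by rewrite eq_sym e.
Qed.

Lemma frobK_tofrac (a : W) :
  frobK (FracField.tofrac a) = FracField.tofrac (witt_frob a).
Proof.
have := @frobK_frac a 1 (oner_neq0 _).
by rewrite !rmorph1 !divr1.
Qed.

Fact frobK_is_zmod_morphism : zmod_morphism (@frobK p k W).
Proof.
move=> x y; rewrite [x]frac_reprE [y]frac_reprE.
set r := generic_quotient.repr x; set r' := generic_quotient.repr y.
have [d0 d0'] := (denom_ratioP r, denom_ratioP r').
rewrite -mulNr addf_div ?tofrac_eq0 // -!rmorphN -!rmorphM -rmorphD.
rewrite !frobK_frac ?mulf_neq0 // -mulNr addf_div.
- by rewrite -!rmorphN -!rmorphM -rmorphD /= -!rmorphN -!rmorphM -rmorphD.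
- by rewrite tofrac_eq0 raddf_eq0 //; apply: witt_frob_inj.
- by rewrite tofrac_eq0 raddf_eq0 //; apply: witt_frob_inj.
Qed.

Fact frobK_is_monoid_morphism : monoid_morphism (@frobK p k W).
Proof.
split=> [|x y].
  by rewrite -(rmorph1 (@FracField.tofrac W)) frobK_tofrac !rmorph1.
rewrite [x]frac_reprE [y]frac_reprE.
set r := generic_quotient.repr x; set r' := generic_quotient.repr y.
have [d0 d0'] := (denom_ratioP r, denom_ratioP r').
rewrite mulf_div -!rmorphM !frobK_frac ?mulf_neq0 //.
by rewrite mulf_div -!rmorphM.
Qed.

HB.instance Definition _ := GRing.isZmodMorphism.Build K K (@frobK p k W)
  frobK_is_zmod_morphism.
HB.instance Definition _ := GRing.isMonoidMorphism.Build K K (@frobK p k W)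
  frobK_is_monoid_morphism.

(** If x is nonzero, then up to powers of p it is a unit u of W with sigma(u) p^a = u p^b.
    Cancelling the smaller power and reducing modulo p would make u vanish in k. *)
Lemma frobK_pow_uniq (a b : nat) (x : K) :
  a != b -> frobK x *+ p ^ a = x *+ p ^ b -> x = 0.
Proof.
have [N [w wP]] := frac_pE x => neq_ab eq_x.
have [w0|w0] := eqVneq w 0.
  move/eqP: wP; rewrite w0 rmorph0 -mulr_natr mulf_eq0.
  by rewrite (negPf (fracK_nat_neq0 _)) ?expn_gt0 ?p_gt0 // orbF => /eqP.
have [v [u [u' [uu' eq_w]]]] := witt_decomp w0.
have eq_u : witt_frob u *+ p ^ a = u *+ p ^ b :> W.
  apply: (@p_torsionfreeX p _ v _ _ witt_torsionfree).
  rewrite -!mulrnA ![(_ * p ^ v)%N]mulnC !mulrnA -rmorphMn -eq_w.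
  apply/eqP; rewrite -tofrac_eq !tofracMn -frobK_tofrac -wP /= rmorphMn /=.
  by rewrite -!mulrnA ![(p ^ N * _)%N]mulnC !mulrnA eq_x.
have ru : witt_red u != 0 :> k.
  apply/eqP => u0; have := rmorph1 (@witt_red p k W).
  by rewrite -uu' rmorphM u0 mulr0 => /eqP; rewrite eq_sym oner_eq0.
case: ltngtP neq_ab => // lt_ab _.
  have : witt_frob u = u *+ p ^ (b - a) :> W.
    apply: (@p_torsionfreeX p _ a _ _ witt_torsionfree).
    by rewrite eq_u -mulrnA -expnD subnK // ltnW.
  move/(congr1 (@witt_red p k W)); rewrite witt_frobP -(subnSK lt_ab) expnS.
  rewrite mulnC mulrnA witt_red_p => /eqP; rewrite expf_eq0 => /andP[_].
  by rewrite (negPf ru).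
have : u = witt_frob u *+ p ^ (a - b) :> W.
  apply: (@p_torsionfreeX p _ b _ _ witt_torsionfree).
  by rewrite -eq_u -mulrnA -expnD subnK // ltnW.
move/(congr1 (@witt_red p k W)); rewrite -(subnSK lt_ab) expnS.
by rewrite mulnC mulrnA witt_red_p => /eqP; rewrite (negPf ru).
Qed.

(** At m <> 0 the coefficient is 0 or the conjugate of the coefficient at m / p, whose degree is
    smaller. *)
Lemma mfps_frob_fixed n (f : mfps n W) : mfps_frob p witt_frob f = f ->
  f = mfps_const n (f 0%MM).
Proof.
move=> fix_f; apply: funext => m; rewrite mfps_constE.
have [->|m0] := eqVneq m 0%MM; first by rewrite mulr1n.
rewrite mulr0n; have [d] := ubnP (mdeg m); elim: d => // d IH in m m0 *.
rewrite ltnS => md; rewrite -fix_f /mfps_frob; case: ifP => // /eqP dvd_m.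
have m'0 : mnm_div p m != 0%MM.
  by apply: contra_neq m0 => e; apply/eqP; rewrite -mdeg_eq0 -dvd_m mdegMn e mdeg0.
rewrite IH ?rmorph0 // (leq_trans _ md) // -{2}dvd_m mdegMn.
by rewrite ltn_Pmulr ?prime_gt1 // lt0n mdeg_eq0.
Qed.

Lemma redA_eq0 n (f : mfps n W) : redA f = 0 -> exists g, f = g *+ p.
Proof.
move=> f0; have /choice[g gP] : forall m, exists y, f m = y *+ p.
  move=> m; apply/witt_red_ker.
  by move: (congr1 (fun g : mfps n k => g m) f0); rewrite mfps0.
by exists (g : mfps n W); apply: funext => m; rewrite mfpsMn.
Qed.

End Witt.

Section WittClosed.
Variables (p : nat) (p_prime : prime p).
Variables (k : closedFieldType) (char_k : p \in [pchar k]) (W : wittRing p k).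
Local Notation K := {fraction W}.
Let p_gt0 : (0 < p)%N := prime_gt0 p_prime.

Lemma closed_pth_root (a : k) : exists x, x ^+ p = a.
Proof.
have /closed_rootP[x] : size ('X^p - a%:P) != 1.
  by rewrite size_XnsubC // eqSS -lt0n.
by rewrite rootE !hornerE subr_eq0 => /eqP; exists x.
Qed.

(** Powers of p are fixed by sigma, so the denominator of r can be cleared. Over W, d > 0 reduces
    the equation modulo p to the extraction of a p-th root, possible as k is closed; successive
    approximation does the rest. *)
Lemma frobK_affine (d : nat) (r : K) : (0 < d)%N ->
  exists y, frobK y = y *+ p ^ d + r.
Proof.
move=> d_gt0; have [N [w wP]] := frac_pE p_prime char_k r.
pose E y : W := witt_frob y - y *+ p ^ d.
have addE : zmod_morphism E.
  by move=> a b; rewrite /E rmorphB mulrnBl; ring.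
pose addEM := GRing.isZmodMorphism.Build _ _ E addE.
pose EA : {additive W -> W} := HB.pack E addEM.
have [c|y yP] := @p_adic_surj p _ _ EA (@witt_p_complete p k W) (@witt_p_separated p k W) _ w.
  have [a aP] := closed_pth_root (witt_red c).
  have [y yP] := witt_red_surj W a.
  have [c' c'P] : exists c', c - E y = c' *+ p.
    apply/witt_red_ker; rewrite !rmorphB /= witt_frobP yP aP.
    by rewrite -(prednK d_gt0) expnSr mulrnA witt_red_p // subr0 subrr.
  by exists y, c'; rewrite -c'P addrC subrK.
have pN0 : (p ^ N)%:R != 0 :> K.
  by rewrite (fracK_nat_neq0 p_prime char_k) // expn_gt0 p_gt0.
exists (FracField.tofrac y / (p ^ N)%:R).
rewrite rmorphM fmorphV rmorph_nat /= frobK_tofrac.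
apply: (mulIf pN0); rewrite mulrDl mulrnAl !divfK // mulr_natr wP -yP.
by rewrite -rmorphMn -rmorphD /EA /= /E addrC subrK.
Qed.
End WittClosed.

Lemma logn_fact_half p N : prime p -> (2 < p)%N -> ((logn p N`!).*2 <= N)%N.
Proof.
move=> p_prime p_gt2; rewrite logn_fact //.
(* The extra term N / p^M in Legendre's sum makes the induction close: for q = N / p^M, the next
   step needs 3 (q / p) <= q, which holds as p > 2. *)
suff bound M : ((\sum_(1 <= j < M.+1) N %/ p ^ j).*2 + N %/ p ^ M <= N)%N.
  by apply: leq_trans (bound N); apply: leq_addr.
elim: M => [|M IH]; first by rewrite big_geq // expn0 divn1.
apply: leq_trans IH; rewrite big_nat_recr //= doubleD -addnA leq_add2l.
rewrite expnSr divnMA; set q := (N %/ p ^ M)%N.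
rewrite -addnn -addnA.
apply: leq_trans (leq_divM q p).
by rewrite mulnC; move: (q %/ p)%N => r; nia.
Qed.

(** * The standard lift of Frobenius *)

Section FrobeniusPower.
Variables (n p : nat) (k : fieldType) (char_k : p \in [pchar k]).
Let p_gt0 : (0 < p)%N := prime_gt0 (pcharf_prime char_k).

Lemma mfps_exp_trunc (R : comNzRingType) (f : mfps n R) d j m :
  (mdeg m < d)%N -> (f ^+ j) m = (mfps_trunc d f ^+ j)@_m.
Proof.
elim: j m => [|j IH] m md; first by rewrite !expr0 mcoeff1.
rewrite !exprS; apply: mfps_mulE => l lm; have ld := leq_ltn_trans lm md.
  by rewrite mfps_truncE.
by rewrite IH.
Qed.

Lemma mfps_exp_pchar (f : mfps n k) :
  f ^+ p = mfps_frob p (pFrobenius_aut char_k) f.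
Proof.
apply: funext => m; set d := (mdeg m).+1.
rewrite (@mfps_exp_trunc _ f d) //.
have char_P : p \in [pchar {mpoly k[n]}] by apply: (rmorph_pchar (@mpolyC n k)).
rewrite -(pFrobenius_autE char_P) /mfps_trunc raddf_sum (raddf_sum (mcoeff m)) /=.
rewrite (eq_bigr (fun l : 'X_{1..n < d} => f l ^+ p * ((l : 'X_{1..n}) *+ p == m)%MM%:R)).
  rewrite /mfps_frob; case: ifPn => [/(mnm_dvdP p_gt0)[l eq_m]|nd].
    have ld : (mdeg l < d)%N.
      by rewrite ltnS eq_m mdegMn leq_pmulr.
    rewrite {}eq_m mnm_divK // (bigD1 (BMultinom ld)) //= eqxx mulr1.
    rewrite big1 ?addr0 ?pFrobenius_autE // => l' ne_l.
    case: eqP => [|_]; last by rewrite mulr0.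
    move=> /(congr1 (mnm_div p)); rewrite !mnm_divK // => e.
    by case/eqP: ne_l; apply: val_inj.
  rewrite big1 // => l _; case: eqP => [e|_]; last by rewrite mulr0.
  by case/negP: nd; apply/(mnm_dvdP p_gt0); exists l.
move=> l _; rewrite pFrobenius_autE exprZn mpolyXn mcoeffZ mcoeffX //.
Qed.
End FrobeniusPower.

Section StandardLift.
Variables (p : nat) (k : fieldType) (char_k : p \in [pchar k]) (W : wittRing p k).
Variable n : nat.
Let p_gt0 : (0 < p)%N := prime_gt0 (pcharf_prime char_k).
Local Notation A := (mfps n W).

Definition std_frob : A -> A := mfps_frob p (@witt_frob p k W).
Let std_frob_additive := GRing.isZmodMorphism.Build A A std_frob
  (mfps_frob_is_zmod_morphism p witt_frob).
Let std_frob_multiplicative := GRing.isMonoidMorphism.Build A A std_frob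
  (mfps_frob_is_monoid_morphism n witt_frob p_gt0).
Definition std_frob_rmorphism : {rmorphism A -> A} :=
  HB.pack std_frob std_frob_additive std_frob_multiplicative.

Fact std_frob_const (w : W) :
  std_frob (mfps_const n w) = mfps_const n (witt_frob w).
Proof.
apply: funext => m; rewrite /std_frob /mfps_frob !mfps_constE.
case: ifPn => [/(mnm_dvdP p_gt0)[l ->]|].
  by rewrite mnm_divK // rmorphMn -!mdeg_eq0 mdegMn muln_eq0 (gtn_eqF p_gt0) orbF.
case: eqP => [->|]; last by rewrite mulr0n.
case/negP; apply/(mnm_dvdP p_gt0); exists 0%MM.
by apply/mnmP => i; rewrite mulmnE !mnm0E.
Qed.

Fact std_frob_red (a : A) : redA (std_frob a) = redA a ^+ p.
Proof.
rewrite (mfps_exp_pchar char_k); apply: funext => m.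
rewrite /redA /mfps_map /std_frob /mfps_frob; case: ifP => _.
  exact: witt_frobP.
by rewrite rmorph0.
Qed.

Definition std_lift : frobLift W n :=
  @FrobLift p k W n std_frob_rmorphism std_frob_const std_frob_red.

Lemma std_lift_var i : std_lift (mfps_var W i) = mfps_mon W (U_(i) *+ p)%MM.
Proof.
rewrite mfps_varE; apply: funext => m.
rewrite /= /std_frob /mfps_frob !mfps_monE; case: ifPn => [/(mnm_dvdP p_gt0)[l ->]|].
  rewrite mnm_divK // rmorph_nat; congr (nat_of_bool _)%:R.
  by apply/eqP/eqP => [->//|/(congr1 (mnm_div p))]; rewrite !mnm_divK.
by case: eqP => [<- /negP[]|//]; apply/(mnm_dvdP p_gt0); exists U_(i)%MM.
Qed.

(** Only the j-th component of nabla x contributes in direction j, since phi(t_i) = t_i^p involves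
    no other variable. *)
Lemma nabla_std_frob (H : fcrystal W n) x j :
  nabla (Frob std_lift x) j
  = (p%:R * mfps_mon W (U_(j) *+ p.-1)%MM) *: Frob std_lift (nabla (x : H) j).
Proof.
rewrite /Frob (frob_horizontal std_lift x) /frob_tens sum_ffunE.
rewrite (bigD1 j) //= big1 => [|i ne_ij]; last first.
  rewrite ffunE mxE /= /std_frob mfps_frob_deriv // mfps_deriv_var (negPf ne_ij).
  by rewrite raddf0 mulr0 scale0r.
rewrite addr0 ffunE mxE /= /std_frob mfps_frob_deriv // mfps_deriv_var eqxx.
by rewrite (mfps_frob_is_monoid_morphism n witt_frob p_gt0).1 mulr1.
Qed.

End StandardLift.

(** * Lang's theorem and unit F-crystals *)

Section Lang.
Variables (p : nat) (k : closedFieldType) (char_k : p \in [pchar k]).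
Let p_prime : prime p := pcharf_prime char_k.
Let p_gt0 : (0 < p)%N := prime_gt0 p_prime.
Let p_gt1 : (1 < p)%N := prime_gt1 p_prime.
Local Notation F := (pFrobenius_aut char_k).

Lemma artin_schreier (c : k) : exists y, y ^+ p - y = c.
Proof.
have /closed_rootP[x] : size ('X^p - ('X + c%:P)) != 1.
  by rewrite size_polyDl size_polyXn ?eqSS -?lt0n // size_polyN size_XaddC ltnS.
rewrite rootE !hornerE opprD addrA subr_eq0 => /eqP <-.
by exists x.
Qed.

Lemma artin_schreier_mx r r' (C : 'M[k]_(r, r')) :
  exists Y, map_mx F Y - Y = C.
Proof.
have /choice[y yP] := fun ij : 'I_r * 'I_r' => artin_schreier (C ij.1 ij.2).
exists (\matrix_(i, j) y (i, j)); apply/matrixP => i j.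
by rewrite !mxE pFrobenius_autE yP.
Qed.

Section FixedVector.
Variables (r : nat) (M : 'M[k]_r.+1).
Hypothesis unitM : M \in unitmx.

Let Fv (x : 'rV[k]_r.+1) := map_mx F x *m M.
Let v i := iter i Fv (delta_mx 0 0).
Let V m := \matrix_(i < m) v i.

Let Fv_neq0 x : x != 0 -> Fv x != 0.
Proof.
apply: contra_neq => Fx0; have : map_mx F x = 0.
  by rewrite -[LHS](mulmxK unitM) [_ *m M]Fx0 mul0mx.
by move=> e; apply: (@map_mx_inj _ _ F); rewrite e map_mx0.
Qed.

Let v_neq0 i : v i != 0.
Proof.
elim: i => [|i IH]; last exact: Fv_neq0.
by apply/negP => /eqP/matrixP/(_ 0 0)/eqP; rewrite !mxE !eqxx oner_eq0.
Qed.

(** The orbit of the first basis vector under the semilinear map [Fv] becomes dependent; v_(m+1) is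
    the first vector in the span of its predecessors. *)
Let v_relation : exists m, row_free (V m.+1) /\
  exists a : nat -> k, v m.+1 = \sum_(i < m.+1) a i *: v i.
Proof.
have ex : exists m, ~~ row_free (V m).
  exists r.+2; rewrite -row_leq_rank -ltnNge ltnS.
  exact: rank_leq_col.
case: (ex_minnP ex) => m nfree min_m.
case: m nfree min_m => [|[|m]] nfree min_m.
- by case/negP: nfree; rewrite -row_leq_rank.
- case/negP: nfree; apply/row_freeP; apply/row_freeP.
  rewrite /row_free eqn_leq rank_leq_row lt0n mxrank_eq0.
  apply: contra_neq (v_neq0 0%N) => /(congr1 (row 0)).
  by rewrite rowK row0.
have free : row_free (V m.+1).
  by apply: contraT => /min_m; rewrite ltnn.
exists m; split=> //.
have : kermx (V m.+2) != 0 by rewrite kermx_eq0.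
case/rowV0Pn => u /sub_kermxP uV u0.
have uV' : \sum_(i < m.+2) u 0 i *: v i = 0.
  by rewrite -[RHS]uV mulmx_sum_row; apply: eq_bigr => i _; rewrite rowK.
move: uV'; rewrite big_ord_recr /= => uV'.
have um0 : u 0 ord_max != 0.
  apply: contraNneq u0 => um0; move: uV'; rewrite um0 scale0r addr0 => uV'.
  have : (\row_(i < m.+1) u 0 (widen_ord (leqnSn _) i)) *m V m.+1 = 0.
    by rewrite -[RHS]uV' mulmx_sum_row; apply: eq_bigr => i _; rewrite rowK !mxE.
  move/eqP; rewrite mulmx_free_eq0 // => /eqP/rowP u0.
  apply/eqP/rowP => i; rewrite mxE; case: (unliftP ord_max i) => [j|] ->//.
  have := u0 j; rewrite !mxE => <-; congr (u 0 _); apply: val_inj.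
  by rewrite /= /bump leqNgt ltn_ord.
exists (fun i => - (u 0 ord_max)^-1 * u 0 (inord i)).
apply: (scalerI um0); rewrite scaler_sumr.
move/eqP: uV'; rewrite addrC addr_eq0 => /eqP ->.
rewrite -sumrN; apply: eq_bigr => i _; rewrite scalerA mulrA mulrN divff //.
rewrite mulN1r scaleNr; congr (- (u 0 _ *: _)); apply: val_inj.
by rewrite /= inordK // (leq_trans (ltn_ord i)).
Qed.

(* For x = sum_(i <= m) b_i v_i and v_(m+1) = sum_(i <= m) a_i v_i, the equation
   F(x) M = x is b_0 = a_0 c^p, b_(i+1) = b_i^p + a_(i+1) c^p with c = b_m; it
   is solved by b_i = h_i(c) c^p, and c = b_m becomes h_m(c) c^(p-1) = 1. *)
Let h (a : nat -> k) := fix h i : {poly k} :=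
  if i is j.+1 then h j ^+ p * 'X^(p * p - p) + (a j.+1)%:P else (a 0%N)%:P.

(** Serves to show that the equation for c is not constant. Evaluation at 0 isolates a_m, because
    p^2 - p > 0; what remains is a p-th power times a monomial. *)
Let h_eq0 a m : h a m = 0 -> forall i, (i <= m)%N -> a i = 0.
Proof.
have pp0 : (0 < p * p - p)%N by rewrite subn_gt0 ltn_Pmulr.
elim: m => [|m IH] /= h0 i.
  by rewrite leqn0 => /eqP ->; apply/eqP; rewrite -polyC_eq0 h0.
have am : a m.+1 = 0.
  have := congr1 (horner^~ 0) h0; rewrite !hornerE.
  by rewrite expr0n gtn_eqF // mulr0 add0r.
move: h0; rewrite am addr0 => /eqP; rewrite mulf_eq0 expf_eq0 p_gt0 /=.
rewrite (negPf (monic_neq0 (monicXn _ _))) orbF => /eqP h0.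
by rewrite leq_eqVlt => /orP[/eqP ->//|]; rewrite ltnS; apply: IH.
Qed.

Lemma frobenius_fixed_vector :
  exists2 x : 'rV[k]_r.+1, x != 0 & map_mx F x *m M = x.
Proof.
have [m [free [a va]]] := v_relation.
have /closed_rootP[c] : size (h a m * 'X^(p.-1) - 1) != 1.
  (* A constant polynomial would equal -1, its value at 0; then h_m and all the a_i would vanish,
     and so would v_(m+1), although [Fv] preserves nonzero vectors. *)
  apply/negP => /eqP sz.
  have p10 : (0 < p.-1)%N by rewrite -subn1 subn_gt0.
  have /size1_polyC eq_c : (size (h a m * 'X^(p.-1) - 1)%R <= 1)%N by rewrite sz.
  have c1 : (h a m * 'X^(p.-1) - 1)`_0 = -1.
    by rewrite coefB coefMXn p10 coef1 sub0r.
  move/eqP: eq_c; rewrite c1 polyCN subr_eq addNr mulf_eq0.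
  rewrite (negPf (monic_neq0 (monicXn _ _))) orbF => /eqP /h_eq0 a0.
  case/eqP: (v_neq0 m.+1); rewrite va big1 // => i _.
  by rewrite a0 ?scale0r // -ltnS.
rewrite rootE !hornerE subr_eq0 => /eqP hc.
pose b i := (h a i).[c] * c ^+ p.
have c0 : c != 0.
  apply: contra_eq_neq hc => ->.
  by rewrite expr0n -subn1 subn_eq0 leqNgt p_gt1 mulr0 eq_sym oner_neq0.
have bm : b m = c by rewrite /b -(prednK p_gt0) exprSr mulrA hc mul1r.
have b0 : b 0%N = a 0%N * c ^+ p by rewrite /b /= hornerC.
have bS i : b i.+1 = b i ^+ p + a i.+1 * c ^+ p.
  rewrite /b /= !hornerE mulrDl exprMn -exprM -mulrA -exprD.
  by rewrite subnK // leq_pmulr.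
exists (\sum_(i < m.+1) b i *: v i).
  have -> : \sum_(i < m.+1) b i *: v i = (\row_(i < m.+1) b i) *m V m.+1.
    by rewrite mulmx_sum_row; apply: eq_bigr => i _; rewrite rowK mxE.
  rewrite mulmx_free_eq0 //; apply: contra_neq c0 => /rowP/(_ ord_max).
  by rewrite !mxE /= bm.
rewrite raddf_sum mulmx_suml /=.
rewrite (eq_bigr (fun i : 'I_m.+1 => b i ^+ p *: v i.+1)); last first.
  by move=> i _; rewrite map_mxZ -scalemxAl.
have -> : \sum_(i < m.+1) b i ^+ p *: v i.+1 =
    \sum_(i < m) b i ^+ p *: v i.+1 + b m ^+ p *: v m.+1 by rewrite big_ord_recr.
have -> : \sum_(i < m) b i ^+ p *: v i.+1 =
    \sum_(i < m.+1) (if nat_of_ord i is j.+1 then b j ^+ p else 0) *: v i.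
  by rewrite big_ord_recl scale0r add0r.
rewrite bm va scaler_sumr.
rewrite -big_split; apply: eq_bigr => -[[|i] lt_im] _ /=.
  by rewrite scale0r add0r scalerA b0 mulrC.
by rewrite bS scalerA scalerDl [c ^+ p * _]mulrC.
Qed.
End FixedVector.

(** Induction on the size. A fixed vector, completed to an invertible Y, makes F(Y) M Y^-1 block
    triangular with first row (1, 0). The smaller block is solved by induction and the remaining
    column w by Artin-Schreier equations. If X' solves the new equation, X' Y solves the original
    one. *)
Lemma lang r (M : 'M[k]_r) : M \in unitmx ->
  exists2 X, X \in unitmx & map_mx F X *m M = X.
Proof.
elim: r M => [|r IH] M unitM.
  by exists 1%:M; [exact: unitmx1 | apply/matrixP => -[]].
have [x x0 xP] := frobenius_fixed_vector unitM.
have [Y [unitY Yx]] : exists Y : 'M[k]_(1 + r), Y \in unitmx /\ usubmx Y = x.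
  have rx : \rank x = 1%N by rewrite rank_rV x0.
  pose Y0 : 'M_(1 + r) := row_ebase x.
  exists (block_mx (col_ebase x) 0 0 1%:M *m Y0); split.
    rewrite unitmx_mul row_ebase_unit andbT unitmxE det_lblock det1 mulr1.
    by rewrite -unitmxE col_ebase_unit.
  rewrite -[RHS](mulmx_ebase x) rx -[Y0 in LHS]vsubmxK mul_block_col.
  rewrite col_mxKu mul0mx addr0 -mulmxA; congr (_ *m _).
  have -> : pid_mx 1 = row_mx 1%:M 0 :> 'M[k]_(1, 1 + r) by exact: pid_mx_row.
  have usub (Y : 'M[k]_(1 + r)) : usubmx Y = row_mx 1%:M 0 *m Y.
    by rewrite -{2}(vsubmxK Y) mul_row_col mul1mx mul0mx addr0.
  exact: usub.
pose M' : 'M_(1 + r) := map_mx F Y *m M *m invmx Y.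
have unitM' : M' \in unitmx.
  by rewrite !unitmx_mul map_unitmx unitY unitM unitmx_inv.
have uM' : usubmx M' = row_mx 1%:M 0.
  have -> : usubmx M' = usubmx (map_mx F Y) *m M *m invmx Y.
    by rewrite !mul_usub_mx.
  rewrite -map_usubmx Yx xP -Yx mul_usub_mx mulmxV //.
  by rewrite -[LHS]/(usubmx (1%:M : 'M_(1 + r))) scalar_mx_block block_mxEv col_mxKu.
have eM' : M' = block_mx 1%:M 0 (dlsubmx M') (drsubmx M').
  by rewrite -{1}(vsubmxK M') uM' -{1}(hsubmxK (dsubmx M')).
have [|X1 unitX1 X1P] := IH (drsubmx M').
  by move: unitM'; rewrite eM' !unitmxE det_lblock det1 mul1r block_mxKdr.
have [w wP] := artin_schreier_mx (- (map_mx F X1 *m dlsubmx M')).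
pose X' : 'M_(1 + r) := block_mx 1%:M 0 w X1.
have X'P : map_mx F X' *m M' = X'.
  rewrite /X' map_block_mx map_mx1 map_mx0 eM' mulmx_block !mul1mx !mul0mx.
  rewrite !mulmx1 !addr0 mulmx0 add0r X1P; congr block_mx.
  by apply/eqP; rewrite -subr_eq0 addrAC wP addNr.
have unitX' : X' \in unitmx by rewrite unitmxE det_lblock det1 mul1r -unitmxE.
exists (X' *m Y); first by rewrite unitmx_mul unitY andbT.
by rewrite map_mxM -{2}X'P /M' !mulmxA mulmxKV.
Qed.

End Lang.

(** * Fixed points and inverses for matrices of power series *)

Section MatrixSeries.
Variables (n : nat) (R : comNzRingType).

(** Fixed point theorem for the t-adic topology: the coefficients of degree d are stationary from
    the iterate d + 1 on. *)
Lemma mx_series_fixpoint a b (Phi : 'M[mfps n R]_(a, b) -> 'M[mfps n R]_(a, b)) :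
  (forall d (X Y : 'M_(a, b)),
     (forall i j (m : 'X_{1..n}), (mdeg m < d)%N -> X i j m = Y i j m) ->
     forall i j (m : 'X_{1..n}), (mdeg m <= d)%N -> Phi X i j m = Phi Y i j m) ->
  exists X, Phi X = X.
Proof.
move=> contr; pose X i := iter i Phi 0.
have step d i j m : (mdeg m < d)%N -> X d.+1 i j m = X d i j m.
  elim: d i j m => // d IH i j m; rewrite ltnS => md.
  exact: (contr d (X d.+1) (X d)).
have stab e d i j m : (mdeg m < d)%N -> (d <= e)%N -> X e i j m = X d i j m.
  move=> md; elim: e => [|e IH]; first by rewrite leqn0 => /eqP ->.
  rewrite leq_eqVlt => /orP[/eqP ->//|]; rewrite ltnS => de.
  by rewrite step ?IH // (leq_trans md).
exists (\matrix_(i, j) ((fun m => X (mdeg m).+1 i j m) : mfps n R)).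
apply/matrixP => i j; apply: funext => m; rewrite mxE.
apply: (contr (mdeg m)) => // i' j' m' m'm; rewrite mxE.
by rewrite -(stab (mdeg m)).
Qed.

Lemma mxM_series_eq a b c (X X' : 'M[mfps n R]_(a, b)) (Y Y' : 'M[mfps n R]_(b, c)) d :
  (forall i j (m : 'X_{1..n}), (mdeg m <= d)%N -> X i j m = X' i j m) ->
  (forall i j (m : 'X_{1..n}), (mdeg m <= d)%N -> Y i j m = Y' i j m) ->
  forall i j (m : 'X_{1..n}), (mdeg m <= d)%N -> (X *m Y) i j m = (X' *m Y') i j m.
Proof.
move=> eqX eqY i j m md; rewrite !mxE !mfps_sum; apply: eq_bigr => l _.
by apply: eq_mfps_mul => m' m'm; rewrite ?eqX ?eqY // (leq_trans m'm).
Qed.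

(** Geometric series: D = 1 - X Z' has zero constant term, so V = 1 + D V has a solution, and V
    inverts 1 - D = X Z'. *)
Lemma unitmx_series r (X : 'M[mfps n R]_r) (Z : 'M[R]_r) :
  map_mx (@mfps_coef0 n R) X *m Z = 1%:M -> exists Y, X *m Y = 1%:M.
Proof.
move=> XZ; pose Z' := map_mx (@mfps_const n R) Z.
pose D := 1%:M - X *m Z'.
have D0 i j : D i j 0%MM = 0.
  have Z'0 : map_mx (@mfps_coef0 n R) Z' = Z.
    by apply/matrixP => a b; rewrite !mxE /mfps_coef0 mfps_constE eqxx.
  have : map_mx (@mfps_coef0 n R) D = 0.
    by rewrite /D map_mxB map_mx1 map_mxM Z'0 XZ subrr.
  by move/matrixP/(_ i j); rewrite mxE [RHS]mxE.
have [|V VP] := @mx_series_fixpoint r r (fun V => 1%:M + D *m V).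
  move=> d V V' eqV i j m md; rewrite !(mxE _ _ i j) !mfpsD !mfps_sum.
  congr (_ + _); apply: eq_bigr => l _.
  have split_mul (f g g' : mfps n R) : f 0%MM = 0 ->
      (forall m', (mdeg m' < d)%N -> g m' = g' m') -> (f * g) m = (f * g') m.
    move=> f0 gg; apply/eqP; rewrite -subr_eq0 -mfpsB -mulrBr; apply/eqP.
    apply: (@mfps_mul_ind _ _ (fun x => x = 0)) => [//|x y -> ->|k' l' kl].
      by rewrite addr0.
    have [->|k0] := eqVneq k' 0%MM; first by rewrite f0 mul0r.
    rewrite mfpsB gg ?subrr ?mulr0 // (leq_trans _ md) //.
    by rewrite -kl mdegD -[X in (X < _)%N]add0n ltn_add2r lt0n mdeg_eq0.
  by apply: split_mul => [|m' m'd]; [apply: D0 | apply: eqV].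
exists (Z' *m V); rewrite mulmxA.
have -> : X *m Z' = 1%:M - D by rewrite /D opprB addrC subrK.
by rewrite mulmxBl mul1mx -{1}VP addrK.
Qed.

End MatrixSeries.

(** * Lang's theorem over W and over W[[t]] *)

Section FixedMatrices.
Variables (p : nat) (k : closedFieldType) (char_k : p \in [pchar k]).
Variables (W : wittRing p k) (n : nat).
Let p_prime : prime p := pcharf_prime char_k.
Let p_gt1 : (1 < p)%N := prime_gt1 p_prime.
Local Notation A := (mfps n W).
Local Notation F := (pFrobenius_aut char_k).
Local Notation red := (@witt_red p k W).

Lemma map_red_frob r r' (X : 'M[W]_(r, r')) :
  map_mx red (map_mx witt_frob X) = map_mx F (map_mx red X).
Proof. by apply/matrixP => i j; rewrite !mxE; apply: witt_frobP. Qed.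

Lemma mx_red_eq0 r r' (X : 'M[W]_(r, r')) :
  map_mx red X = 0 -> exists Y, X = Y *+ p.
Proof.
move=> X0; have /choice[y yP] : forall ij : 'I_r * 'I_r', exists y, X ij.1 ij.2 = y *+ p.
  move=> ij; apply/witt_red_ker.
  by move/matrixP/(_ ij.1 ij.2): X0; rewrite !mxE.
exists (\matrix_(i, j) y (i, j)); apply/matrixP => i j.
by rewrite mulmxnE mxE -yP.
Qed.

Lemma mx_red_surj r r' (X : 'M[k]_(r, r')) : exists Y : 'M[W]_(r, r'), map_mx red Y = X.
Proof.
have /choice[y yP] := fun ij : 'I_r * 'I_r' => witt_red_surj W (X ij.1 ij.2).
by exists (\matrix_(i, j) y (i, j)); apply/matrixP => i j; rewrite !mxE yP.
Qed.

Lemma unitmx_witt r (X : 'M[W]_r) : map_mx red X \in unitmx -> X \in unitmx.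
Proof.
rewrite !unitmxE det_map_mx unitfE => /witt_unitP[y yP].
by apply/unitrPr; exists y; rewrite mulrC.
Qed.

(** A solution X1 modulo p is lifted arbitrarily to X0, with error p D, and corrected by p Y. The
    correction solves the additive equation sigma(Y) M - Y = -D; modulo p the substitution Y = Y' X1
    turns it into Artin-Schreier equations for the entries of Y'. *)
Lemma lang_witt r (M : 'M[W]_r) : map_mx red M \in unitmx ->
  exists2 X, X \in unitmx & map_mx witt_frob X *m M = X.
Proof.
move=> unitM; have [X1 unitX1 X1P] := lang char_k unitM.
have [X0 X0P] := mx_red_surj X1.
pose E (Y : 'M[W]_r) := map_mx witt_frob Y *m M - Y.
have addE : zmod_morphism E.
  by move=> a b; rewrite /E map_mxB mulmxBl !opprD !opprK addrACA.
pose addEM := GRing.isZmodMorphism.Build _ _ E addE.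
pose EA : {additive 'M[W]_r -> 'M[W]_r} := HB.pack E addEM.
have redE Y : map_mx red (E Y) = map_mx F (map_mx red Y) *m map_mx red M - map_mx red Y.
  by rewrite /E map_mxB map_mxM map_red_frob.
have [D DP] : exists D, E X0 = D *+ p.
  by apply: mx_red_eq0; rewrite redE X0P X1P subrr.
have [C|Y YP] := @p_adic_surj p _ _ EA (mx_complete (@witt_p_complete p k W))
    (mx_separated (@witt_p_separated p k W)) _ (- D).
  have [Y' Y'P] := artin_schreier_mx char_k (map_mx red C *m invmx X1).
  have [Y YP] := mx_red_surj (Y' *m X1).
  have [C' C'P] : exists C', C - E Y = C' *+ p.
    apply: mx_red_eq0; rewrite map_mxB redE YP map_mxM -mulmxA X1P -mulmxBl Y'P.
    by rewrite mulmxKV // subrr.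
  by exists Y, C'; rewrite -C'P addrC subrK.
exists (X0 + Y *+ p).
  apply: unitmx_witt; rewrite map_mxD X0P.
  suff -> : map_mx red (Y *+ p) = 0 by rewrite addr0.
  by apply/matrixP => i j; rewrite !mxE mulmxnE witt_red_p.
suff : EA (X0 + Y *+ p) = 0 by move/subr0_eq.
by rewrite raddfD raddfMn YP [EA X0]DP mulNrn subrr.
Qed.

(** The constant term is given by the case of W; the higher coefficients come from a t-adic fixed
    point, as t -> t^p strictly raises positive degrees. *)
Lemma lang_series r (M : 'M[A]_r) : M \in unitmx ->
  exists2 X, X \in unitmx & map_mx (@std_frob p k W n) X *m M = X.
Proof.
move=> unitM; have unitM0 : map_mx red (map_mx (@mfps_coef0 n W) M) \in unitmx.
  suff /mulmx1_unit[] : map_mx red (map_mx (@mfps_coef0 n W) M)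
      *m map_mx red (map_mx (@mfps_coef0 n W) (invmx M)) = 1%:M by [].
  by rewrite -!map_mxM mulmxV // !map_mx1.
have [X0 unitX0 X0P] := lang_witt unitM0.
(* In degree 0 Frobenius does not raise the degree and contraction fails; [Y0] therefore imposes the
   constant term X0. *)
pose Y0 (Y : 'M[A]_r) : 'M[A]_r :=
  \matrix_(i, j) ((fun m => if m == 0%MM then X0 i j else Y i j m) : A).
have frob_mx Y i j m : map_mx (@std_frob p k W n) (Y0 Y) i j m =
    if mnm_dvd p m then witt_frob (Y0 Y i j (mnm_div p m)) else 0 by rewrite mxE.
have [|Y YP] := @mx_series_fixpoint n W r r
    (fun Y => map_mx (@std_frob p k W n) (Y0 Y) *m M).
  move=> d Y Y' eqY i j m md; apply: (@mxM_series_eq _ _ _ _ _ _ _ _ _ d) => //.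
  move=> {md}i {}j {}m md; rewrite !frob_mx; case: ifP => // /eqP dvd_m.
  rewrite !mxE; case: eqP => // /eqP m0; rewrite eqY //.
  apply: leq_trans md; rewrite -{2}dvd_m mdegMn ltn_Pmulr //.
  by rewrite lt0n mdeg_eq0.
have Y00 : Y0 Y = Y.
  apply/matrixP => i j; apply: funext => m; rewrite mxE; case: eqP => // ->.
  rewrite -YP mxE mfps_sum; move/matrixP/(_ i j): X0P => {1}<-.
  rewrite mxE; apply: eq_bigr => l _.
  rewrite -[RHS]/(mfps_coef0 _) rmorphM /= /mfps_coef0 frob_mx !mxE /mnm_dvd.
  have -> : mnm_div p (0%MM : 'X_{1..n}) = 0%MM.
    by apply/mnmP => i'; rewrite mnmE !mnm0E div0n.
  by rewrite eqxx -mdeg_eq0 mdegMn mdeg0.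
exists Y; last by rewrite -{2}YP Y00.
have [|Z ZP] := @unitmx_series n W r Y (invmx X0); last by case/mulmx1_unit: ZP.
suff -> : map_mx (@mfps_coef0 n W) Y = X0 by rewrite mulmxV.
by apply/matrixP => i j; rewrite -Y00 !mxE /mfps_coef0 eqxx.
Qed.

End FixedMatrices.

(** * Flat fixed bases of unit F-crystals *)

Section UnitCrystal.
Variables (p : nat) (k : closedFieldType) (char_k : p \in [pchar k]).
Variables (W : wittRing p k) (n : nat).
Let p_prime : prime p := pcharf_prime char_k.
Local Notation A := (mfps n W).
Local Notation phi := (std_lift char_k W n).

Lemma mod_separated (H : vectType A) : p_separated p H.
Proof.
move=> x xP; apply: (can_inj (@v2rK _ H)); rewrite linear0.
apply: (mx_separated (mfps_separated (@witt_p_separated p k W))) => N.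
by have [y ->] := xP N; exists (v2r y); rewrite raddfMn.
Qed.

Lemma mod_torsionfree (H : vectType A) : p_torsionfree p H.
Proof.
move=> x xP; apply: (can_inj (@v2rK _ H)); rewrite linear0.
apply: (mx_torsionfree (mfps_torsionfree (@witt_torsionfree p k W))).
by rewrite -raddfMn xP raddf0.
Qed.

Lemma FrobD (H : fcrystal W n) (psi : frobLift W n) (x y : H) :
  Frob psi (x + y) = Frob psi x + Frob psi y.
Proof. by rewrite /Frob /pull linearD map_mxD linearD. Qed.

Lemma FrobZ (H : fcrystal W n) (psi : frobLift W n) a (x : H) :
  Frob psi (a *: x) = psi a *: Frob psi x.
Proof. by rewrite /Frob /pull linearZ map_mxZ linearZ. Qed.

Fact Frob_is_zmod_morphism (H : fcrystal W n) (psi : frobLift W n) :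
  zmod_morphism (@Frob p k W n H psi).
Proof.
by move=> x y; rewrite FrobD -scaleN1r FrobZ rmorphN1 scaleN1r.
Qed.
HB.instance Definition _ (H : fcrystal W n) (psi : frobLift W n) :=
  GRing.isZmodMorphism.Build H H (@Frob p k W n H psi)
  (Frob_is_zmod_morphism psi).

(* If nabla x is divisible by p^N, then by p^(N+1), since phi(dt_j) is divisible
   by p. *)
Lemma std_fixed_horizontal (H : fcrystal W n) (x : H) j :
  Frob phi x = x -> nabla x j = 0.
Proof.
move=> fix_x; apply: mod_separated => N.
elim: N => [|N [y yP]]; first by exists (nabla x j); rewrite expn0.
exists (mfps_mon W (U_(j) *+ p.-1)%MM *: Frob phi y).
rewrite -{1}fix_x nabla_std_frob yP raddfMn /= -scalerA scalerMnr.
by rewrite scaler_nat scalerMnr -mulrnA expnSr.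
Qed.

(** If phi(X) M = X for the matrix M of F(phi), the rows of X are the coordinates of fixed vectors;
    X being invertible, they form a basis. *)
Lemma unit_crystal_basis (V : fcrystal W n) : unit_fcrystal V ->
  exists v : 'I_(dim V) -> V, [/\ is_basis (@everything V) v,
    forall b, Frob phi (v b) = v b & forall b j, nabla (v b) j = 0].
Proof.
move=> /(_ phi)[g gK Kg].
pose M := \matrix_i v2r (frob V phi (delta_mx 0 i)).
have frobE z : v2r (frob V phi z) = z *m M.
  rewrite {1}[z]row_sum_delta !linear_sum /= mulmx_sum_row.
  by apply: eq_bigr => i _; rewrite !linearZ rowK.
have unitM : M \in unitmx.
  suff /mulmx1_unit[] : (\matrix_i (g (r2v (delta_mx 0 i)))) *m M = 1%:M by [].
  apply/row_matrixP => i; rewrite row_mul rowK -frobE Kg r2vK.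
  by rewrite row1.
have [X unitX XP] := lang_series char_k unitM.
pose v b := r2v (row b X) : V.
have fix_v b : Frob phi (v b) = v b.
  apply: (can_inj (@v2rK _ V)); rewrite /Frob frobE /pull /v r2vK.
  by rewrite map_row -row_mul XP.
exists v; split=> //; last by move=> b j; apply: std_fixed_horizontal.
have sumv c : v2r (\sum_j c j *: v j) = (\row_j c j) *m X.
  rewrite linear_sum mulmx_sum_row; apply: eq_bigr => i _.
  by rewrite linearZ /= r2vK mxE.
split=> [x|c c0 j]; first split=> // _.
  exists (fun j => (v2r x *m invmx X) 0 j); apply: (can_inj (@v2rK _ V)).
  rewrite sumv (_ : \row_j _ = v2r x *m invmx X) ?mulmxKV //.
  by apply/rowP => j; rewrite mxE.
have := sumv c; rewrite c0 linear0 => /(congr1 (mulmx^~ (invmx X))).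
by rewrite mul0mx mulmxK // => /rowP/(_ j); rewrite !mxE.
Qed.

End UnitCrystal.

(** * Ordinary Hodge F-crystals *)

Section Submodules.
Variables (R : comNzRingType) (V : lmodType R).
Implicit Types S : V -> Prop.

Definition is_submodule S := S 0 /\ forall a x y, S x -> S y -> S (a *: x + y).

Section Closure.
Variables (S : V -> Prop) (subS : is_submodule S).
Lemma submodule0 : S 0. Proof. by case: subS. Qed.
Lemma submoduleD x y : S x -> S y -> S (x + y).
Proof. by move=> Sx Sy; rewrite -[x]scale1r; apply: subS.2. Qed.
Lemma submoduleZ a x : S x -> S (a *: x).
Proof. by move=> Sx; rewrite -[_ *: _]addr0; apply: subS.2 => //; apply: submodule0. Qed.
Lemma submoduleN x : S x -> S (- x).
Proof. by rewrite -scaleN1r; apply: submoduleZ. Qed.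
Lemma submoduleB x y : S x -> S y -> S (x - y).
Proof. by move=> Sx Sy; apply: submoduleD => //; apply: submoduleN. Qed.
Lemma submoduleMn x N : S x -> S (x *+ N).
Proof. by rewrite -scaler_nat; apply: submoduleZ. Qed.
Lemma submodule_sum (I : Type) (r : seq I) (P : pred I) (F : I -> V) :
  (forall i, P i -> S (F i)) -> S (\sum_(i <- r | P i) F i).
Proof.
by move=> SF; apply: (big_ind S) => //; [apply: submodule0 | apply: submoduleD].
Qed.
End Closure.

Lemma free_is_submodule S : free_submodule S -> is_submodule S.
Proof.
case=> r [e [span _]]; split.
  apply/span; exists (fun _ => 0); rewrite big1 // => i _; exact: scale0r.
move=> a x y /span[c ->] /span[d ->]; apply/span.
exists (fun j => a * c j + d j); rewrite scaler_sumr -big_split.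
by apply: eq_bigr => i _; rewrite /= scalerA -scalerDl.
Qed.

Lemma zero_is_submodule : is_submodule (@zero_sub V).
Proof. by split=> // a x y -> ->; rewrite /zero_sub scaler0 addr0. Qed.

Lemma is_basis_mem S r (e : 'I_r -> V) : is_basis S e -> forall j, S (e j).
Proof.
move=> [span _] j; apply/span; exists (fun l => (l == j)%:R).
rewrite (bigD1 j) //= eqxx scale1r big1 ?addr0 // => l /negPf ->.
exact: scale0r.
Qed.

Lemma basis_coord_uniq S r (e : 'I_r -> V) (c d : 'I_r -> R) : is_basis S e ->
  \sum_j c j *: e j = \sum_j d j *: e j -> c =1 d.
Proof.
move=> [_ free] /eqP; rewrite -subr_eq0 -sumrB => /eqP.
under eq_bigr do rewrite -scalerBl.
by move/free => cd j; apply/eqP; rewrite -subr_eq0; apply/eqP/cd.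
Qed.

Lemma basis_matrix S r s (e : 'I_r -> V) (e' : 'I_s -> V) :
  is_basis S e -> (forall j, S (e' j)) ->
  exists C : 'M[R]_(s, r), forall j, e' j = \sum_l C j l *: e l.
Proof.
move=> [span _] Se'.
have /choice[c cP] : forall j, exists c : 'I_r -> R, e' j = \sum_l c l *: e l.
  by move=> j; apply/span.
by exists (\matrix_(j, l) c j l) => j; rewrite cP; apply: eq_bigr => l _; rewrite mxE.
Qed.

Lemma matrix_comp r s q (C : 'M[R]_(s, r)) (D : 'M[R]_(q, s)) (e : 'I_r -> V) i :
  \sum_j D i j *: (\sum_l C j l *: e l) = \sum_l (D *m C) i l *: e l.
Proof.
under eq_bigr do rewrite scaler_sumr.
rewrite exchange_big; apply: eq_bigr => l _; rewrite mxE scaler_suml.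
by apply: eq_bigr => j _; rewrite scalerA.
Qed.

Lemma basis_matrix1 S r (e : 'I_r -> V) (C : 'M[R]_r) : is_basis S e ->
  (forall i, e i = \sum_l C i l *: e l) -> C = 1%:M.
Proof.
move=> basis_e eC; apply/matrixP => i j; rewrite mxE.
apply: (basis_coord_uniq (c := C i) (d := fun l => (i == l)%:R) basis_e).
rewrite -eC (bigD1 i) //= eqxx scale1r big1 ?addr0 // => l.
by rewrite eq_sym => /negPf ->; rewrite scale0r.
Qed.

End Submodules.

Lemma inverse_mx_size (R : comNzRingType) (F : fieldType) (f : {rmorphism R -> F})
  r s (C : 'M[R]_(r, s)) (D : 'M[R]_(s, r)) :
  C *m D = 1%:M -> D *m C = 1%:M -> r = s.
Proof.
move=> /(congr1 (map_mx f)) CD /(congr1 (map_mx f)) DC; apply/eqP.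
rewrite eqn_leq; move: CD DC; rewrite !map_mxM !map_mx1.
by move=> /mulmx1_min -> /mulmx1_min ->.
Qed.

Lemma basis_size (R : comNzRingType) (F : fieldType) (f : {rmorphism R -> F})
  (V : lmodType R) (S : V -> Prop) r s (e : 'I_r -> V) (e' : 'I_s -> V) :
  is_basis S e -> is_basis S e' -> r = s.
Proof.
move=> be be'; have [C CP] := basis_matrix be (is_basis_mem be').
have [D DP] := basis_matrix be' (is_basis_mem be).
apply: (inverse_mx_size f (C := D) (D := C)).
- by apply: (basis_matrix1 be) => i; rewrite -matrix_comp DP; under eq_bigr do rewrite CP.
- by apply: (basis_matrix1 be') => i; rewrite -matrix_comp CP; under eq_bigr do rewrite DP.
Qed.

Section Connection.
Variables (p : nat) (k : fieldType) (W : wittRing p k) (n : nat).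
Variable H : crystal W n.
Implicit Types x y : H.

Lemma nabla_addE x y j : nabla (x + y) j = nabla x j + nabla y j.
Proof. by rewrite nablaD ffunE. Qed.
Lemma nabla_scaleE a x j :
  nabla (a *: x) j = mfps_deriv j a *: x + a *: nabla x j.
Proof. by rewrite nabla_leibniz !ffunE mxE. Qed.
Lemma nabla_constE (c : W) x j :
  nabla (mfps_const n c *: x) j = mfps_const n c *: nabla x j.
Proof. by rewrite nabla_scaleE mfps_deriv_const scale0r add0r. Qed.
Lemma nabla_sumE (I : Type) (r : seq I) (P : pred I) (F : I -> H) j :
  nabla (\sum_(i <- r | P i) F i) j = \sum_(i <- r | P i) nabla (F i) j.
Proof.
apply: (big_morph (fun x => nabla x j)) => [x y|]; first exact: nabla_addE.
by apply: (addrI (nabla 0 j)); rewrite addr0 -nabla_addE addr0.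
Qed.
End Connection.

Section OrdinaryHodge.
Variables (p : nat) (k : closedFieldType) (char_k : p \in [pchar k]).
Variables (W : wittRing p k) (n : nat) (H : fcrystal W n).
Variables (U Fil : nat -> H -> Prop).
Hypotheses (hodge : hodge_fcrystal Fil) (ord : ordinary H).
Hypotheses (slope : slope_filtration U) (level : level_le H 3).
Let p_prime : prime p := pcharf_prime char_k.
Local Notation A := (mfps n W).
Local Notation phi := (std_lift char_k W n).

Definition residue : A -> k := @witt_red p k W \o @mfps_coef0 n W.
HB.instance Definition _ := GRing.RMorphism.on residue.

Lemma slope_sub i : is_submodule (U i).
Proof. by have [free _ _] := sf_sub slope i; apply: free_is_submodule. Qed.
Lemma pred_slope_sub i : is_submodule (pred_fil U i).
Proof. by case: i => [|i]; [apply: zero_is_submodule | apply: slope_sub]. Qed.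
Lemma hodge_sub i : is_submodule (Fil i).
Proof. exact: free_is_submodule (hf_free hodge i). Qed.
Lemma pred_slope_incr i x : pred_fil U i x -> U i x.
Proof.
case: i => [|i] /=; last exact: sf_incr.
by move->; apply: submodule0; apply: slope_sub.
Qed.
Lemma slope_mono i j x : (i <= j)%N -> U i x -> U j x.
Proof.
elim: j => [|j IH]; first by rewrite leqn0 => /eqP ->.
rewrite leq_eqVlt => /orP[/eqP ->//|]; rewrite ltnS => ij Ui.
by apply: (sf_incr slope); apply: IH.
Qed.
Lemma hodge_mono i j x : (i <= j)%N -> Fil j x -> Fil i x.
Proof.
elim: j => [|j IH]; first by rewrite leqn0 => /eqP ->.
rewrite leq_eqVlt => /orP[/eqP ->//|]; rewrite ltnS => ij Fj.
by apply: IH => //; apply: (hf_decr hodge).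
Qed.

Lemma to_specialD (x y : H) : to_special (x + y) = to_special x + to_special y.
Proof.
rewrite /to_special linearD; apply/rowP => i; rewrite !mxE.
exact: (raddfD (@mfps_map n W k witt_red)).
Qed.
Lemma to_specialN (x : H) : to_special (- x) = - to_special x.
Proof.
rewrite /to_special linearN; apply/rowP => i; rewrite !mxE.
exact: (raddfN (@mfps_map n W k witt_red)).
Qed.
Lemma to_special_eq0 (x : H) : to_special x = 0 -> exists y, x = y *+ p.
Proof.
move=> x0; have /choice[y yP] : forall i, exists y, v2r x 0 i = y *+ p.
  move=> i; apply: redA_eq0.
  by move/rowP/(_ i): x0; rewrite !mxE.
exists (r2v (\row_i y i)); apply: (can_inj (@v2rK _ H)).
rewrite raddfMn /= r2vK; apply/rowP => i.
by rewrite mulmxnE mxE -yP.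
Qed.

(** Modulo p the intersection is zero, and by [specializes] the quotient x / p stays in both
    submodules; so x is infinitely divisible by p. *)
Lemma slope_hodge_disjoint i x : U i x -> Fil i.+1 x -> x = 0.
Proof.
move=> Ux Fx; apply: mod_separated => N.
suff [y [_ _ ->]] : exists y, [/\ U i y, Fil i.+1 y & x = y *+ p ^ N] by exists y.
elim: N => [|N [y [Uy Fy ->]]]; first by exists x; split=> //; rewrite expn0.
have y0 : to_special y = 0.
  have [_ disj] := ord.2 i; apply: disj.
    by apply/(sf_special slope i).1; exists y.
  by apply/(hf_special hodge i.+1).1; exists y.
have [u Uu yu] := (sf_special slope i).2 y Uy y0.
have [f Ff yf] := (hf_special hodge i.+1).2 y Fy y0.
exists u; split=> //; last by rewrite expnS mulrnA yu expn1.
suff -> : u = f by [].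
by apply: (p_torsionfreeX (N := 1) (@mod_torsionfree p k W n H)); rewrite -yu.
Qed.

(** The sum is everything modulo p. Bases of the two submodules provide a p-complete coordinate
    module, to which successive approximation applies. *)
Lemma slope_hodge_span i x : exists u f, [/\ U i u, Fil i.+1 f & x = u + f].
Proof.
have [r [bu buP]] : free_submodule (U i) by have [] := sf_sub slope i.
have [s [bf bfP]] := hf_free hodge i.+1.
pose E (z : 'rV[A]_(r + s)) : H :=
  \sum_j z 0 (lshift s j) *: bu j + \sum_j z 0 (rshift r j) *: bf j.
have addE : zmod_morphism E.
  move=> a b; rewrite /E opprD addrACA -!sumrB.
  by congr (_ + _); apply: eq_bigr => j _; rewrite !mxE scalerBl.
pose addEM := GRing.isZmodMorphism.Build _ _ E addE.
pose EA : {additive 'rV[A]_(r + s) -> H} := HB.pack E addEM.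
have [c|z <-] := @p_adic_surj p _ _ EA (mx_complete (mfps_complete (@witt_p_complete p k W)))
    (@mod_separated p k W n H) _ x; last first.
  exists (\sum_j z 0 (lshift s j) *: bu j), (\sum_j z 0 (rshift r j) *: bf j).
  by split=> //; [apply/buP.1|apply/bfP.1]; eexists.
have [span _] := ord.2 i; have [x1 [x2 [x1P x2P cP]]] := span (to_special c).
have [u Uu uP] := ((sf_special slope i).1 x1).1 x1P.
have [f Ff fP] := ((hf_special hodge i.+1).1 x2).1 x2P.
have [cu cuP] := (buP.1 u).1 Uu; have [cf cfP] := (bfP.1 f).1 Ff.
pose z := row_mx (\row_j cu j) (\row_j cf j).
have Ez : E z = u + f.
  rewrite /E cuP cfP; congr (_ + _); apply: eq_bigr => j _.
    by rewrite row_mxEl mxE.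
  by rewrite row_mxEr mxE.
have [c' c'P] : exists c', c - E z = c' *+ p.
  apply: to_special_eq0; rewrite to_specialD to_specialN Ez to_specialD uP fP cP.
  by rewrite subrr.
by exists z, c'; rewrite -c'P addrC subrK.
Qed.

Lemma pred_slope_hodge_disjoint i x : pred_fil U i x -> Fil i x -> x = 0.
Proof. by case: i => [|i] //=; apply: slope_hodge_disjoint. Qed.
Lemma pred_slope_hodge_span i x :
  exists u f, [/\ pred_fil U i u, Fil i f & x = u + f].
Proof.
case: i => [|i]; last exact: slope_hodge_span.
by exists 0, x; split; rewrite ?add0r //; apply: (hf_full hodge).
Qed.

(** Level at most 3 makes Fil^4 vanish modulo p, hence vanish by repeated division by p; then H =
    U_3 + Fil^4 is U_3. *)
Lemma slope3_full x : U 3 x.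
Proof.
have [u [f [Uu Ff ->]]] := slope_hodge_span 3 x.
suff -> : f = 0 by rewrite addr0.
apply: mod_separated => N.
suff [y [_ ->]] : exists y, Fil 4 y /\ f = y *+ p ^ N by exists y.
elim: N => [|N [y [Fy ->]]]; first by exists f; rewrite expn0.
have y0 : to_special y = 0.
  by apply: level.2; apply/(hf_special hodge 4).1; exists y.
have [f' Ff' yf] := (hf_special hodge 4).2 y Fy y0.
by exists f'; split=> //; rewrite expnS mulrnA yf expn1.
Qed.

(** Models the lifts to H^i of a flat basis of V_i fixed by phi: after lifting, both properties hold
    only up to U_(i-1). *)
Definition adapted i r (e : 'I_r -> H) := [/\ is_basis (hodge_part U Fil i) e,
  forall b j, pred_fil U i (nabla (e b) j)
  & forall b, pred_fil U i (Frob phi (e b) - e b *+ p ^ i)].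

(** A preimage in U_i of a fixed vector of V_i can be moved into Fil^i by an element of U_(i-1),
    because H = U_(i-1) + Fil^i. As the kernel U_(i-1) of f meets Fil^i trivially, coordinates in
    V_i determine vectors of H^i. *)
Lemma adapted_exists i : exists r (e : 'I_r -> H), adapted i e.
Proof.
have [V [f [unitV [f_lin f_surj f_ker f_nabla f_Frob]]]] := sf_graded slope i.
have [v [basis_v v_fixed v_flat]] := unit_crystal_basis char_k unitV.
have subU := slope_sub i; have sub' := pred_slope_sub i.
have f0 : f 0 = 0 by apply/f_ker; [apply: submodule0 | apply: submodule0].
have fZD a x y : U i x -> U i y -> f (a *: x + y) = a *: f x + f y by apply: f_lin.
have fZ a x : U i x -> f (a *: x) = a *: f x.
  by move=> Ux; rewrite -[_ *: x]addr0 fZD ?f0 ?addr0 //; apply: submodule0.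
have fB x y : U i x -> U i y -> f (x - y) = f x - f y.
  by move=> Ux Uy; rewrite addrC -scaleN1r fZD // scaleN1r addrC.
have fsum r (c : 'I_r -> A) (x : 'I_r -> H) : (forall j, U i (x j)) ->
    f (\sum_j c j *: x j) = \sum_j c j *: f (x j).
  elim: r c x => [|r IH] c x Ux; first by rewrite !big_ord0 f0.
  rewrite !big_ord_recl fZD ?IH //.
  by apply: submodule_sum => // j _; apply: submoduleZ.
have /choice[e eP] : forall b, exists e, hodge_part U Fil i e /\ f e = v b.
  move=> b; have [x Ux fx] := f_surj (v b).
  have [u [y [Uu Fy eq_x]]] := pred_slope_hodge_span i x.
  have Uu' := pred_slope_incr Uu.
  have eq_y : y = x - u by rewrite eq_x addrAC subrr add0r.
  exists y; split; first by split=> //; rewrite eq_y; apply: submoduleB.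
  by rewrite eq_y fB // (_ : f u = 0) ?subr0 //; apply/f_ker.
have Ue b : U i (e b) by case: (eP b) => -[].
have Fe b : Fil i (e b) by case: (eP b) => -[].
have fe b : f (e b) = v b by case: (eP b).
exists (dim V), e; split=> [|b j|b].
- split=> [x|c c0]; first split=> [[Ux Fx]|[c ->]].
  + have [c cP] := (basis_v.1 (f x)).1 I; exists c.
    apply/eqP; rewrite -subr_eq0; apply/eqP.
    have Uc : U i (\sum_j c j *: e j).
      by apply: submodule_sum => // j _; apply: submoduleZ.
    apply: (@pred_slope_hodge_disjoint i); last first.
      apply: submoduleB => //; first exact: hodge_sub.
      apply: submodule_sum => [|j _]; first exact: hodge_sub.
      by apply: submoduleZ => //; apply: hodge_sub.
    apply/f_ker; first exact: submoduleB.
    by rewrite fB // fsum // cP; under eq_bigr do rewrite -fe; rewrite subrr.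
  + split; apply: submodule_sum => [|j _]; try exact: hodge_sub; try exact: slope_sub.
      by apply: submoduleZ.
    by apply: submoduleZ => //; apply: hodge_sub.
  + apply: basis_v.2; under eq_bigr do rewrite -fe.
    by rewrite -fsum // c0.
- have [_ stab _] := sf_sub slope i.
  by apply/f_ker; [apply: stab | rewrite f_nabla // fe v_flat].
- have [_ _ stab] := sf_sub slope i.
  apply/f_ker; first by apply: submoduleB; [|apply: stab|apply: submoduleMn].
  rewrite fB; [|exact: stab|exact: submoduleMn].
  rewrite f_Frob // fe v_fixed -[e b *+ _]scaler_nat fZ // fe scaler_nat.
  exact: subrr.
Qed.

Lemma adapted_decomp i r (e : 'I_r -> H) x : adapted i e -> U i x ->
  exists c u, pred_fil U i u /\ x = \sum_j c j *: e j + u.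
Proof.
move=> [basis_e _ _] Ux.
have [u [f [Uu Ff eq_x]]] := pred_slope_hodge_span i x.
have [c cP] : exists c : 'I_r -> A, f = \sum_j c j *: e j.
  apply/basis_e.1; split=> //.
  rewrite (_ : f = x - u); last by rewrite eq_x addrAC subrr add0r.
  by apply: submoduleB => //; [apply: slope_sub | apply: pred_slope_incr].
by exists c, u; rewrite eq_x addrC -cP.
Qed.

(** A matrix fixed by phi is constant, so it commutes with nabla as well as with Frobenius. *)
Lemma adapted_change i r (e : 'I_r -> H) (C D : 'M[A]_r) : adapted i e ->
  map_mx (@std_frob p k W n) C = C -> D *m C = 1%:M ->
  adapted i (fun a => \sum_l C a l *: e l).
Proof.
move=> [basis_e flat_e frob_e] fixC DC; have sub' := pred_slope_sub i.
have CD : C *m D = 1%:M by apply: mulmx1C.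
have constC a l : C a l = mfps_const n (C a l 0%MM).
  by apply: (mfps_frob_fixed p_prime); move/matrixP/(_ a l): fixC; rewrite mxE.
split=> [|b j|b].
- split=> [x|c c0].
    rewrite basis_e.1; split=> -[c ->].
      exists (fun j => \sum_l c l * D l j).
      have := matrix_comp C (\row_j \sum_l c l * D l j) e 0.
      under eq_bigr do rewrite mxE; move=> ->; apply: eq_bigr => j _.
      congr (_ *: _); rewrite (_ : \row_j \sum_l c l * D l j = (\row_j c j) *m D).
        by rewrite -mulmxA DC mulmx1 mxE.
      by apply/rowP => l; rewrite !mxE; apply: eq_bigr => q _; rewrite mxE.
    exists (fun j => ((\row_l c l) *m C) 0 j).
    by rewrite -matrix_comp; under [in RHS]eq_bigr do rewrite mxE.
  have := matrix_comp C (\row_j c j) e 0.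
  under eq_bigr do rewrite mxE; rewrite c0 => /esym /basis_e.2 c0'.
  have : (\row_j c j) *m C = 0 by apply/rowP => l; rewrite c0' mxE.
  move/(congr1 (mulmx^~ D)); rewrite -mulmxA CD mulmx1 mul0mx => /rowP cj j.
  by have := cj j; rewrite !mxE.
- rewrite nabla_sumE; apply: submodule_sum => // l _.
  by rewrite constC nabla_constE; apply: submoduleZ.
- rewrite raddf_sum /= -sumrMnl -sumrB; apply: submodule_sum => // l _.
  have fixCb : phi (C b l) = C b l by move/matrixP/(_ b l): fixC; rewrite mxE.
  by rewrite FrobZ fixCb scalerMnr -scalerBr; apply: submoduleZ.
Qed.

End OrdinaryHodge.

Section Concatenation.
Variables (T : Type) (r s : nat) (e : 'I_r -> T) (e' : 'I_s -> T).
Definition cat_fam (i : 'I_(r + s)) : T :=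
  match split i with inl a => e a | inr b => e' b end.
Lemma cat_fam_l i : cat_fam (lshift s i) = e i.
Proof. by rewrite /cat_fam (unsplitK (inl i)). Qed.
Lemma cat_fam_r i : cat_fam (rshift r i) = e' i.
Proof. by rewrite /cat_fam (unsplitK (inr i)). Qed.
End Concatenation.

Lemma sum_cat_fam (R : comNzRingType) (V : lmodType R) r s
    (c : 'I_(r + s) -> R) (e : 'I_r -> V) (e' : 'I_s -> V) :
  \sum_i c i *: cat_fam e e' i
  = \sum_i c (lshift s i) *: e i + \sum_i c (rshift r i) *: e' i.
Proof.
rewrite big_split_ord; congr (_ + _); apply: eq_bigr => i _.
  by rewrite cat_fam_l.
by rewrite cat_fam_r.
Qed.

Definition cy_deg (h : nat) : 'I_((1 + h) + (h + 1)) -> nat :=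
  cat_fam (cat_fam (fun _ => 0%N) (fun _ => 1%N))
          (cat_fam (fun _ => 2%N) (fun _ => 3%N)).

Section Coordinates.
Variables (R : comNzRingType) (V : lmodType R) (N : nat) (e : 'I_N -> V).
Hypothesis basis_e : is_basis (@everything V) e.

Definition coord_of (x : V) : 'I_N -> R := projT1 (cid ((basis_e.1 x).1 I)).
Lemma coord_ofE x : x = \sum_i coord_of x i *: e i.
Proof. exact: (projT2 (cid ((basis_e.1 x).1 I))). Qed.
Lemma coord_of_uniq x (c : 'I_N -> R) : x = \sum_i c i *: e i -> coord_of x =1 c.
Proof. by move=> xc; apply: (basis_coord_uniq basis_e); rewrite -coord_ofE. Qed.
Lemma coord_of_linear i a x y :
  coord_of (a *: x + y) i = a * coord_of x i + coord_of y i.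
Proof.
apply: (coord_of_uniq (c := fun i => a * coord_of x i + coord_of y i)).
rewrite {1}[x]coord_ofE {1}[y]coord_ofE scaler_sumr -big_split.
by apply: eq_bigr => j _; rewrite /= scalerA scalerDl.
Qed.
Lemma coord_of_e i j : coord_of (e j) i = (j == i)%:R.
Proof.
apply: (coord_of_uniq (c := fun i => (j == i)%:R)).
rewrite (bigD1 j) //= eqxx scale1r big1 ?addr0 // => l.
by rewrite eq_sym => /negPf ->; rewrite scale0r.
Qed.
End Coordinates.

(** * The symplectic basis *)

Section Pairing.
Variables (p : nat) (k : closedFieldType) (char_k : p \in [pchar k]).
Variables (W : wittRing p k) (n : nat) (H : fcrystal W n).
Variables (U Fil : nat -> H -> Prop) (B : {biscalar H}).
Hypotheses (hodge : hodge_fcrystal Fil) (ord : ordinary H).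
Hypotheses (slope : slope_filtration U) (level : level_le H 3).
Local Notation A := (mfps n W).
Local Notation phi := (std_lift char_k W n).
Local Notation adapted i e := (@adapted p k char_k W n H U Fil i _ e).
Hypothesis B_frob : forall x y,
  B (Frob phi x) (Frob phi y) = phi (B x y) *+ p ^ 3.
Hypothesis B_perfect : forall l : {scalar H}, exists! x, forall y, B x y = l y.

Let A_torsionfree : p_torsionfree p A :=
  mfps_torsionfree (@witt_torsionfree p k W).

(** The errors [Frob phi (e a) - e a *+ p ^ i] lie in U_(i-1), and likewise for e', so the
    orthogonality hypotheses leave only the leading terms. *)
Lemma gram_frob i j r s (e : 'I_r -> H) (e' : 'I_s -> H) a b :
  adapted i e -> adapted j e' ->
  (forall x y, pred_fil U i x -> U j y -> B x y = 0) ->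
  (forall x y, U i x -> pred_fil U j y -> B x y = 0) ->
  B (e a) (e' b) *+ p ^ (i + j) = phi (B (e a) (e' b)) *+ p ^ 3.
Proof.
move=> [basis_e _ frob_e] [basis_e' _ frob_e'] orth1 orth2.
have Ue : U i (e a) by have [] := is_basis_mem basis_e a.
have Ue' : U j (e' b) by have [] := is_basis_mem basis_e' b.
rewrite -B_frob.
have -> : Frob phi (e a) = e a *+ p ^ i + (Frob phi (e a) - e a *+ p ^ i).
  by rewrite addrC subrK.
have -> : Frob phi (e' b) = e' b *+ p ^ j + (Frob phi (e' b) - e' b *+ p ^ j).
  by rewrite addrC subrK.
have subUj := slope_sub slope j.
rewrite linearDl [X in _ + X]orth1; last 2 first.
- exact: frob_e.
- apply: submoduleD => //; first exact: submoduleMn.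
  exact/(pred_slope_incr slope)/frob_e'.
rewrite linearDr [X in _ + X + _]orth2; last 2 first.
- by apply: submoduleMn => //; apply: slope_sub.
- exact: frob_e'.
by rewrite !addr0 linearMnl linearMnr -mulrnA expnD mulnC.
Qed.

(** Induction on i + j reduces to adapted bases, whose pairings satisfy g = p^(3-i-j) phi(g). As 3 -
    i - j > 0, iteration makes g divisible by every power of p. *)
Lemma slope_orth i j x y : (i + j < 3)%N -> U i x -> U j y -> B x y = 0.
Proof.
have [s] := ubnP (i + j); elim: s => // s IH in i j x y *; rewrite ltnS => ij_s ij3.
have orth1 x' y' : pred_fil U i x' -> U j y' -> B x' y' = 0.
  case: i ij_s ij3 => [|i] ij_s ij3; first by move=> ->; rewrite linear0l.
  by apply: IH => //; apply: leq_ltn_trans ij3; rewrite leq_add2r.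
have orth2 x' y' : U i x' -> pred_fil U j y' -> B x' y' = 0.
  case: j ij_s ij3 orth1 => [|j] ij_s ij3 _; first by move=> _ ->; rewrite linear0r.
  rewrite addnS in ij_s ij3.
  by apply: IH => //; apply: leq_ltn_trans ij3.
have [r [e ad_e]] := adapted_exists char_k hodge ord slope i.
have [r' [e' ad_e']] := adapted_exists char_k hodge ord slope j.
move=> Ux Uy.
have [c [u [Uu ->]]] := adapted_decomp hodge ord slope ad_e Ux.
have [c' [u' [Uu' eq_y]]] := adapted_decomp hodge ord slope ad_e' Uy.
rewrite linearDl [X in _ + X]orth1 // addr0 eq_y linearDr [X in _ + X]orth2 //; last first.
  apply: submodule_sum => [|a _]; first exact: slope_sub.
  apply: submoduleZ; first exact: slope_sub.
  by case: ad_e => basis_e _ _; have [] := is_basis_mem basis_e a.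
rewrite addr0 linear_sumlz big1 // => a _; rewrite linear_sumr big1 // => b _.
rewrite linearZl_LR linearZr /=.
suff -> : B (e a) (e' b) = 0 by rewrite !mulr0.
have gP := gram_frob a b ad_e ad_e' orth1 orth2.
move: (B (e a) (e' b)) gP => g gP.
have {}gP : g = phi g *+ p ^ (3 - (i + j)).
  apply: (p_torsionfreeX (N := i + j) A_torsionfree).
  by rewrite gP -mulrnA -expnD subnK // ltnW.
apply: (mfps_separated (@witt_p_separated p k W)) => N.
elim: N => [|N [z zP]]; first by exists g; rewrite expn0.
exists (phi z *+ p ^ (2 - (i + j))).
rewrite gP {1}zP raddfMn -!mulrnA -!expnD; congr (_ *+ p ^ _).
by lia.
Qed.

(* Each element of H splits into parts in U_{i-1}, H^i and Fil^{i+1}, and only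
   the middle one pairs non-trivially with H^{3-i}. *)
Lemma gram_inverse i j r N (e e' : 'I_r -> H) (E : 'I_N -> H) (f : 'I_r -> 'I_N) :
  (i + j = 3)%N -> adapted i e -> adapted j e' ->
  (forall x y, Fil i.+1 x -> Fil j y -> B x y = 0) ->
  is_basis (@everything H) E -> injective f -> (forall b, e' b = E (f b)) ->
  let G := \matrix_(a, b) B (e a) (e' b) in
  exists D, D *m G = 1%:M /\ map_mx (@std_frob p k W n) D = D.
Proof.
move=> ij ad_e ad_e' orth_fil basis_E f_inj e'E G.
have orth1 x y : pred_fil U i x -> U j y -> B x y = 0.
  case: i ij {ad_e orth_fil} => [|i] ij; first by move=> ->; rewrite linear0l.
  by apply: slope_orth; rewrite -ij.
have orth2 x y : U i x -> pred_fil U j y -> B x y = 0.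
  case: j ij orth1 {ad_e' orth_fil} => [|j] ij _; first by move=> _ ->; rewrite linear0r.
  by apply: slope_orth; rewrite -ij addnS.
have [basis_e _ _] := ad_e; have [basis_e' _ _] := ad_e'.
have fixG : map_mx (@std_frob p k W n) G = G.
  apply/matrixP => a b; rewrite !mxE; apply: esym.
  apply: (p_torsionfreeX (N := 3) A_torsionfree).
  by rewrite -{1}ij; apply: gram_frob.
have /choice[d dP] : forall b, exists d : 'I_r -> A,
    forall b', \sum_a d a * B (e a) (e' b') = (b == b')%:R.
  (* Row b of D: perfectness represents the coordinate along E (f b) by a vector x, and the H^i part
     of x has the wanted coefficients. *)
  move=> b; pose l x : A := coord_of basis_E x (f b).
  have lin_l : linear_for *%R l by move=> a x y; apply: coord_of_linear.
  pose lin_lM := GRing.isLinear.Build A H A *%R l lin_l.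
  pose L : {scalar H} := HB.pack l lin_lM.
  have [x [xP _]] := B_perfect L.
  have [u [x' [Uu Fx' eq_x]]] := pred_slope_hodge_span hodge ord slope i x.
  have [y [z [Uy Fz eq_x']]] := slope_hodge_span hodge ord slope i x'.
  have [d dP] : exists d : 'I_r -> A, y = \sum_a d a *: e a.
    apply/basis_e.1; split=> //.
    rewrite (_ : y = x' - z); last by rewrite eq_x' addrK.
    apply: submoduleB => //; first exact: hodge_sub.
    exact: (hf_decr hodge).
  exists d => b'; have [Ue' Fe'] := is_basis_mem basis_e' b'.
  rewrite -(inj_eq f_inj) eq_sym -(coord_of_e basis_E) -e'E.
  rewrite -[RHS]/(L _) -xP eq_x eq_x' !linearDl orth1 // [B z _]orth_fil //.
  rewrite add0r addr0 dP linear_sumlz; apply: eq_bigr => a _.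
  by rewrite linearZl_LR.
exists (\matrix_(b, a) d b a).
have DG : (\matrix_(b, a) d b a) *m G = 1%:M.
  apply/matrixP => b b'; rewrite !mxE -dP; apply: eq_bigr => a _.
  by rewrite !mxE.
split=> //; set D := \matrix_(b, a) d b a in DG *.
have GD : G *m D = 1%:M by apply: mulmx1C.
(* phi(D) is also inverse to the fixed matrix G, so it equals D. *)
pose phiM := std_frob_rmorphism char_k W n.
have : map_mx phiM D *m G = 1%:M.
  rewrite -[X in _ *m X](_ : map_mx phiM G = G) // -map_mxM DG.
  exact: map_mx1.
move/(congr1 (mulmx^~ D)); rewrite -mulmxA GD mulmx1 mul1mx.
by [].
Qed.

(** Spanning peels off the graded pieces of U from the top; independence kills the components from
    degree 0 upwards, using that U_i and Fil^(i+1) meet trivially. *)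
Lemma adapted_cat_basis r0 r1 r2 r3 (e0 : 'I_r0 -> H) (e1 : 'I_r1 -> H)
    (e2 : 'I_r2 -> H) (e3 : 'I_r3 -> H) :
  adapted 0 e0 -> adapted 1 e1 -> adapted 2 e2 -> adapted 3 e3 ->
  is_basis (@everything H) (cat_fam (cat_fam e0 e1) (cat_fam e2 e3)).
Proof.
move=> ad0 ad1 ad2 ad3.
have sumE c : \sum_i c i *: cat_fam (cat_fam e0 e1) (cat_fam e2 e3) i =
    (\sum_i c (lshift _ (lshift _ i)) *: e0 i + \sum_i c (lshift _ (rshift _ i)) *: e1 i)
    + (\sum_i c (rshift _ (lshift _ i)) *: e2 i + \sum_i c (rshift _ (rshift _ i)) *: e3 i).
  by rewrite sum_cat_fam !(sum_cat_fam (fun i => c _)).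
have mem i r (e : 'I_r -> H) (c : 'I_r -> A) : adapted i e ->
    hodge_part U Fil i (\sum_j c j *: e j).
  by move=> [be _ _]; apply/be.1; exists c.
split=> [x|c].
  split=> // _.
  have [c3 [u2 [Uu2 ->]]] :=
    adapted_decomp hodge ord slope ad3 (slope3_full hodge ord slope level x).
  have [c2 [u1 [Uu1 ->]]] := adapted_decomp hodge ord slope ad2 Uu2.
  have [c1 [u0 [Uu0 ->]]] := adapted_decomp hodge ord slope ad1 Uu1.
  have [c0 [u [-> ->]]] := adapted_decomp hodge ord slope ad0 Uu0.
  exists (cat_fam (cat_fam c0 c1) (cat_fam c2 c3)); rewrite sumE addr0.
  under [in RHS]eq_bigr do rewrite !cat_fam_l.
  under [X in _ = _ + X + _]eq_bigr do rewrite cat_fam_l cat_fam_r.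
  under [X in _ = _ + (X + _)]eq_bigr do rewrite cat_fam_r cat_fam_l.
  under [X in _ = _ + (_ + X)]eq_bigr do rewrite !cat_fam_r.
  by rewrite addrA [RHS]addrC [in RHS](addrC (\sum_i c2 i *: _))
    [in RHS](addrC (\sum_i c0 i *: _)).
rewrite sumE.
set X0 := \sum_i c (lshift _ (lshift _ i)) *: e0 i.
set X1 := \sum_i c (lshift _ (rshift _ i)) *: e1 i.
set X2 := \sum_i c (rshift _ (lshift _ i)) *: e2 i.
set X3 := \sum_i c (rshift _ (rshift _ i)) *: e3 i.
have [U0 F0] : hodge_part U Fil 0 X0 by apply: mem.
have [U1 F1] : hodge_part U Fil 1 X1 by apply: mem.
have [U2 F2] : hodge_part U Fil 2 X2 by apply: mem.
have [U3 F3] : hodge_part U Fil 3 X3 by apply: mem.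
move=> X0123.
have subF i : is_submodule (Fil i) by apply: hodge_sub.
have disj := slope_hodge_disjoint hodge ord slope.
have X00 : X0 = 0.
  apply: (disj 0%N) => //.
  move/eqP: X0123; rewrite -addrA addr_eq0 => /eqP ->.
  apply: submoduleN => //; apply: submoduleD => //.
  by apply: submoduleD => //; [apply: hodge_mono F2 | apply: hodge_mono F3].
move: X0123; rewrite X00 add0r => X123.
have X10 : X1 = 0.
  apply: (disj 1%N) => //.
  move/eqP: X123; rewrite addr_eq0 => /eqP ->.
  apply: submoduleN => //; apply: submoduleD => //; exact: hodge_mono F3.
move: X123; rewrite X10 add0r => X23.
have X20 : X2 = 0.
  apply: (disj 2%N) => //.
  by move/eqP: X23; rewrite addr_eq0 => /eqP ->; apply: submoduleN.
move: X23; rewrite X20 add0r => X30.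
have [[_ free0] _ _] := ad0; have [[_ free1] _ _] := ad1.
have [[_ free2] _ _] := ad2; have [[_ free3] _ _] := ad3.
move=> j; case: (split_ordP j) => j' ->; case: (split_ordP j') => j'' ->.
- exact: (free0 _ X00).
- exact: (free1 _ X10).
- exact: (free2 _ X20).
- exact: (free3 _ X30).
Qed.

End Pairing.

(* Locked: unfolding the blocks makes unification very slow. *)
Definition cy_gram (R : pzRingType) (h : nat) : 'M[R]_((1 + h) + (h + 1)) :=
  locked (block4 0 0 0 (- 1%:M) 0 0 1%:M 0 0 (- 1%:M) 0 0 1%:M 0 0 0).

Lemma cy_gramE (R : pzRingType) h : cy_gram R h =
  block4 0 0 0 (- 1%:M) 0 0 1%:M 0 0 (- 1%:M) 0 0 1%:M 0 0 0.
Proof. by rewrite /cy_gram -lock. Qed.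

Section CY3Basis.
Variables (p : nat) (k : closedFieldType) (char_k : p \in [pchar k]).
Variables (W : wittRing p k) (n h : nat) (H : fcrystal W n).
Variables (U Fil : nat -> H -> Prop) (B : {biscalar H}).
Hypothesis CY : ordinary_CY3 h U Fil B.
Local Notation A := (mfps n W).
Local Notation phi := (std_lift char_k W n).
Local Notation adapted i e := (@adapted p k char_k W n H U Fil i _ e).
Let hodge := cy_hodge CY.
Let ord := cy_ordinary CY.
Let slope := cy_slope CY.
Let level := (cy_divisible CY).1.

Lemma pairing_skew x y : B x y = - B y x.
Proof.
apply/eqP; rewrite -addr_eq0; apply/eqP.
have := cy_alternating CY (x + y).
by rewrite linearDl !linearDr /= !(cy_alternating CY) add0r addr0.
Qed.

Lemma hodge_orth i j x y : (3 < i + j)%N -> (i <= 3)%N -> (j <= 3)%N ->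
  Fil i x -> Fil j y -> B x y = 0.
Proof.
have orth13 a b : Fil 1 a -> Fil 3 b -> B a b = 0.
  by move=> Fa Fb; apply: ((cy_perp3 CY a).2 Fa).
have orth22 a b : Fil 2 a -> Fil 2 b -> B a b = 0.
  by move=> Fa Fb; apply: ((cy_perp2 CY a).2 Fa).
have mono := @hodge_mono p k W n H Fil hodge.
case: i => [|[|[|[|i]]]] //; case: j => [|[|[|[|j]]]] // _ _ _ Fx Fy.
- exact: orth13.
- exact: orth22.
- by apply: orth13 => //; apply: mono Fx.
- by rewrite pairing_skew orth13 ?oppr0.
- by apply: orth22 => //; apply: mono Fx.
- by apply: orth13 => //; apply: mono Fx.
Qed.

Lemma adapted_of_rank i r : free_of_rank (hodge_part U Fil i) r ->
  exists e : 'I_r -> H, adapted i e.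
Proof.
move=> [e' basis_e'].
have [s [e ad_e]] := adapted_exists char_k hodge ord slope i.
have [basis_e _ _] := ad_e.
have eq_rs := basis_size (@residue p k W n) basis_e basis_e'.
by subst s; exists e.
Qed.

Lemma cy3_basis : exists e : 'I_((1 + h) + (h + 1)) -> H,
  [/\ is_basis (@everything H) e,
      forall b, hodge_part U Fil (cy_deg b) (e b),
      forall b j, pred_fil U (cy_deg b) (nabla (e b) j),
      forall b, pred_fil U (cy_deg b) (Frob phi (e b) - e b *+ p ^ cy_deg b)
    & \matrix_(i, j) B (e i) (e j) = cy_gram A h].
Proof.
have [e0 ad0] := adapted_of_rank (cy_rank0 CY).
have [e1 ad1] := adapted_of_rank (cy_rank1 CY).
have [e2 ad2] := adapted_of_rank (cy_rank2 CY).
have [e3 ad3] := adapted_of_rank (cy_rank3 CY).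
have basis_E := adapted_cat_basis hodge ord slope level ad0 ad1 ad2 ad3.
have Bfrob := cy_frob CY phi; have Bperf := cy_perfect CY.
have [D1 [DG1 fix1]] : exists D, D *m (\matrix_(a, b) B (e1 a) (e2 b)) = 1%:M
    /\ map_mx (@std_frob p k W n) D = D.
  apply: (gram_inverse hodge ord slope Bfrob Bperf _ ad1 ad2 _ basis_E
    (f := fun b => rshift _ (lshift _ b))) => //.
  - by move=> x y; apply: hodge_orth.
  - by move=> a b /rshift_inj /lshift_inj.
  - by move=> b; rewrite cat_fam_r cat_fam_l.
have [D0 [DG0 fix0]] : exists D, D *m (\matrix_(a, b) B (e0 a) (e3 b)) = 1%:M
    /\ map_mx (@std_frob p k W n) D = D.
  apply: (gram_inverse hodge ord slope Bfrob Bperf _ ad0 ad3 _ basis_E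
    (f := fun b => rshift _ (rshift _ b))) => //.
  - by move=> x y; apply: hodge_orth.
  - by move=> a b /rshift_inj /rshift_inj.
  - by move=> b; rewrite !cat_fam_r.
have {}ad1 := adapted_change slope ad1 fix1 (mulmx1C DG1).
(* The minus sign produces the entry -1 of the Gram matrix between degrees 0 and 3. *)
have fixN0 : map_mx (@std_frob p k W n) (- D0) = - D0.
  apply/matrixP => a b; move/matrixP/(_ a b): fix0; rewrite !mxE => {2}<-.
  exact: (raddfN (std_frob_rmorphism char_k W n)).
have DG0' : - (\matrix_(a, b) B (e0 a) (e3 b)) *m - D0 = 1%:M.
  by rewrite mulNmx mulmxN opprK; apply: mulmx1C.
have {}ad0 := adapted_change slope ad0 fixN0 DG0'.
set f1 := fun a => \sum_l D1 a l *: e1 l in ad1.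
set f0 := fun a => \sum_l (- D0) a l *: e0 l in ad0.
have f12 a b : B (f1 a) (e2 b) = (a == b)%:R.
  move/matrixP/(_ a b): DG1; rewrite !mxE => <-; rewrite linear_sumlz.
  by apply: eq_bigr => l _; rewrite linearZl_LR !mxE.
have f03 a b : B (f0 a) (e3 b) = - (a == b)%:R.
  move/matrixP/(_ a b): DG0; rewrite !mxE => <-; rewrite linear_sumlz -sumrN.
  by apply: eq_bigr => l _; rewrite linearZl_LR !mxE mulNr.
exists (cat_fam (cat_fam f0 f1) (cat_fam e2 e3)).
have part b : hodge_part U Fil (cy_deg b) (cat_fam (cat_fam f0 f1) (cat_fam e2 e3) b).
  have [[m0 _ _] [m1 _ _]] := (ad0, ad1).
  have [[m2 _ _] [m3 _ _]] := (ad2, ad3).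
  rewrite /cy_deg; case: (split_ordP b) => c ->; case: (split_ordP c) => d ->;
    rewrite !(cat_fam_l, cat_fam_r).
  - exact: (is_basis_mem m0).
  - exact: (is_basis_mem m1).
  - exact: (is_basis_mem m2).
  - exact: (is_basis_mem m3).
(* Degrees with sum below 3 are orthogonal by slopes, those with sum above 3 by the Hodge
   filtration. *)
have orth a b : (cy_deg a + cy_deg b != 3)%N ->
    B (cat_fam (cat_fam f0 f1) (cat_fam e2 e3) a)
      (cat_fam (cat_fam f0 f1) (cat_fam e2 e3) b) = 0.
  have le3 c : (@cy_deg h c <= 3)%N.
    rewrite /cy_deg; case: (split_ordP c) => d ->; case: (split_ordP d) => d' ->;
    by rewrite !(cat_fam_l, cat_fam_r).
  have [[Ua Fa] [Ub Fb]] := (part a, part b).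
  case: ltngtP => // ab3 _; first exact: (slope_orth hodge ord slope Bfrob ab3).
  exact: (hodge_orth ab3).
split=> //.
- exact: (adapted_cat_basis hodge ord slope level ad0 ad1 ad2 ad3).
- have [[_ m0 _] [_ m1 _]] := (ad0, ad1).
  have [[_ m2 _] [_ m3 _]] := (ad2, ad3).
  move=> b j; rewrite /cy_deg; case: (split_ordP b) => c ->; case: (split_ordP c) => d ->;
    rewrite !(cat_fam_l, cat_fam_r).
  - exact: m0.
  - exact: m1.
  - exact: m2.
  - exact: m3.
- have [[_ _ m0] [_ _ m1]] := (ad0, ad1).
  have [[_ _ m2] [_ _ m3]] := (ad2, ad3).
  move=> b; rewrite /cy_deg; case: (split_ordP b) => c ->; case: (split_ordP c) => d ->;
    rewrite !(cat_fam_l, cat_fam_r).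
  - exact: m0.
  - exact: m1.
  - exact: m2.
  - exact: m3.
apply/matrixP => a b; rewrite mxE; move: (orth a b).
rewrite cy_gramE /block4 /cy_deg.
case: (split_ordP a) => a1 ->; case: (split_ordP a1) => a2 ->;
case: (split_ordP b) => b1 ->; case: (split_ordP b1) => b2 ->;
rewrite !(block_mxEul, block_mxEur, block_mxEdl, block_mxEdr, cat_fam_l, cat_fam_r) !mxE => o;
try (exact: o).
- exact: f03.
- exact: f12.
- by rewrite pairing_skew f12 eq_sym.
- by rewrite pairing_skew f03 opprK eq_sym.
Qed.

Variable e : 'I_((1 + h) + (h + 1)) -> H.
Hypothesis basis_e : is_basis (@everything H) e.
Hypothesis e_part : forall b, hodge_part U Fil (cy_deg b) (e b).
Local Notation coord := (coord_of basis_e).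

(** The part y of x along the vectors outside P lies in S' by construction and in S by subtraction,
    so it is zero. *)
Let coord_split x (P : pred 'I__) (S S' : H -> Prop) :
  is_submodule S -> is_submodule S' -> S x ->
  (forall i, P i -> S (e i)) -> (forall i, ~~ P i -> S' (e i)) ->
  (forall y, S y -> S' y -> y = 0) -> forall i, ~~ P i -> coord x i = 0.
Proof.
move=> subS subS' Sx SP SP' disj i nPi.
have [_ free] := basis_e.
pose y := \sum_(j | ~~ P j) coord x j *: e j.
have y0 : y = 0.
  apply: disj; last by apply: submodule_sum => // j nPj; apply: submoduleZ => //; apply: SP'.
  have -> : y = x - \sum_(j | P j) coord x j *: e j.
    by rewrite {1}(coord_ofE basis_e x) (bigID P) /= addrAC subrr add0r.
  apply: submoduleB => //; apply: submodule_sum => // j Pj.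
  by apply: submoduleZ => //; apply: SP.
have := free (fun j => if P j then 0 else coord x j).
rewrite (bigID P) /= big1 ?add0r => [|j ->]; last exact: scale0r.
under eq_bigr => j /negPf -> do [].
by rewrite -/y => /(_ y0 i); rewrite (negPf nPi).
Qed.

Lemma slope_coord d x i : U d x -> (d < cy_deg i)%N -> coord x i = 0.
Proof.
move=> Ux; rewrite ltnNge.
apply: (coord_split (S := U d) (S' := Fil d.+1)
  (P := fun i => (cy_deg i <= d)%N)) => // [||j ||y].
- exact: slope_sub.
- exact: hodge_sub.
- by move=> jd; apply: (slope_mono slope jd); case: (e_part j).
- by move=> j; rewrite -ltnNge => dj; apply: (hodge_mono hodge dj); case: (e_part j).
- exact: slope_hodge_disjoint.
Qed.

Lemma hodge_coord d x i : Fil d x -> (cy_deg i < d)%N -> coord x i = 0.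
Proof.
case: d => // d Fx; rewrite ltnS leqNgt.
apply: (coord_split (S := Fil d.+1) (S' := U d)
  (P := fun i => (d < cy_deg i)%N)) => // [||j ||y].
- exact: hodge_sub.
- exact: slope_sub.
- by move=> dj; apply: (hodge_mono hodge dj); case: (e_part j).
- by move=> j; rewrite -leqNgt => jd; apply: (slope_mono slope jd); case: (e_part j).
- by move=> Fy Uy; apply: (slope_hodge_disjoint hodge ord slope Uy).
Qed.

Hypothesis e_flat : forall b j, pred_fil U (cy_deg b) (nabla (e b) j).
Hypothesis e_frob :
  forall b, pred_fil U (cy_deg b) (Frob phi (e b) - e b *+ p ^ cy_deg b).

Lemma pred_slope_coord d x i : pred_fil U d x -> (d <= cy_deg i)%N -> coord x i = 0.
Proof.
case: d => [->|d] /= => [_|]; last exact: slope_coord.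
apply: (coord_of_uniq basis_e (c := fun=> 0)).
by rewrite big1 // => j _; rewrite scale0r.
Qed.

(** Flatness modulo the slope filtration bounds the degrees of the components from above, Griffiths
    transversality from below; only [cy_deg b - 1] remains. *)
Lemma nabla_coord b j i : (cy_deg i).+1 != cy_deg b -> coord (nabla (e b) j) i = 0.
Proof.
rewrite neq_ltn orbC ltnS => /orP[/pred_slope_coord|]; first exact.
move=> lt_ib; have [_ Fb] := e_part b; apply: (@hodge_coord (cy_deg b).-1).
  by apply: (hf_transverse hodge); rewrite prednK // (leq_trans _ lt_ib).
by rewrite -ltnS prednK // (leq_trans _ lt_ib).
Qed.

Lemma frob_coord b i : (cy_deg b <= cy_deg i)%N ->
  coord (Frob phi (e b)) i = (b == i)%:R *+ p ^ cy_deg b.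
Proof.
move=> bi; have := pred_slope_coord (e_frob b) bi.
rewrite addrC -scaler_nat -scaleNr coord_of_linear coord_of_e => /eqP.
by rewrite addrC mulNr subr_eq0 mulr_natl => /eqP.
Qed.

End CY3Basis.

(** * Horizontal functionals and change of Frobenius lift *)

Definition mnm_fact n (m : 'X_{1.. n}) : nat := \prod_i (m i)`!.
Definition mnm_bin n (m' m : 'X_{1.. n}) : nat := \prod_i 'C(m' i, m i).

Section MultiIndices.
Variable n : nat.
Implicit Types m : 'X_{1.. n}.

Lemma mnm_fact_gt0 m : (0 < mnm_fact m)%N.
Proof. by rewrite prodn_gt0 // => i; apply: fact_gt0. Qed.

Lemma mnm_bin_fact m m' : (mnm_bin (m + m')%MM m * (mnm_fact m * mnm_fact m') = mnm_fact (m + m')%MM)%N.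
Proof.
rewrite -!big_split; apply: eq_bigr => i _ /=; rewrite mnmDE.
by rewrite -[in RHS](@bin_fact _ (m i)) ?leq_addr // addKn.
Qed.

Lemma mnm_bin_small m' m : ~~ (m <= m')%MM -> mnm_bin m' m = 0%N.
Proof.
move=> nle; have [i lt_i] : exists i, (m' i < m i)%N.
  apply/existsP; apply: contraNT nle; rewrite negb_exists => /forallP le.
  by apply/mnm_lepP => i; rewrite leqNgt.
by rewrite /mnm_bin (bigD1 i) //= bin_small.
Qed.

Lemma mnm_factU m i : mnm_fact (m + U_(i))%MM = (mnm_fact m * (m i).+1)%N.
Proof.
rewrite /mnm_fact (bigD1 i) //= [in RHS](bigD1 i) //= mnmDE mnm1E eqxx addn1.
rewrite factS -mulnA [RHS]mulnC; congr (_ * (_ * _))%N.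
by apply: eq_bigr => j ne_ji; rewrite mnmDE mnm1E eq_sym (negPf ne_ji) addn0.
Qed.

Lemma mnm_fact0 : mnm_fact (0%MM : 'X_{1.. n}) = 1%N.
Proof. by rewrite /mnm_fact big1 // => i _; rewrite mnm0E. Qed.

Lemma logn_mnm_fact p m : prime p -> (2 < p)%N -> ((logn p (mnm_fact m)).*2 <= mdeg m)%N.
Proof.
move=> p_prime p_gt2; rewrite mdegE /mnm_fact.
elim/big_rec2: _ => [|i a b _ IH]; first by rewrite logn1.
have [->|b0] := posnP b.
  by rewrite muln0 logn0.
rewrite lognM ?fact_gt0 // doubleD leq_add //.
exact: logn_fact_half.
Qed.

Definition mnm_of_ffun D (f : {ffun 'I_n -> 'I_D}) : 'X_{1.. n} :=
  [multinom f i : nat | i < n].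

Lemma mnm_of_ffun_inj D : injective (@mnm_of_ffun D).
Proof.
move=> f g /mnmP fg; apply/ffunP => i; apply: val_inj.
by have := fg i; rewrite !mnmE.
Qed.

(** Boxes replace degree balls because a product over the variables of sums over 'I_D expands over
    functions into 'I_D; the two families are cofinal. *)
Definition mnm_box D : seq 'X_{1.. n} :=
  [seq mnm_of_ffun f | f : {ffun 'I_n -> 'I_D}].

Lemma mnm_box_uniq D : uniq (mnm_box D).
Proof. by rewrite map_inj_uniq ?enum_uniq //; apply: mnm_of_ffun_inj. Qed.

Lemma mem_mnm_box D m : (m \in mnm_box D) = [forall i, (m i < D)%N].
Proof.
apply/imageP/forallP => [[f _ ->] i|lt_m]; first by rewrite mnmE.
exists [ffun i => Ordinal (lt_m i)] => //.
by apply/mnmP => i; rewrite mnmE ffunE.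
Qed.

Lemma mnm_box_mdeg D m : (mdeg m < D)%N -> m \in mnm_box D.
Proof.
move=> md; rewrite mem_mnm_box; apply/forallP => i.
by apply: leq_ltn_trans md; rewrite mdegE (bigD1 i) //= leq_addr.
Qed.

Lemma mnm_box_bound D m : m \in mnm_box D -> (mdeg m <= n * D)%N.
Proof.
rewrite mem_mnm_box => /forallP lt_m; rewrite mdegE.
rewrite -[n in (n * _)%N]card_ord -sum_nat_const leq_sum // => i _.
exact: ltnW.
Qed.

Lemma big_mnm_box (V : nmodType) D (F : 'X_{1.. n} -> V) :
  \sum_(m <- mnm_box D) F m = \sum_(f : {ffun 'I_n -> 'I_D}) F (mnm_of_ffun f).
Proof. by rewrite big_image. Qed.

End MultiIndices.

Section Lattice.
Variables (p : nat) (k : fieldType) (W : wittRing p k).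
Local Notation K := {fraction W}.

Definition integral (x : K) := exists w : W, x = FracField.tofrac w.
Local Notation small N := (in_pV p N integral).

Lemma small0 N : small N 0.
Proof. by exists 0; [exists 0; rewrite rmorph0|rewrite mul0rn]. Qed.
Lemma smallD N x y : small N x -> small N y -> small N (x + y).
Proof.
move=> [_ [w ->] ->] [_ [v ->] ->]; exists (FracField.tofrac (w + v)).
  by exists (w + v).
by rewrite rmorphD mulrnDl.
Qed.
Lemma smallN N x : small N x -> small N (- x).
Proof.
move=> [_ [w ->] ->]; exists (FracField.tofrac (- w)); first by exists (- w).
by rewrite rmorphN mulNrn.
Qed.
Lemma smallB N x y : small N x -> small N y -> small N (x - y).
Proof. by move=> sx sy; apply: smallD => //; apply: smallN. Qed.
Lemma small_sum N (I : Type) (r : seq I) (P : pred I) (F : I -> K) :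
  (forall i, P i -> small N (F i)) -> small N (\sum_(i <- r | P i) F i).
Proof. by move=> sF; apply: (big_ind (small N)) => //; [apply: small0|apply: smallD]. Qed.
Hypothesis p_neq0 : p%:R != 0 :> K.

Lemma small_quotient N c e x (w : W) : (N + c <= e)%N ->
  x * (p ^ c)%:R = FracField.tofrac w * (p ^ e)%:R -> small N x.
Proof.
move=> le_e eq_x; exists (FracField.tofrac (w *+ p ^ (e - (N + c)))).
  by eexists.
have pc0 : (p ^ c)%:R != 0 :> K by rewrite natrX expf_neq0.
apply: (mulIf pc0); rewrite eq_x !mulr_natr rmorphMn -!mulrnA -!expnD.
by congr (_ *+ p ^ _); lia.
Qed.
End Lattice.

(** * Expanding the image under an arbitrary lift around the standard one *)

Section Taylor.
Variables (p : nat) (p_gt2 : (2 < p)%N).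
Variables (k : fieldType) (char_k : p \in [pchar k]) (W : wittRing p k) (n : nat).
Let p_prime : prime p := pcharf_prime char_k.
Let p_gt0 : (0 < p)%N := prime_gt0 p_prime.
Local Notation A := (mfps n W).
Local Notation K := {fraction W}.
Local Notation KT := (mfps n K).
Local Notation small N := (in_pV p N (@integral p k W)).

Let p_neq0 : p%:R != 0 :> K.
Proof. exact: (fracK_nat_neq0 p_prime char_k W p_gt0). Qed.

(** The range of m is one box common to all m', so that sums over m and m' can be exchanged; the
    terms where m does not divide m' vanish with [mnm_bin]. *)
Lemma mfps_prod_binomial (x y : 'I_n -> A) m' D : m' \in mnm_box n D ->
  \prod_j (x j + y j) ^+ m' j =
  \sum_(m <- mnm_box n D)
     ((\prod_j y j ^+ m j) * \prod_j x j ^+ (m' - m)%MM j) *+ mnm_bin m' m.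
Proof.
rewrite mem_mnm_box => /forallP lt_m'; rewrite big_mnm_box.
rewrite (eq_bigr (fun j => \sum_(i < D)
    (y j ^+ i * x j ^+ (m' j - i)) *+ 'C(m' j, i))); last first.
  move=> j _; rewrite exprDn (big_ord_widen D (fun i => (x j ^+ (m' j - i) * y j ^+ i) *+ 'C(m' j, i))) //.
  rewrite [RHS](bigID (fun i : 'I_D => (i < (m' j).+1)%N)) /=.
  rewrite [X in _ = _ + X]big1 ?addr0.
    by apply: eq_bigr => i _; rewrite mulrC.
  by move=> i; rewrite ltnS -ltnNge => lt_i; rewrite bin_small // mulr0n.
rewrite bigA_distr_bigA; apply: eq_bigr => f _.
rewrite -big_split /= -prodrMn /mnm_bin.
by apply: eq_bigr => j _; rewrite mnmBE !mnmE.
Qed.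

Variables (psi : frobLift W n) (g : KT) (c : 'X_{1.. n} -> A).
Variables (C : nat) (l : 'X_{1.. n}).
Let y j : A := psi (mfps_var W j) - std_lift char_k W n (mfps_var W j).
Hypothesis cP : forall m, c m * (mnm_fact m)%:R = \prod_j y j ^+ m j.
Hypothesis g_bounded : forall m, exists w : W,
  g m * (mnm_fact m)%:R * (p ^ C)%:R = FracField.tofrac w.

(** The partial derivative of g of multi-index m. *)
Let dg m : KT := fun q => g (q + m)%MM * (mnm_fact (q + m)%MM)%:R / (mnm_fact q)%:R.

(* The terms of the double series obtained by expanding psi(t)^m' around the
   standard lift t^p; summing over m gives the image of g under psi, summing
   over m' gives the Taylor expansion of the standard image. *)
Let u m m' : K := frobK (g m') * (mnm_bin m' m)%:R *
  FracField.tofrac (((\prod_j y j ^+ m j) * mfps_mon W ((m' - m) *+ p)%MM) l).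

Let y_div j : exists z, y j = z *+ p.
Proof.
apply: redA_eq0; rewrite /y.
have eq_red : redA (psi (mfps_var W j)) = redA (std_lift char_k W n (mfps_var W j)).
  by rewrite !frobl_red.
by rewrite [LHS](raddfB (@mfps_map n W k witt_red)) [X in X - _]eq_red; apply: subrr.
Qed.

(** A nonzero term has |m| >= |m'| - |l|, and y^m contributes p^|m|. The denominator of g_m' is at
    most p^(C + v) with v = v_p(m'!) <= |m'| / 2, so the threshold leaves p^N, uniformly in m. *)
Let u_small N m m' : (2 * (N + C + mdeg l) <= mdeg m')%N -> small N (u m m').
Proof.
move=> le_m'; have [le_mm'|/mnm_bin_small bin0] := boolP (m <= m')%MM; last first.
  by rewrite /u bin0 mulr0 mul0r; apply: small0.
have [le_l|nle_l] := boolP (((m' - m) *+ p)%MM <= l)%MM; last first.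
  rewrite /u [X in FracField.tofrac (X l)]mulrC mfps_monM (negPf nle_l) rmorph0 mulr0.
  exact: small0.
have le_deg : (mdeg m' <= mdeg m + mdeg l)%N.
  rewrite -(submK le_mm') mdegD addnC leq_add2l.
  apply: (@leq_trans (mdeg ((m' - m) *+ p)%MM)); first by rewrite mdegMn leq_pmulr.
  by rewrite !mdegE leq_sum // => i _; apply/mnm_lepP.
have [w wP] := g_bounded m'.
have [w' w'P] := witt_nat_decomp p_prime char_k W (mnm_fact_gt0 m').
set v := logn p _ in w'P.
have le_v : (v.*2 <= mdeg m')%N by apply: logn_mnm_fact.
have /choice[z zP] := y_div.
have yz : \prod_j y j ^+ m j = (\prod_j z j ^+ m j) *+ p ^ mdeg m.
  rewrite (eq_bigr (fun j => z j ^+ m j * p%:R ^+ m j)); last first.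
    by move=> j _; rewrite zP -[z j *+ p]mulr_natr exprMn.
  by rewrite big_split /= prodrXr -mdegE -natrX mulr_natr.
pose Z := (\prod_j z j ^+ m j) * mfps_mon W ((m' - m) *+ p)%MM.
apply: (small_quotient (c := C + v) (e := mdeg m)
  (w := witt_frob w * w' * (mnm_bin m' m)%:R * Z l) p_neq0); first by lia.
have eq_g : frobK (g m') * (mnm_fact m')%:R * (p ^ C)%:R = FracField.tofrac (witt_frob w).
  by rewrite -frobK_tofrac -wP !rmorphM !rmorph_nat.
have eq_w' : (p ^ v)%:R = FracField.tofrac w' * (mnm_fact m')%:R :> K.
  by have := congr1 (@FracField.tofrac W) w'P; rewrite tofracM tofracXn !rmorph_nat natrX.
have -> : u m m' = frobK (g m') * (mnm_bin m' m)%:R * (FracField.tofrac (Z l) * (p ^ mdeg m)%:R).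
  by congr (_ * _); rewrite yz mulrnAl mfpsMn tofracMn mulr_natr.
rewrite !tofracM rmorph_nat -eq_g expnD natrM eq_w' /=.
by ring.
Qed.

Let u_row m' D : m' \in mnm_box n D ->
  \sum_(m <- mnm_box n D) u m m' =
  frobK (g m') * FracField.tofrac ((\prod_j psi (mfps_var W j) ^+ m' j) l).
Proof.
move=> box_m'.
rewrite (eq_bigr (fun j => (std_lift char_k W n (mfps_var W j) + y j) ^+ m' j)); last first.
  by move=> j _; rewrite /y addrC subrK.
rewrite (mfps_prod_binomial _ _ box_m') mfps_sum rmorph_sum mulr_sumr.
apply: eq_bigr => m _; rewrite mfpsMn rmorphMn /= /u -mulrA mulr_natl.
congr (_ * (FracField.tofrac (mfps_mul _ _ l) *+ _)).
rewrite -mfps_var_prod; apply: eq_bigr => j _.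
rewrite -[std_frob _]/(std_lift char_k W n _) std_lift_var mulmnE mulnC exprM; congr (_ ^+ _).
rewrite -mfps_var_prod (bigD1 j) //= big1 ?mulr1 ?mulmnE ?mnm1E ?eqxx ?mul1n //.
by move=> i ne_ij; rewrite mulmnE mnm1E eq_sym (negPf ne_ij) mul0n.
Qed.

(** Only the m' with p |m' - m| <= |l| contribute, so a column is a finite sum; for m in the box D
    these m' lie in the box enlarged by |l| + 1. *)
Let u_col m D : m \in mnm_box n D ->
  (toKT (c m) * mfps_frob p (@frobK p k W) (dg m)) l =
  \sum_(m' <- mnm_box n (D + (mdeg l).+1)) u m m'.
Proof.
rewrite mem_mnm_box => /forallP lt_m.
pose F : KT := \sum_(m' <- mnm_box n (D + (mdeg l).+1))
  mfps_const n (frobK (g m') * (mnm_bin m' m * mnm_fact m)%:R) * mfps_mon K ((m' - m) *+ p)%MM.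
have -> : (toKT (c m) * mfps_frob p (@frobK p k W) (dg m)) l = (toKT (c m) * F) l.
  apply: eq_mfps_mul => // q ql; rewrite /F mfps_sum.
  under eq_bigr do rewrite mfps_constM mfps_monE.
  rewrite /mfps_frob; case: ifPn => [/(mnm_dvdP p_gt0)[q' eq_q]|nd]; last first.
    rewrite big1 // => m' _; case: eqP => [e|]; last by rewrite mulr0.
    by case/negP: nd; apply/(mnm_dvdP p_gt0); exists (m' - m)%MM.
  rewrite eq_q mnm_divK //.
  have box_q : (q' + m)%MM \in mnm_box n (D + (mdeg l).+1).
    rewrite mem_mnm_box; apply/forallP => j; rewrite mnmDE addnC -addSn leq_add //.
    apply: leq_trans (leqW ql); rewrite eq_q mdegMn.
    apply: (@leq_trans (mdeg q')); last by rewrite leq_pmulr.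
    by rewrite mdegE (bigD1 j) //= leq_addr.
  rewrite (bigD1_seq _ box_q) ?mnm_box_uniq //= [X in _ + X]big1 ?addr0.
    rewrite addmK eqxx mulr1 /dg.
    have fact_q' : (mnm_fact q')%:R != 0 :> K.
      by rewrite (fracK_nat_neq0 p_prime char_k) // mnm_fact_gt0.
    rewrite -mulrA rmorphM; congr (_ * _).
    rewrite (addmC q') -mnm_bin_fact mulnA natrM mulfK // rmorph_nat.
    by rewrite natrM.
  move=> m' ne_m'; case: eqP => [e|]; last by rewrite mulr0.
  have [le_mm'|/mnm_bin_small ->] := boolP (m <= m')%MM; last by rewrite !mulr0 mul0r.
  case/eqP: ne_m'; rewrite -(submK le_mm'); congr (_ + _)%MM.
  by move/(congr1 (mnm_div p)): e; rewrite !mnm_divK.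
rewrite /F mulr_sumr mfps_sum; apply: eq_bigr => m' _.
rewrite mulrCA mfps_constM /u natrM -!mulrA; congr (_ * (_ * _)).
have -> : mfps_mon K ((m' - m) *+ p)%MM = toKT (mfps_mon W ((m' - m) *+ p)%MM).
  by apply: funext => q; rewrite /toKT /mfps_map !mfps_monE rmorph_nat.
rewrite -cP -mfps_natM.
have toKTM (a b : A) : toKT (a * b) = toKT a * toKT b by exact: (rmorphM (@mfps_map n W K (@FracField.tofrac W))).
have toKTn j : toKT (j%:R : A) = j%:R by exact: (rmorph_nat (@mfps_map n W K (@FracField.tofrac W))).
congr (_ * _); rewrite -[RHS]/(toKT _ l) !toKTM toKTn.
by apply: (congr1 (fun f : KT => f l)); ring.
Qed.

Let box_split D (I : seq 'X_{1.. n}) (F : 'X_{1.. n} -> K) : uniq I ->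
  (forall m, m \in mnm_box n D -> m \in I) ->
  \sum_(m <- I) F m
  = \sum_(m <- mnm_box n D) F m + \sum_(m <- I | m \notin mnm_box n D) F m.
Proof.
move=> uniqI sub; rewrite (bigID (mem (mnm_box n D))) /=; congr (_ + _).
rewrite -big_filter; apply: perm_big; apply: uniq_perm.
- exact: filter_uniq.
- exact: mnm_box_uniq.
by move=> m; rewrite mem_filter; apply/andP/idP => [[]//|mD]; split=> //; apply: sub.
Qed.

(** Exchange of summation: S sums whole columns, S1 a square box, and S2 the rows of I outside the
    box. Both S - S1 and S2 involve only terms with m' outside the box, where [u] is small uniformly
    in m. *)
Lemma taylor_frob_image s :
  p_sum p (@integral p k W)
    (fun m => (toKT (c m) * mfps_frob p (@frobK p k W) (dg m)) l) s ->
  p_sum p (@integral p k W)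
    (fun m => frobK (g m) * FracField.tofrac ((\prod_j psi (mfps_var W j) ^+ m j) l)) s.
Proof.
move=> sum_s N; have [d dP] := sum_s N.
(* D suffices both for the given convergence at precision N and for [u_small]; indices in the box
   have degree at most n D, so I contains the box. *)
pose D := maxn d (2 * (N + C + mdeg l)); exists (n * D).+1 => I uniqI subI.
have sub_box m : m \in mnm_box n D -> m \in I.
  by move=> /mnm_box_bound mD; apply: subI.
have out_box E m : m \notin mnm_box n D -> small N (u E m).
  move=> nbox; apply: u_small; apply: leq_trans (leq_maxr d _) _.
  by rewrite leqNgt; apply: contra nbox; apply: mnm_box_mdeg.
have := dP (mnm_box n D) (mnm_box_uniq n D).
case=> [m md|]; first by apply: mnm_box_mdeg; apply: leq_trans md (leq_maxl _ _).
move=> x; set S := \sum_(m <- _) _ => sx eq_x.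
have {}eq_x : small N (s - S) by exists x.
rewrite (box_split _ uniqI sub_box).
set S1 := \sum_(m <- mnm_box n D) _; set S2 := \sum_(m <- I | _) _.
rewrite (_ : s - (S1 + S2) = (s - S) + (S - S1) - S2); last by ring.
apply: smallB; last first.
  apply: small_sum => m nbox; rewrite -(@u_row m (mdeg m).+1) ?mnm_box_mdeg //.
  by apply: small_sum => E _; apply: out_box.
apply: smallD => //.
have -> : S = \sum_(m <- mnm_box n D) \sum_(m' <- mnm_box n (D + (mdeg l).+1)) u m m'.
  by rewrite /S; apply: eq_big_seq => m; apply: u_col.
have -> : S1 = \sum_(m <- mnm_box n D) \sum_(m' <- mnm_box n D) u m m'.
  rewrite exchange_big /S1; apply: eq_big_seq => m' mD.
  by rewrite (u_row mD).
rewrite -sumrB; apply: small_sum => m _.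
rewrite (@box_split D) ?mnm_box_uniq // => [|m']; last first.
  rewrite !mem_mnm_box => /forallP lt_m'; apply/forallP => j.
  exact: leq_trans (lt_m' j) (leq_addr _ _).
rewrite addrAC subrr add0r; apply: small_sum => m'; exact: out_box.
Qed.

End Taylor.

Section NablaPow.
Variables (p : nat) (k : fieldType) (W : wittRing p k) (n : nat).
Variable H : crystal W n.
Implicit Types (x y : H) (m : 'X_{1.. n}).

Let fold m (s : seq 'I_n) x : H :=
  foldr (fun i y => iter (m i) (fun z => nabla z i) y) x s.

Let iter_comm i j N x :
  iter N (fun z : H => nabla z i) (nabla x j) = nabla (iter N (fun z : H => nabla z i) x) j.
Proof. by elim: N => //= N ->; apply: nabla_comm. Qed.

Let fold_comm m s x j : fold m s (nabla x j) = nabla (fold m s x) j.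
Proof. by elim: s => //= i s ->; apply: iter_comm. Qed.

Let foldU m s x j : uniq s -> fold (m + U_(j))%MM s x =
  if j \in s then nabla (fold m s x) j else fold m s x.
Proof.
elim: s => //= i s IH /andP[nis us]; rewrite IH // in_cons mnmDE mnm1E.
have [->|ne_ij] := eqVneq j i; first by rewrite (negPf nis) addn1.
by rewrite addn0 /=; case: ifP => // _; rewrite iter_comm.
Qed.

Lemma nabla_powU m x j : nabla_pow (m + U_(j))%MM x = nabla (nabla_pow m x) j.
Proof. by rewrite [LHS]foldU ?enum_uniq // mem_enum. Qed.

Lemma nabla_pow_nabla m x j : nabla_pow m (nabla x j) = nabla (nabla_pow m x) j.
Proof. exact: fold_comm. Qed.

Lemma nabla_pow0 x : nabla_pow 0%MM x = x.
Proof. by rewrite /nabla_pow; elim: (enum _) => //= i s ->; rewrite mnm0E. Qed.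

Lemma mnm_ind (P : 'X_{1.. n} -> Prop) :
  P 0%MM -> (forall m j, P m -> P (m + U_(j))%MM) -> forall m, P m.
Proof.
move=> P0 PU m; have [d] := ubnP (mdeg m); elim: d m => // d IH m.
rewrite ltnS => md; have [->//|m0] := eqVneq m 0%MM.
have [j mj] : exists j, m j != 0%N.
  apply/existsP; apply: contraNT m0; rewrite negb_exists => /forallP m0.
  by apply/eqP/mnmP => j; rewrite mnm0E; apply/eqP; rewrite -[_ == _]negbK.
rewrite -(submK (m := U_(j)%MM) (m' := m)) ?lep1mP //; apply/PU/IH.
apply: leq_trans md; rewrite -[X in (_ < mdeg X)%N](submK (m := U_(j)%MM)) ?lep1mP //.
by rewrite mdegD mdeg1 addn1.
Qed.

Lemma nabla_pow_add q m x : nabla_pow q (nabla_pow m x) = nabla_pow (q + m)%MM x.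
Proof.
elim/mnm_ind: m => [|m j IH]; first by rewrite nabla_pow0 addm0.
by rewrite addmA !nabla_powU nabla_pow_nabla IH.
Qed.

Lemma nabla_powD m x y : nabla_pow m (x + y) = nabla_pow m x + nabla_pow m y.
Proof.
elim/mnm_ind: m => [|m j IH]; first by rewrite !nabla_pow0.
by rewrite !nabla_powU IH nabla_addE.
Qed.

End NablaPow.

(** * Horizontal functionals and their behaviour under Frobenius *)

Section HorizontalFunctional.
Variables (p : nat) (p_gt2 : (2 < p)%N).
Variables (k : closedFieldType) (char_k : p \in [pchar k]) (W : wittRing p k) (n : nat).
Variable H : fcrystal W n.
Let p_prime : prime p := pcharf_prime char_k.
Let p_gt0 : (0 < p)%N := prime_gt0 p_prime.
Local Notation A := (mfps n W).
Local Notation K := {fraction W}.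
Local Notation KT := (mfps n K).
Local Notation phi := (std_lift char_k W n).
Local Notation frobKT := (mfps_frob p (@frobK p k W)).
Implicit Types (x y : H) (m : 'X_{1.. n}).

Let K_nat_neq0 N : (0 < N)%N -> N%:R != 0 :> K.
Proof. exact: fracK_nat_neq0. Qed.

(** K has characteristic 0. With [mnm_ind], this proves identities of series by comparing constant
    terms and derivatives. *)
Lemma mfps_derivI (f g : KT) j m : mfps_deriv j f m = mfps_deriv j g m ->
  f (m + U_(j))%MM = g (m + U_(j))%MM.
Proof.
rewrite !mfps_derivE -[LHS]mulr_natr -[RHS]mulr_natr; apply: mulIf.
exact: K_nat_neq0.
Qed.

Lemma toKT_is_zmod_morphism : zmod_morphism (@toKT p k W n).
Proof. exact: (raddfB (@mfps_map n W K (@FracField.tofrac W))). Qed.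
HB.instance Definition _ := GRing.isZmodMorphism.Build A KT (@toKT p k W n)
  toKT_is_zmod_morphism.
Lemma toKT_is_monoid_morphism : monoid_morphism (@toKT p k W n).
Proof.
split; first exact: (rmorph1 (@mfps_map n W K (@FracField.tofrac W))).
exact: (rmorphM (@mfps_map n W K (@FracField.tofrac W))).
Qed.
HB.instance Definition _ := GRing.isMonoidMorphism.Build A KT (@toKT p k W n)
  toKT_is_monoid_morphism.

Lemma toKT_deriv j (a : A) : toKT (mfps_deriv j a) = mfps_deriv j (toKT a).
Proof. exact: mfps_map_deriv. Qed.
Lemma toKT_mon m : toKT (mfps_mon W m) = mfps_mon K m.
Proof. by apply: funext => q; rewrite /toKT /mfps_map !mfps_monE rmorph_nat. Qed.

Variable ev : H -> K.
Hypothesis evD : forall x y, ev (x + y) = ev x + ev y.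
Hypothesis evZ : forall a x, ev (a *: x) = FracField.tofrac (a 0%MM) * ev x.

(* The Taylor series at the origin of the horizontal functional extending ev *)
Definition hor x : KT := fun m => ev (nabla_pow m x) / (mnm_fact m)%:R.

Lemma horD x y : hor (x + y) = hor x + hor y.
Proof. by apply: funext => m; rewrite mfpsD /hor nabla_powD evD mulrDl. Qed.

Lemma hor0coef x : hor x 0%MM = ev x.
Proof. by rewrite /hor nabla_pow0 mnm_fact0 divr1. Qed.

Lemma hor_nabla x j : hor (nabla x j) = mfps_deriv j (hor x).
Proof.
apply: funext => m; rewrite mfps_derivE /hor nabla_pow_nabla nabla_powU mnm_factU.
rewrite natrM invfM mulrA -[RHS]mulr_natr mulfVK //.
exact: K_nat_neq0.
Qed.

(** Both sides obey the same Leibniz rule, so induction on the multi-index works for all a and x at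
    once. *)
Lemma horZ a x : hor (a *: x) = toKT a * hor x.
Proof.
apply: funext => m; elim/mnm_ind: m a x => [|m j IH] a x.
  by rewrite hor0coef evZ -[RHS]/(mfps_coef0 _) rmorphM /= /mfps_coef0 hor0coef.
apply: mfps_derivI; rewrite -hor_nabla nabla_scaleE horD mfpsD !IH.
by rewrite mfps_derivM mfpsD toKT_deriv hor_nabla.
Qed.

Lemma hor_sum (I : Type) (r : seq I) (P : pred I) (F : I -> H) :
  hor (\sum_(i <- r | P i) F i) = \sum_(i <- r | P i) hor (F i).
Proof.
apply: (big_morph hor horD).
by rewrite -(scale0r (0 : H)) horZ rmorph0 mul0r.
Qed.

Variable d : nat.
Hypothesis ev_frob : forall x, ev (Frob phi x) = frobK (ev x) *+ p ^ d.

(** Differentiating in direction j multiplies both sides by p t_j^(p-1) and replaces x by nabla x j.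
    The monomial mixes coefficients, so the induction is on a bound for the degree, for all x. *)
Lemma hor_std_frob x : hor (Frob phi x) = frobKT (hor x) *+ p ^ d.
Proof.
apply: funext => m; have [b] := ubnP (mdeg m).
elim: b m x => // b IH m x; rewrite ltnS.
elim/mnm_ind: m => [_|m j _ mb].
  by rewrite hor0coef ev_frob mfpsMn mfps_frob_coef0 // hor0coef.
rewrite mdegD mdeg1 addn1 in mb.
apply: mfps_derivI; rewrite -hor_nabla nabla_std_frob horZ.
rewrite raddfMn /= mfps_frob_deriv // -mulrnAr -hor_nabla.
have -> : toKT (p%:R * mfps_mon W (U_(j) *+ p.-1)%MM : A) = p%:R * mfps_mon K (U_(j) *+ p.-1)%MM.
  by rewrite rmorphM rmorph_nat /= toKT_mon.
by apply: eq_mfps_mul => // q qm; apply: IH; apply: leq_ltn_trans mb.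
Qed.

Variable C : nat.
Hypothesis ev_bounded :
  forall x, exists w : W, ev x * (p ^ C)%:R = FracField.tofrac w.

Let hor_bounded x m : exists w : W,
  hor x m * (mnm_fact m)%:R * (p ^ C)%:R = FracField.tofrac w.
Proof.
have [w wP] := ev_bounded (nabla_pow m x); exists w.
by rewrite /hor divfK ?wP // K_nat_neq0 // mnm_fact_gt0.
Qed.

Lemma exact_divP (x y : A) : (exists q, q * y = x) -> exact_div x y * y = x.
Proof. by move=> ex; rewrite /exact_div; case: pselect => // e; case: (cid e). Qed.

(** Neither [exact_div] takes its default value: m_j! divides p^(m_j) in W, and two lifts of
    Frobenius agree modulo p. *)
Lemma chi_coef_fact (psi : frobLift W n) m :
  chi_coef psi phi m * (mnm_fact m)%:R
  = \prod_j (psi (mfps_var W j) - phi (mfps_var W j)) ^+ m j.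
Proof.
rewrite /chi_coef /mnm_fact natr_prod -big_split; apply: eq_bigr => j _ /=.
rewrite mulrAC exact_divP; last first.
  have [w wP] := witt_nat_decomp p_prime char_k W (fact_gt0 (m j)).
  have le_v : (logn p (m j)`! <= m j)%N.
    by have := logn_fact_half (m j) p_prime p_gt2; lia.
  exists (mfps_const n (w * p%:R ^+ (m j - logn p (m j)`!))).
  rewrite -(rmorph_nat (@mfps_const n W)) -rmorphM mulrAC wP -exprD subnKC //.
  by rewrite rmorphXn rmorph_nat.
rewrite -exprMn mulrC exact_divP //.
have eq_red : redA (psi (mfps_var W j)) = redA (phi (mfps_var W j)).
  by rewrite !frobl_red.
have [q ->] : exists q, psi (mfps_var W j) - phi (mfps_var W j) = q *+ p.
  by apply: redA_eq0; rewrite [LHS](raddfB (@mfps_map n W k witt_red)) [X in X - _]eq_red subrr.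
by exists q; rewrite mulr_natr.
Qed.

(** The l-th coefficient of [hor] composed with F(phi) is applied to the expansion of chi(psi, phi).
    The term of index m becomes p^d times the coefficient of [chi_coef] times the standard image of
    the m-th derivative of [hor x], as in [taylor_frob_image]. *)
Lemma hor_frob_image (psi : frobLift W n) x (g : KT) :
  hor (Frob psi x) = g *+ p ^ d -> frob_image psi (hor x) g.
Proof.
move=> eq_g l.
apply: (@taylor_frob_image p p_gt2 k char_k W n psi (hor x) (chi_coef psi phi) C l) => //; first exact: chi_coef_fact.
have [chi chiP frobE] := frob_chi H psi phi.
have FrobE : Frob psi x = frob H phi (chi (pull psi x)) by rewrite frobE.
have pd0 : (p ^ d)%:R != 0 :> K by apply: K_nat_neq0; rewrite expn_gt0 p_gt0.
(* The extra precision pays for the division by p^d and for the denominator p^C l! of the l-th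
   coefficient. *)
move=> N; have [b bP] := chiP x (N + (d + C + logn p (mnm_fact l)))%N.
exists b => I uniqI subI; have [y _ yP] := bP I uniqI subI.
pose L z : K := hor (frob H phi z) l.
have LB z z' : L (z - z') = L z - L z'.
  rewrite /L linearB horD -[- frob H phi z']scaleN1r horZ rmorphN1 mulN1r.
  by rewrite mfpsD mfpsN.
have L0 : L 0 = 0 by rewrite -[X in L X](subrr 0) LB subrr.
have LD z z' : L (z + z') = L z + L z' by rewrite -[in LHS](opprK z') LB -[- z']sub0r LB L0 sub0r opprK.
have Lsum (F : 'X_{1.. n} -> pullback H) : L (\sum_(m <- I) F m) = \sum_(m <- I) L (F m).
  exact: (big_morph L LD L0).
have Lterm m : L (chi_coef psi phi m *: pull phi (nabla_pow m x)) =
    (toKT (chi_coef psi phi m) * frobKT (fun q : 'X_{1.. n} =>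
         hor x (q + m)%MM * (mnm_fact (q + m))%:R / (mnm_fact q)%:R)) l * (p ^ d)%:R.
  rewrite /L linearZ horZ -[frob H phi _]/(Frob phi _) hor_std_frob.
  rewrite [X in X l]mulrnAr mfpsMn [RHS]mulr_natr.
  congr (mfps_mul _ (mfps_frob _ _ _) l *+ _).
  apply: funext => q; rewrite /hor nabla_pow_add divfK //.
  by rewrite K_nat_neq0 // mnm_fact_gt0.
have {yP} := congr1 L yP; rewrite LB Lsum.
under eq_bigr do rewrite Lterm.
rewrite -mulr_suml -[X in X - _]/(hor (frob H phi (chi (pull psi x))) l) -FrobE eq_g mfpsMn.
rewrite -[g l *+ _]mulr_natr -mulrBl => eq_L.
have [w wP] := hor_bounded (frob H phi y) l.
have [w' w'P] := witt_nat_decomp p_prime char_k W (mnm_fact_gt0 l).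
set v := logn p _ in w'P eq_L *.
apply: (small_quotient (c := d + C + v) (e := N + (d + C + v)) (w := w * w') (K_nat_neq0 p_gt0)) => //.
have eq_w' : (p ^ v)%:R = FracField.tofrac w' * (mnm_fact l)%:R :> K.
  by have := congr1 (@FracField.tofrac W) w'P; rewrite tofracM tofracXn !rmorph_nat natrX.
rewrite !expnD 2!natrM mulrA mulrA eq_L.
have -> : L (y *+ p ^ (N + (d + C + v))) = L y * (p ^ (N + (d + C + v)))%:R.
  rewrite /L -scaler_nat linearZ horZ rmorph_nat mfps_natM mulrC //.
rewrite tofracM -wP eq_w' !expnD !natrM /L.
by ring.
Qed.

End HorizontalFunctional.

(** * The period matrix *)

Section SlopeSplitting.
Variables (p : nat) (k : closedFieldType) (char_k : p \in [pchar k]) (W : wittRing p k).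
Let p_prime : prime p := pcharf_prime char_k.
Let p_gt0 : (0 < p)%N := prime_gt0 p_prime.
Local Notation K := {fraction W}.
Variables (I : finType) (deg : I -> nat) (M : I -> I -> K).
Hypothesis M_upper : forall c b, (deg b <= deg c)%N -> M c b = (b == c)%:R *+ p ^ deg b.

Let sumM (t : I -> K) b :
  \sum_c t c * M c b = t b *+ p ^ deg b + \sum_(c | (deg c < deg b)%N) t c * M c b.
Proof.
rewrite (bigID (fun c => (deg c < deg b)%N)) /= addrC; congr (_ + _).
rewrite (bigD1 b) ?ltnn //= M_upper // eqxx mulrnAr mulr1 big1 ?addr0 // => c.
rewrite -leqNgt => /andP[le_bc ne_cb].
by rewrite M_upper // eq_sym (negPf ne_cb) mul0rn mulr0.
Qed.

(* Solved degree by degree: each step is an equation sigma(y) = p^d y + r with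
   d > 0, which always has a solution in K. *)
Lemma slope_row a : exists t : I -> K,
  (forall b, (deg b <= deg a)%N -> t b = (a == b)%:R) /\
  (forall b, \sum_c t c * M c b = frobK (t b) *+ p ^ deg a).
Proof.
suff [t [t0 tP]] : exists t : I -> K,
    (forall b, (deg b <= deg a)%N -> t b = (a == b)%:R) /\
    (forall b, (deg b < (\max_b deg b).+1)%N ->
       \sum_c t c * M c b = frobK (t b) *+ p ^ deg a).
  by exists t; split=> // b; apply: tP; rewrite ltnS leq_bigmax.
elim: (_.+1) => [|D [t [t0 tP]]]; first by exists (fun b => (a == b)%:R).
have [le_Da|lt_aD] := leqP D (deg a).
  exists t; split=> // b; rewrite ltnS leq_eqVlt => /orP[/eqP bD|]; last exact: tP.
  rewrite sumM big1 ?addr0 => [|c lt_cb].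
    rewrite t0 ?bD // rmorph_nat; have [->|_] := eqVneq a b; first by rewrite bD.
    by rewrite mulr0n !mul0rn.
  have lt_ca : (deg c < deg a)%N by apply: leq_trans lt_cb _; rewrite bD.
  rewrite t0 1?ltnW //; case: eqP => [e|]; last by rewrite mul0r.
  by rewrite e ltnn in lt_ca.
have pa0 : (p ^ deg a)%:R != 0 :> K.
  by rewrite (fracK_nat_neq0 p_prime char_k) // expn_gt0 p_gt0.
have Da : (0 < D - deg a)%N by rewrite subn_gt0.
have /choice[y yP] : forall b, exists y, frobK y = y *+ p ^ (D - deg a) +
    (\sum_(c | (deg c < deg b)%N) t c * M c b) / (p ^ deg a)%:R.
  by move=> b; apply: (frobK_affine p_prime char_k).
exists (fun b => if deg b == D then y b else t b); split=> [b le_ba|b].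
  by case: eqP => [bD|_]; [rewrite bD leqNgt lt_aD in le_ba | apply: t0].
rewrite ltnS leq_eqVlt => /orP[/eqP bD|bD].
  rewrite sumM bD eqxx yP mulrnDl -mulrnA -expnD subnK 1?ltnW //; congr (_ + _).
  rewrite -[RHS]mulr_natr divfK // bD; apply: eq_bigr => c.
  by case: eqP => // ->; rewrite ltnn.
rewrite (ltn_eqF bD) -tP // !sumM (ltn_eqF bD); congr (_ + _).
apply: eq_bigr => c lt_cb; case: eqP => // cD.
by move: bD; rewrite -cD => /(ltn_trans lt_cb); rewrite ltnn.
Qed.

End SlopeSplitting.

Lemma cy_gram_sqr (R : pzRingType) h : cy_gram R h *m cy_gram R h = - 1%:M.
Proof.
rewrite !cy_gramE /block4 !mulmx_block !(mulmx0, mul0mx, mulmx1, mul1mx, addr0, add0r).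
have neg1 r r' : - 1%:M = block_mx (- 1%:M) 0 0 (- 1%:M) :> 'M[R]_(r + r').
  by rewrite scalar_mx_block opp_block_mx !oppr0.
by rewrite !add_block_mx !(addr0, add0r) -!neg1 !block_mx0 -neg1.
Qed.

Lemma map_cy_gram (R R' : pzRingType) (f : {rmorphism R -> R'}) h :
  map_mx f (cy_gram R h) = cy_gram R' h.
Proof. by rewrite !cy_gramE /block4 !map_block_mx !map_mxN !map_mx0 !map_mx1. Qed.

Lemma congruence_derivation (R : comPzRingType) r (T G w : 'M[R]_r) :
  T *m w *m G *m T^T + T *m G *m (T *m w)^T = T *m (w *m G + G *m w^T) *m T^T.
Proof. by rewrite trmx_mul mulmxDr mulmxDl !mulmxA. Qed.

(** Conjugation by G passes from the symplectic condition on vectors to the one on functionals,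
    which the rows of [T] need. *)
Lemma symplectic_dual (R : comPzRingType) r (G w : 'M[R]_r) :
  G *m G = - 1%:M -> w^T *m G + G *m w = 0 -> w *m G + G *m w^T = 0.
Proof.
move=> GG /(congr1 (fun X => G *m X *m G)).
rewrite mulmx0 mul0mx mulmxDr mulmxDl !mulmxA GG -mulmxA GG.
by rewrite mulmxN mulmx1 !mulNmx mul1mx -opprD addrC => /eqP; rewrite oppr_eq0 => /eqP.
Qed.

Section DegreeOfIndex.
Variable h : nat.
Implicit Types a b : 'I_((1 + h) + (h + 1)).

Lemma cy_deg_valP a : [/\ (nat_of_ord a == 0%N) = (cy_deg a == 0%N),
  (1 <= a <= h)%N = (cy_deg a == 1%N), (h + 1 <= a <= 2 * h)%N = (cy_deg a == 2%N)
  & (nat_of_ord a == (2 * h + 1)%N) = (cy_deg a == 3%N)].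
Proof.
rewrite /cy_deg; case: (split_ordP a) => c ->; case: (split_ordP c) => d ->;
  rewrite !(cat_fam_l, cat_fam_r) /=; have := ltn_ord d; split; apply/idP/idP; lia.
Qed.

Lemma cy_gram_deg (R : pzRingType) a b :
  (cy_deg a + cy_deg b != 3)%N -> cy_gram R h a b = 0.
Proof.
rewrite !cy_gramE /block4 /cy_deg.
case: (split_ordP a) => a1 ->; case: (split_ordP a1) => a2 ->;
case: (split_ordP b) => b1 ->; case: (split_ordP b1) => b2 ->;
by rewrite !(block_mxEul, block_mxEur, block_mxEdl, block_mxEdr, cat_fam_l, cat_fam_r) ?mxE.
Qed.

(** Off the diagonal T strictly raises degrees, while G pairs only degrees with sum 3; when a and b
    already have sum 3, only the diagonal entries of T contribute. *)
Lemma unipotent_congruence_deg (R : comNzRingType) (T : 'M[R]_((1 + h) + (h + 1))) a b :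
  (forall a b, (cy_deg b <= cy_deg a)%N -> T a b = (a == b)%:R) ->
  (cy_deg a + cy_deg b = 3)%N ->
  (T *m cy_gram R h *m T^T) a b = cy_gram R h a b.
Proof.
move=> uniT ab3.
have T0 c d : (cy_deg d <= cy_deg c)%N -> c != d -> T c d = 0.
  by move=> le_dc /negPf ne; rewrite uniT // ne.
have -> : (T *m cy_gram R h *m T^T) a b =
    \sum_c (\sum_d T a d * cy_gram R h d c) * T b c.
  by rewrite mxE; apply: eq_bigr => c _; rewrite mxE [T^T c b]mxE.
rewrite (bigD1 b) //= [X in _ + X]big1 ?addr0 => [|c ne_cb].
  rewrite (uniT b b) // eqxx mulr1 (bigD1 a) //= (uniT a a) // eqxx mul1r.
  rewrite big1 ?addr0 // => d ne_da.
  have [le_da|lt_ad] := leqP (cy_deg d) (cy_deg a).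
    by rewrite T0 ?mul0r // eq_sym.
  by rewrite cy_gram_deg ?mulr0 //; apply/eqP; lia.
have [le_cb|lt_bc] := leqP (cy_deg c) (cy_deg b).
  by rewrite T0 ?mulr0 // eq_sym.
rewrite big1 ?mul0r // => d _.
have [lt_da|le_ad] := ltnP (cy_deg d) (cy_deg a).
  by rewrite T0 ?mul0r // 1?ltnW //; apply: contraTneq lt_da => ->; rewrite ltnn.
by rewrite cy_gram_deg ?mulr0 //; apply/eqP; lia.
Qed.

End DegreeOfIndex.

Section PeriodMatrix.
Variables (p : nat) (p_gt2 : (2 < p)%N).
Variables (k : closedFieldType) (char_k : p \in [pchar k]) (W : wittRing p k).
Variables (n h : nat) (H : fcrystal W n).
Variables (U Fil : nat -> H -> Prop) (B : {biscalar H}).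
Hypothesis CY : ordinary_CY3 h U Fil B.
Let p_prime : prime p := pcharf_prime char_k.
Let p_gt0 : (0 < p)%N := prime_gt0 p_prime.
Local Notation A := (mfps n W).
Local Notation K := {fraction W}.
Local Notation KT := (mfps n K).
Local Notation N := ((1 + h) + (h + 1))%N.
Local Notation phi := (std_lift char_k W n).
Local Notation toK := (@FracField.tofrac W).
Local Notation toKTm := (map_mx (@toKT p k W n)).
Local Notation frob0 := (@frobK p k W).

Variable e : 'I_N -> H.
Hypothesis basis_e : is_basis (@everything H) e.
Hypothesis e_part : forall b, hodge_part U Fil (cy_deg b) (e b).
Hypothesis e_flat : forall b j, pred_fil U (cy_deg b) (nabla (e b) j).
Hypothesis e_frob :
  forall b, pred_fil U (cy_deg b) (Frob phi (e b) - e b *+ p ^ cy_deg b).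
Hypothesis e_gram : \matrix_(i, j) B (e i) (e j) = cy_gram A h.
Local Notation coord := (coord_of basis_e).

Definition connection_matrix j : 'M[A]_N := \matrix_(c, b) coord (nabla (e b) j) c.
Definition frobenius_matrix (psi : frobLift W n) : 'M[A]_N :=
  \matrix_(c, b) coord (Frob psi (e b)) c.

Let B_gram i j : B (e i) (e j) = cy_gram A h i j.
Proof. by rewrite -e_gram mxE. Qed.

Let gram_const i j : cy_gram A h i j = mfps_const n (cy_gram W h i j).
Proof. by rewrite -(map_cy_gram (@mfps_const n W)) mxE. Qed.

Let B_coord x y : B x y = \sum_i \sum_j coord x i * (coord y j * cy_gram A h i j).
Proof.
rewrite {1}(coord_ofE basis_e x) linear_sumlz; apply: eq_bigr => i _.
rewrite linearZl_LR /= -mulr_sumr; congr (_ * _).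
rewrite {1}(coord_ofE basis_e y) linear_sumr; apply: eq_bigr => j _.
by rewrite linearZr /= B_gram.
Qed.

Lemma connection_symplectic j :
  connection_matrix j *m cy_gram A h + cy_gram A h *m (connection_matrix j)^T = 0.
Proof.
set w := connection_matrix j; set G := cy_gram A h.
have wG : w^T *m G + G *m w = 0.
  apply/matrixP => a b; rewrite !mxE.
  have := congr1 (fun r : 'rV[A]_n => r 0 j) (cy_nabla CY (e a) (e b)).
  rewrite !mxE B_gram gram_const mfps_deriv_const => eq0; rewrite -[RHS]eq0; congr (_ + _).
    rewrite {1}(coord_ofE basis_e (nabla (e a) j)) linear_sumlz.
    by apply: eq_bigr => c _; rewrite linearZl_LR /= B_gram !mxE.
  rewrite {1}(coord_ofE basis_e (nabla (e b) j)) linear_sumr.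
  by apply: eq_bigr => c _; rewrite linearZr /= B_gram !mxE mulrC.
exact: symplectic_dual (cy_gram_sqr _ _) wG.
Qed.

Let F0 : 'M[K]_N := map_mx toK (map_mx (@mfps_coef0 n W) (frobenius_matrix phi)).

Let F0_upper c b : (cy_deg b <= cy_deg c)%N -> F0 c b = (b == c)%:R *+ p ^ cy_deg b.
Proof.
move=> le_bc; rewrite !mxE (frob_coord CY basis_e e_part e_frob le_bc).
by rewrite !rmorphMn !rmorph1 eqxx.
Qed.

Let F0_symplectic : F0^T *m cy_gram K h *m F0 = (p ^ 3)%:R *: cy_gram K h.
Proof.
pose M := frobenius_matrix phi.
have MGM : M^T *m cy_gram A h *m M = (p ^ 3)%:R *: cy_gram A h.
  apply/matrixP => a b; rewrite [RHS]mxE [LHS]mxE.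
  have := cy_frob CY phi (e a) (e b).
  rewrite B_gram (_ : phi (cy_gram A h a b) = cy_gram A h a b); last first.
    by have := congr1 (fun X : 'M_N => X a b) (map_cy_gram phi h); rewrite [LHS]mxE.
  rewrite mulr_natl => <-; rewrite B_coord exchange_big; apply: eq_bigr => d _.
  rewrite [(_ *m _) a d]mxE mulr_suml; apply: eq_bigr => c _.
  by rewrite [M^T a c]mxE [M c a]mxE [M d b]mxE; ring.
have := congr1 (map_mx toK \o map_mx (@mfps_coef0 n W)) MGM.
rewrite /= !map_mxM !map_mxZ !map_trmx !map_cy_gram -/F0 => ->.
by rewrite !rmorph_nat.
Qed.

Let F0_symplectic' : F0 *m cy_gram K h *m F0^T = (p ^ 3)%:R *: cy_gram K h.
Proof.
set G := cy_gram K h; have GG : G *m G = - 1%:M by apply: cy_gram_sqr.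
have p3 : (p ^ 3)%:R != 0 :> K.
  by rewrite (fracK_nat_neq0 p_prime char_k) // expn_gt0 p_gt0.
pose c : K := - (p ^ 3)%:R^-1.
have FF : (c *: (G *m F0^T *m G)) *m F0 = 1%:M.
  rewrite -scalemxAl -!mulmxA [F0^T *m _]mulmxA F0_symplectic -scalemxAr GG.
  by rewrite scalerA mulNr mulVf // scaleN1r opprK.
have := mulmx1C FF; rewrite -scalemxAr => /(congr1 (fun X => (p ^ 3)%:R *: (X *m G))).
rewrite -scalemxAl scalerA mulrN divff // scaleN1r mul1mx => <-.
by rewrite -!mulmxA GG !mulmxN mulmx1 opprK.
Qed.

(** Compatibility with G is automatic. The entry r of T0 G T0^T at (a, b) satisfies sigma(r) p^(deg
    a + deg b) = p^3 r, hence vanishes unless the degrees have sum 3; in that case unipotency gives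
    its value. *)
Lemma slope_splitting : exists T0 : 'M[K]_N,
  [/\ forall a b, (cy_deg b <= cy_deg a)%N -> T0 a b = (a == b)%:R,
      forall a b, \sum_c T0 a c * F0 c b = frob0 (T0 a b) *+ p ^ cy_deg a
    & T0 *m cy_gram K h *m T0^T = cy_gram K h].
Proof.
have /choice[t tP] := slope_row char_k F0_upper.
pose T0 : 'M[K]_N := \matrix_(a, b) t a b.
have uniT0 a b : (cy_deg b <= cy_deg a)%N -> T0 a b = (a == b)%:R.
  by move=> le_ba; rewrite mxE (tP a).1.
have frobT0 a b : \sum_c T0 a c * F0 c b = frob0 (T0 a b) *+ p ^ cy_deg a.
  by rewrite mxE -(tP a).2; apply: eq_bigr => c _; rewrite mxE.
exists T0; split=> //; apply/matrixP => a b.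
have [ab3|ab3] := eqVneq (cy_deg a + cy_deg b)%N 3%N.
  exact: unipotent_congruence_deg.
rewrite cy_gram_deg //; set R := _ *m _.
apply: (@frobK_pow_uniq _ p_prime _ char_k W _ _ _ ab3).
pose D := \matrix_(a, b) (frob0 (T0 a b) *+ p ^ cy_deg a).
have DE c d : D c d = frob0 (T0 c d) *+ p ^ cy_deg c by rewrite [LHS]mxE.
have TF : T0 *m F0 = D.
  by apply/matrixP => c d; rewrite DE [LHS]mxE frobT0.
have eqR : (p ^ 3)%:R *: R = (T0 *m F0) *m cy_gram K h *m (T0 *m F0)^T.
  rewrite /R trmx_mul -!mulmxA [F0 *m _]mulmxA [F0 *m _ *m _]mulmxA.
  by rewrite F0_symplectic' -!scalemxAl -!scalemxAr.
have -> : R a b *+ p ^ 3 = (D *m cy_gram K h *m D^T) a b.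
  by rewrite -TF -eqR [RHS]mxE mulr_natl.
have frobG c d : frob0 (cy_gram K h c d) = cy_gram K h c d.
  by have := congr1 (fun X : 'M_N => X c d) (map_cy_gram frob0 h); rewrite [LHS]mxE.
have DG c : (D *m cy_gram K h) a c = frob0 ((T0 *m cy_gram K h) a c) *+ p ^ cy_deg a.
  rewrite [LHS]mxE [(T0 *m _) a c]mxE rmorph_sum -sumrMnl; apply: eq_bigr => d _.
  by rewrite DE rmorphM /= frobG mulrnAl.
rewrite [RHS]mxE [R a b]mxE rmorph_sum -sumrMnl; apply: eq_bigr => c _.
rewrite DG [D^T c b]mxE DE [T0^T c b]mxE rmorphM /= expnD mulrnA.
by rewrite mulrnAr mulrnAl.
Qed.

Section Frame.
Variable T0 : 'M[K]_N.
Hypothesis uniT0 : forall a b, (cy_deg b <= cy_deg a)%N -> T0 a b = (a == b)%:R.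
Hypothesis frobT0 :
  forall a b, \sum_c T0 a c * F0 c b = frob0 (T0 a b) *+ p ^ cy_deg a.

Let ev a (x : H) : K := \sum_b T0 a b * toK (coord x b 0%MM).

Let evD a x y : ev a (x + y) = ev a x + ev a y.
Proof.
rewrite -big_split; apply: eq_bigr => b _ /=.
by rewrite -[x in x + y]scale1r coord_of_linear mul1r mfpsD rmorphD mulrDr.
Qed.

Let evZ a c x : ev a (c *: x) = toK (c 0%MM) * ev a x.
Proof.
have -> : c *: x = c *: x + 0 by rewrite addr0.
rewrite mulr_sumr; apply: eq_bigr => b _ /=.
have coord0 : coord 0 b = 0.
  by rewrite (coord_of_uniq basis_e (c := fun=> 0)) // big1 // => i _; rewrite scale0r.
rewrite coord_of_linear coord0 addr0 -[(c * _) _]/(mfps_coef0 _) rmorphM rmorphM /=.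
by rewrite mulrCA.
Qed.

Let ev_sum a (F : 'I_N -> H) : ev a (\sum_i F i) = \sum_i ev a (F i).
Proof.
apply: (big_morph (ev a) (evD a)).
by rewrite -(scale0r (0 : H)) evZ mfps0 rmorph0 mul0r.
Qed.

Let ev_e a b : ev a (e b) = T0 a b.
Proof.
rewrite /ev (bigD1 b) //= coord_of_e eqxx mulr1n mfps1 eqxx rmorph1 mulr1.
rewrite big1 ?addr0 // => c ne_cb.
by rewrite coord_of_e eq_sym (negPf ne_cb) mulr0n mfps0 rmorph0 mulr0.
Qed.

Let ev_frob a x : ev a (Frob phi x) = frob0 (ev a x) *+ p ^ cy_deg a.
Proof.
rewrite {1}(coord_ofE basis_e x) raddf_sum /= ev_sum.
rewrite [in RHS](_ : ev a x = \sum_b T0 a b * toK (coord x b 0%MM)) //.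
rewrite rmorph_sum -sumrMnl; apply: eq_bigr => b _.
rewrite FrobZ evZ rmorphM /= mulrC -mulrnAl; congr (_ * _).
  by rewrite -frobT0; apply: eq_bigr => c _; rewrite !mxE.
by rewrite /std_frob mfps_frob_coef0 // -frobK_tofrac.
Qed.

Let ev_bounded a : exists C, forall x, exists w : W, ev a x * (p ^ C)%:R = toK w.
Proof.
have /choice[c cP] : forall b, exists c, exists w : W, T0 a b * (p ^ c)%:R = toK w.
  move=> b; have [c [w wP]] := frac_pE p_prime char_k (T0 a b).
  by exists c, w; rewrite mulr_natr.
have /choice[w wP] := cP; exists (\sum_b c b)%N => x.
exists (\sum_b w b * coord x b 0%MM * (p ^ (\sum_(i | i != b) c i))%:R).
rewrite mulr_suml rmorph_sum; apply: eq_bigr => b _ /=.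
by rewrite !tofracM rmorph_nat -wP (bigD1 b) //= expnD natrM; ring.
Qed.

Definition period : 'M[KT]_N := \matrix_(a, b) hor (ev a) (e b).

Let periodE a b : period a b = hor (ev a) (e b).
Proof. by rewrite mxE. Qed.

Let hor_coord a x : hor (ev a) x = \sum_c period a c * toKT (coord x c).
Proof.
rewrite {1}(coord_ofE basis_e x) (hor_sum char_k (evD a) (evZ a)); apply: eq_bigr => c _.
by rewrite (horZ char_k (evD a) (evZ a)) mulrC -periodE.
Qed.

Lemma period_deriv j :
  map_mx (mfps_deriv j) period = period *m toKTm (connection_matrix j).
Proof.
apply/matrixP => a b; rewrite [LHS]mxE [RHS]mxE periodE -hor_nabla // hor_coord.
by apply: eq_bigr => c _; rewrite !mxE.
Qed.

(** Induction on the degree of b: nabla lowers degrees, so the derivatives of the entry involve only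
    entries strictly below the diagonal blocks, already known to be 0. The entry is constant, with
    value that of T0. *)
Lemma period_unipotent a b : (cy_deg b <= cy_deg a)%N -> period a b = (a == b)%:R.
Proof.
have [d] := ubnP (cy_deg b); elim: d b => // d IH b; rewrite ltnS => bd le_ba.
have flat j : mfps_deriv j (period a b) = 0.
  rewrite periodE -hor_nabla // hor_coord big1 // => c _.
  have [lt_cb|le_bc] := ltnP (cy_deg c) (cy_deg b).
    rewrite IH ?(leq_trans lt_cb) //; last by rewrite ltnW // (leq_trans lt_cb).
    case: eqP => [ac|]; last by rewrite mul0r.
    by move: lt_cb; rewrite -ac ltnNge le_ba.
  by rewrite (pred_slope_coord CY basis_e e_part (e_flat b j) le_bc) rmorph0 mulr0.
apply: funext => m; elim/mnm_ind: m => [|m j _].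
  by rewrite periodE hor0coef ev_e uniT0 // -[RHS]/(mfps_coef0 _) rmorph_nat.
apply: (mfps_derivI char_k); rewrite flat.
by rewrite -(rmorph_nat (@mfps_const n K)) mfps_deriv_const.
Qed.

(** Row a is an eigenvector of Frobenius for p^(deg a); its image under psi is therefore
    [hor (Frob psi (e b))] divided by this power, which is possible over K. *)
Lemma period_frob psi : exists psiT : 'M[KT]_N,
  (forall a b, frob_image psi (period a b) (psiT a b)) /\
  period *m toKTm (frobenius_matrix psi) = \matrix_(a, b) (psiT a b *+ p ^ cy_deg a).
Proof.
pose c (a : 'I_N) : KT := mfps_const n ((p ^ cy_deg a)%:R^-1).
have pa0 (a : 'I_N) : (p ^ cy_deg a)%:R != 0 :> K.
  by rewrite (fracK_nat_neq0 p_prime char_k) // expn_gt0 p_gt0.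
have cK a (f : KT) : (c a * f) *+ p ^ cy_deg a = f.
  rewrite -mulr_natr mulrAC -(rmorph_nat (@mfps_const n K)) -rmorphM mulVf //.
  by rewrite rmorph1 mul1r.
exists (\matrix_(a, b) (c a * hor (ev a) (Frob psi (e b)))); split=> [a b|].
  have [C evC] := ev_bounded a; rewrite [period a b]mxE [X in frob_image _ _ X]mxE.
  exact: (hor_frob_image p_gt2 (evD a) (evZ a) (ev_frob a) evC (esym (cK a _))).
apply/matrixP => a b; rewrite [LHS]mxE [RHS]mxE [X in _ = X *+ _]mxE cK hor_coord.
by apply: eq_bigr => i _; rewrite !mxE.
Qed.

Hypothesis sympT0 : T0 *m cy_gram K h *m T0^T = cy_gram K h.

Lemma period_symplectic : period *m cy_gram KT h *m period^T = cy_gram KT h.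
Proof.
have G_const a b : cy_gram KT h a b = mfps_const n (cy_gram K h a b).
  by have := congr1 (fun X : 'M_N => X a b) (map_cy_gram (@mfps_const n K) h);
    rewrite [LHS]mxE.
have derivM j r s t (X : 'M[KT]_(r, s)) (Y : 'M[KT]_(s, t)) :
    map_mx (mfps_deriv j) (X *m Y) = map_mx (mfps_deriv j) X *m Y + X *m map_mx (mfps_deriv j) Y.
  apply/matrixP => a b; rewrite !mxE raddf_sum -big_split; apply: eq_bigr => c _ /=.
  by rewrite mfps_derivM !mxE.
have derivG j : map_mx (mfps_deriv j) (cy_gram KT h) = 0.
  by apply/matrixP => a b; rewrite [LHS]mxE G_const mfps_deriv_const [RHS]mxE.
have derivR j : map_mx (mfps_deriv j) (period *m cy_gram KT h *m period^T) = 0.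
  rewrite !derivM derivG mulmx0 addr0 -map_trmx period_deriv congruence_derivation.
  have := congr1 toKTm (connection_symplectic j).
  rewrite map_mxD !map_mxM map_trmx map_cy_gram map_mx0 => ->.
  by rewrite mulmx0 mul0mx.
have R0 : map_mx (@mfps_coef0 n K) (period *m cy_gram KT h *m period^T) = cy_gram K h.
  rewrite !map_mxM -map_trmx map_cy_gram.
  suff -> : map_mx (@mfps_coef0 n K) period = T0 by [].
  by apply/matrixP => a b; rewrite [LHS]mxE periodE /mfps_coef0 hor0coef ev_e.
apply/matrixP => a b; apply: funext => m; elim/mnm_ind: m => [|m j _].
  by move/matrixP/(_ a b): R0; rewrite [LHS]mxE G_const mfps_constE eqxx.
apply: (mfps_derivI char_k); rewrite G_const mfps_deriv_const.
by move/matrixP/(_ a b): (derivR j); rewrite [LHS]mxE [RHS]mxE => ->.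
Qed.

End Frame.
End PeriodMatrix.

(** * The shape of the period matrix *)

Section BlockMatrices.
Variables (R : comPzRingType) (h : nat).

Lemma mul_block4
  (a11 b11 : 'M[R]_1) (a12 b12 a13 b13 : 'rV[R]_h) (a14 b14 : 'M[R]_1)
  (a21 b21 : 'cV[R]_h) (a22 b22 a23 b23 : 'M[R]_h) (a24 b24 : 'cV[R]_h)
  (a31 b31 : 'cV[R]_h) (a32 b32 a33 b33 : 'M[R]_h) (a34 b34 : 'cV[R]_h)
  (a41 b41 : 'M[R]_1) (a42 b42 a43 b43 : 'rV[R]_h) (a44 b44 : 'M[R]_1) :
  block4 a11 a12 a13 a14 a21 a22 a23 a24 a31 a32 a33 a34 a41 a42 a43 a44
  *m block4 b11 b12 b13 b14 b21 b22 b23 b24 b31 b32 b33 b34 b41 b42 b43 b44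
  = block4
     (a11 *m b11 + a12 *m b21 + (a13 *m b31 + a14 *m b41))
     (a11 *m b12 + a12 *m b22 + (a13 *m b32 + a14 *m b42))
     (a11 *m b13 + a12 *m b23 + (a13 *m b33 + a14 *m b43))
     (a11 *m b14 + a12 *m b24 + (a13 *m b34 + a14 *m b44))
     (a21 *m b11 + a22 *m b21 + (a23 *m b31 + a24 *m b41))
     (a21 *m b12 + a22 *m b22 + (a23 *m b32 + a24 *m b42))
     (a21 *m b13 + a22 *m b23 + (a23 *m b33 + a24 *m b43))
     (a21 *m b14 + a22 *m b24 + (a23 *m b34 + a24 *m b44))
     (a31 *m b11 + a32 *m b21 + (a33 *m b31 + a34 *m b41))
     (a31 *m b12 + a32 *m b22 + (a33 *m b32 + a34 *m b42))
     (a31 *m b13 + a32 *m b23 + (a33 *m b33 + a34 *m b43))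
     (a31 *m b14 + a32 *m b24 + (a33 *m b34 + a34 *m b44))
     (a41 *m b11 + a42 *m b21 + (a43 *m b31 + a44 *m b41))
     (a41 *m b12 + a42 *m b22 + (a43 *m b32 + a44 *m b42))
     (a41 *m b13 + a42 *m b23 + (a43 *m b33 + a44 *m b43))
     (a41 *m b14 + a42 *m b24 + (a43 *m b34 + a44 *m b44)).
Proof. by rewrite /block4 !mulmx_block !add_block_mx. Qed.

Lemma tr_block4
  (a11 : 'M[R]_1) (a12 a13 : 'rV[R]_h) (a14 : 'M[R]_1)
  (a21 : 'cV[R]_h) (a22 a23 : 'M[R]_h) (a24 : 'cV[R]_h)
  (a31 : 'cV[R]_h) (a32 a33 : 'M[R]_h) (a34 : 'cV[R]_h)
  (a41 : 'M[R]_1) (a42 a43 : 'rV[R]_h) (a44 : 'M[R]_1) :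
  (block4 a11 a12 a13 a14 a21 a22 a23 a24 a31 a32 a33 a34 a41 a42 a43 a44)^T
  = block4 a11^T a21^T a31^T a41^T a12^T a22^T a32^T a42^T
           a13^T a23^T a33^T a43^T a14^T a24^T a34^T a44^T.
Proof. by rewrite /block4 !tr_block_mx. Qed.

Definition idx0 : 'I_((1 + h) + (h + 1)) := lshift (h + 1) (lshift h ord0).
Definition idx1 (i : 'I_h) : 'I_((1 + h) + (h + 1)) := lshift (h + 1) (rshift 1 i).
Definition idx2 (i : 'I_h) : 'I_((1 + h) + (h + 1)) := rshift (1 + h) (lshift 1 i).
Definition idx3 : 'I_((1 + h) + (h + 1)) := rshift (1 + h) (rshift h ord0).

Lemma cy_deg_idx : [/\ cy_deg idx0 = 0%N, forall i, cy_deg (idx1 i) = 1%N,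
  forall i, cy_deg (idx2 i) = 2%N & cy_deg idx3 = 3%N].
Proof. by rewrite /cy_deg; split=> [|i|i|]; rewrite !(cat_fam_l, cat_fam_r). Qed.

Lemma idx_cases (a : 'I_((1 + h) + (h + 1))) :
  [\/ a = idx0, exists i, a = idx1 i, exists i, a = idx2 i | a = idx3].
Proof.
case: (split_ordP a) => b ->; case: (split_ordP b) => c ->.
- by constructor 1; rewrite (ord1 c).
- by constructor 2; exists c.
- by constructor 3; exists c.
- by constructor 4; rewrite (ord1 c).
Qed.

Section Shape.
Variable T : 'M[R]_((1 + h) + (h + 1)).
Definition blk12 : 'rV[R]_h := \row_i T idx0 (idx1 i).
Definition blk13 : 'rV[R]_h := \row_i T idx0 (idx2 i).
Definition blk14 : 'M[R]_1 := (T idx0 idx3)%:M.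
Definition blk23 : 'M[R]_h := \matrix_(i, j) T (idx1 i) (idx2 j).
Definition blk24 : 'cV[R]_h := \col_i T (idx1 i) idx3.
Definition blk34 : 'cV[R]_h := \col_i T (idx2 i) idx3.

Hypothesis uniT : forall a b, (cy_deg b <= cy_deg a)%N -> T a b = (a == b)%:R.

Lemma unipotent_block4 : T = block4 1%:M blk12 blk13 blk14
  0 1%:M blk23 blk24 0 0 1%:M blk34 0 0 0 1%:M.
Proof.
have [d0 d1 d2 d3] := cy_deg_idx.
have T0 a b : (cy_deg b < cy_deg a)%N -> T a b = 0.
  move=> lt_ba; rewrite uniT 1?ltnW //; case: eqP => // ab.
  by rewrite ab ltnn in lt_ba.
apply/matrixP => a b; rewrite /block4.
have [->|[i ->]|[i ->]|->] := idx_cases a; have [->|[j ->]|[j ->]|->] := idx_cases b;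
rewrite !(block_mxEul, block_mxEur, block_mxEdl, block_mxEdr) !mxE ?mulr1n //;
first [by rewrite T0 // ?(d0, d1, d2, d3)
  | by rewrite uniT ?(d1, d2) // ?eqxx // /idx1 /idx2 !(eq_lshift, eq_rshift)].
Qed.

Hypothesis sympT : T *m cy_gram R h *m T^T = cy_gram R h.

(** The congruence is read on the blocks (1,2), (1,3) and (2,2). The (1,1) block is a value of an
    alternating form, so it leaves [T idx0 idx3] free. *)
Lemma symplectic_blocks :
  [/\ blk12 = blk34^T, blk23^T = blk23 & blk13 = blk34^T *m blk23 - blk24^T].
Proof.
move: sympT; rewrite unipotent_block4 cy_gramE tr_block4 !mul_block4.
rewrite !(trmx0, trmx1, mulmx0, mul0mx, mulmx1, mul1mx, addr0, add0r, mulNmx, mulmxN).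
rewrite /block4 => /eq_block_mx[/eq_block_mx[_ e13 _ e23] /eq_block_mx[e12 _ _ _] _ _].
have {}e12 : blk12 = blk34^T.
  by apply/eqP; rewrite -subr_eq0 -[X in X == _]add0r -[X in X + _]oppr0 e12.
split=> //.
  by apply/eqP; rewrite -subr_eq0 addrC e23.
move/eqP: e13; rewrite addrC subr_eq0 => /eqP <-.
rewrite e12; congr (_ *m _ - _).
by apply/eqP; rewrite -subr_eq0 addrC e23.
Qed.

(** The corner of the product is Z + tau_23 . tau_13, which dictates the value of Z. *)
Lemma symplectic_factor : T =
  block4 1%:M blk34^T 0 0 0 1%:M 0 0 0 0 1%:M blk34 0 0 0 1%:M
  *m block4 1%:M 0 (- blk24^T) (T idx0 idx3 - \sum_i blk34 i 0 * blk24 i 0)%:M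
            0 1%:M blk23 blk24 0 0 1%:M 0 0 0 0 1%:M.
Proof.
have [b12 _ b13] := symplectic_blocks.
rewrite mul_block4 !(mulmx0, mul0mx, mulmx1, mul1mx, addr0, add0r).
rewrite {1}unipotent_block4 b12 b13 [_ - _]addrC.
suff -> : blk14 = (T idx0 idx3 - \sum_i blk34 i 0 * blk24 i 0)%:M + blk34^T *m blk24 by [].
apply/matrixP => i j; rewrite (ord1 i) (ord1 j) {1}/blk14 [RHS]mxE.
rewrite [LHS]mxE [X in _ = X + _]mxE !mulr1n [(_ *m _) 0 0]mxE.
rewrite [X in _ = _ + X](eq_bigr (fun i => blk34 i 0 * blk24 i 0)) ?subrK // => l _.
by rewrite [_^T 0 l]mxE.
Qed.
End Shape.

Lemma mul_slope_block4 (p : nat) (X : 'M[R]_((1 + h) + (h + 1))) :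
  block4 1%:M 0 0 0 0 (p%:R)%:M 0 0 0 0 (p%:R ^+ 2)%:M 0 0 0 0 (p%:R ^+ 3)%:M *m X
  = \matrix_(a, b) (X a b *+ p ^ cy_deg a).
Proof.
have [d0 d1 d2 d3] := cy_deg_idx.
have -> : block4 1%:M 0 0 0 0 (p%:R)%:M 0 0 0 0 (p%:R ^+ 2)%:M 0 0 0 0 (p%:R ^+ 3)%:M
    = diag_mx (\row_a (p ^ cy_deg a)%:R) :> 'M[R]_((1 + h) + (h + 1)).
  apply/matrixP => a b; rewrite /block4.
  have [->|[i ->]|[i ->]|->] := idx_cases a; have [->|[j ->]|[j ->]|->] := idx_cases b;
  rewrite !(block_mxEul, block_mxEur, block_mxEdl, block_mxEdr) !mxE ?(d0, d1, d2, d3);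
  rewrite /idx0 /idx1 /idx2 /idx3 ?(eq_lshift, eq_rshift, eq_lrshift, eq_rlshift);
  by rewrite ?eqxx ?expn0 ?expn1 ?natrX ?mulr1n.
by apply/matrixP => a b; rewrite mul_diag_mx !mxE mulr_natl.
Qed.
End BlockMatrices.

(** * The Kodaira-Spencer map *)

Section KodairaSpencer.
Variables (p : nat) (k : closedFieldType) (char_k : p \in [pchar k]) (W : wittRing p k).
Variables (n h : nat) (H : fcrystal W n).
Variables (U Fil : nat -> H -> Prop) (B : {biscalar H}).
Hypothesis CY : ordinary_CY3 h U Fil B.
Local Notation A := (mfps n W).
Variable e : 'I_((1 + h) + (h + 1)) -> H.
Hypothesis basis_e : is_basis (@everything H) e.
Hypothesis e_part : forall b, hodge_part U Fil (cy_deg b) (e b).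
Hypothesis e_flat : forall b j, pred_fil U (cy_deg b) (nabla (e b) j).
Local Notation coord := (coord_of basis_e).

Definition ks_matrix : 'M[A]_(h, n) := \matrix_(i, j) coord (nabla (e (idx3 h)) j) (idx2 i).

Let sum_idx2 (V : nmodType) (F : 'I_((1 + h) + (h + 1)) -> V) :
  (forall a, cy_deg a != 2%N -> F a = 0) -> \sum_a F a = \sum_i F (idx2 i).
Proof.
have [d0 d1 d2 d3] := cy_deg_idx h.
move=> F0; rewrite big_split_ord /= [X in X + _]big1 ?add0r => [|i _]; last first.
  apply: F0; have [->|[j ->]|[j e_j]|e_i] := idx_cases (lshift (h + 1) i);
    rewrite ?d0 ?d1 //.
    by move/eqP: e_j; rewrite eq_lrshift.
  by move/eqP: e_i; rewrite eq_lrshift.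
by rewrite big_split_ord /= [X in _ + X]big1 ?addr0 // => i _; apply: F0; rewrite (ord1 i) d3.
Qed.

Lemma connection_idx2 a j : cy_deg a != 2%N -> coord (nabla (e (idx3 h)) j) a = 0.
Proof.
have [_ _ _ d3] := cy_deg_idx h => da.
by apply: (nabla_coord CY basis_e e_part e_flat); rewrite d3.
Qed.

Lemma nabla_idx3 j : nabla (e (idx3 h)) j = \sum_i ks_matrix i j *: e (idx2 i).
Proof.
rewrite {1}(coord_ofE basis_e (nabla _ j)) sum_idx2.
  by apply: eq_bigr => i _; rewrite mxE.
by move=> a da; rewrite connection_idx2 ?scale0r.
Qed.

Lemma sum_connection_idx3 (R : comNzRingType) (f : {rmorphism A -> R})
    (t : 'I_((1 + h) + (h + 1)) -> R) j :
  \sum_c t c * f (coord (nabla (e (idx3 h)) j) c) = \sum_i t (idx2 i) * f (ks_matrix i j).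
Proof.
rewrite sum_idx2; last by move=> a da; rewrite connection_idx2 // rmorph0 mulr0.
by apply: eq_bigr => i _; rewrite mxE.
Qed.

Let hodge3 x : hodge_part U Fil 3 x -> x = coord x (idx3 h) *: e (idx3 h).
Proof.
have [d0 d1 d2 d3] := cy_deg_idx h => -[_ F3].
rewrite {1}(coord_ofE basis_e x) (bigD1 (idx3 h)) //= big1 ?addr0 // => a ne_a.
rewrite (hodge_coord CY basis_e e_part F3) ?scale0r //.
have [->|[i ->]|[i ->]|ea] := idx_cases a; rewrite ?(d0, d1, d2) //.
by rewrite ea eqxx in ne_a.
Qed.

Let contract_e3 (theta : {scalar 'rV[A]_n}) :
  contract theta (nabla (e (idx3 h))) =
  \sum_i (ks_matrix *m \col_j theta (delta_mx 0 j)) i 0 *: e (idx2 i).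
Proof.
rewrite /contract; under eq_bigr do rewrite nabla_idx3 scaler_sumr.
rewrite exchange_big; apply: eq_bigr => i _; rewrite mxE scaler_suml.
by apply: eq_bigr => j _; rewrite scalerA [(\col_j _) j 0]mxE mulrC.
Qed.

(** Surjectivity gives a right inverse D column by column. As n = h is not yet known, D K = 1 is
    obtained instead from injectivity, since K (D K - 1) = 0. *)
Lemma ks_invertible : kodaira_spencer_iso U Fil ->
  exists D : 'M[A]_(n, h), ks_matrix *m D = 1%:M /\ D *m ks_matrix = 1%:M.
Proof.
have [d0 d1 d2 d3] := cy_deg_idx h.
have e3P : hodge_part U Fil 3 (e (idx3 h)) by rewrite -d3.
have e2P i : hodge_part U Fil 2 (e (idx2 i)) by rewrite -(d2 i).
case=> inj surj.
have injM (u : 'cV[A]_n) : ks_matrix *m u = 0 -> u = 0.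
  move=> Ku; pose th (w : 'rV[A]_n) : A := (w *m u) 0 0.
  have lin_th : linear_for *%R th by move=> a x y; rewrite /th mulmxDl -scalemxAl !mxE.
  pose lin_thM := GRing.isLinear.Build A 'rV[A]_n A *%R th lin_th.
  pose theta : {scalar 'rV[A]_n} := HB.pack th lin_thM.
  have thetaE j : theta (delta_mx 0 j) = u j 0 by rewrite /theta /= /th -rowE mxE.
  have theta0 : forall w, theta w = 0.
    apply: inj => x x3; rewrite (hodge3 x3); set c := coord x _.
    have subF : is_submodule (Fil 3) by apply: (hodge_sub (cy_hodge CY)).
    rewrite /contract; under eq_bigr do rewrite nabla_scaleE scalerDr.
    rewrite big_split /=; apply: submoduleD => //.
      apply: submodule_sum => // j _; do 2!apply: submoduleZ => //.
      by case: e3P.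
    rewrite (_ : \sum_(i < n) _ = c *: contract theta (nabla (e (idx3 h)))); last first.
      rewrite scaler_sumr; apply: eq_bigr => j _.
      by rewrite !scalerA mulrC.
    rewrite contract_e3 (_ : \col_j _ = u); last first.
      by apply/matrixP => i j; rewrite mxE thetaE (ord1 j).
    rewrite Ku big1 ?scaler0 => [|i _]; last by rewrite mxE scale0r.
    exact: submodule0.
  by apply/matrixP => j j'; rewrite (ord1 j') -thetaE theta0 mxE.
have /choice[D DP] : forall l : 'I_h, exists u : 'cV[A]_n, ks_matrix *m u = delta_mx l 0.
  move=> l; pose g x := coord x (idx3 h) *: e (idx2 l).
  have [||theta thP] := surj g.
  - by move=> a x y _ _; rewrite /g coord_of_linear scalerDl scalerA.
  - move=> x _; have [U2 F2] := e2P l; split.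
      by apply: submoduleZ => //; apply: (slope_sub (cy_slope CY)).
    by apply: submoduleZ => //; apply: (hodge_sub (cy_hodge CY)).
  exists (\col_j theta (delta_mx 0 j)); apply/matrixP => i i'.
  have := hodge_coord CY basis_e e_part (i := idx2 i) (thP _ e3P).
  rewrite d2 => /(_ isT); rewrite /g coord_of_e eqxx scale1r contract_e3.
  set K := ks_matrix *m _.
  have -> : \sum_i0 K i0 0 *: e (idx2 i0) - e (idx2 l) =
      \sum_a (cat_fam (fun=> 0) (cat_fam (fun i0 => (K - delta_mx l 0) i0 0) (fun=> 0))) a *: e a.
    rewrite big_split_ord /= [X in _ = X + _]big1 ?add0r => [|a _]; last first.
      by rewrite cat_fam_l scale0r.
    rewrite big_split_ord /= [X in _ = _ + X]big1 ?addr0 => [|a _]; last first.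
      by rewrite !cat_fam_r scale0r.
    under [RHS]eq_bigr do rewrite cat_fam_r cat_fam_l mxE scalerDl.
    rewrite big_split /=; congr (_ + _).
    rewrite (bigD1 l) //= !mxE !eqxx scaleN1r big1 ?addr0 // => a ne_al.
    by rewrite !mxE (negPf ne_al) oppr0 scale0r.
  rewrite (coord_of_uniq basis_e erefl) cat_fam_r cat_fam_l (ord1 i') => /eqP.
  by rewrite !mxE subr_eq0 => /eqP.
pose Dm : 'M[A]_(n, h) := \matrix_(j, l) D l j 0.
have KD : ks_matrix *m Dm = 1%:M.
  apply/matrixP => i l; have /matrixP/(_ i 0) := DP l.
  rewrite [delta_mx _ _ _ _]mxE eqxx andbT => e_il.
  rewrite [RHS]mxE -e_il [LHS]mxE [RHS]mxE; apply: eq_bigr => j _.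
  by rewrite [Dm j l]mxE.
exists Dm; split=> //; apply: subr0_eq; apply/matrixP => i j.
have := injM (col j (Dm *m ks_matrix - 1%:M)).
rewrite colE mulmxA mulmxBr mulmxA KD mul1mx mulmx1 subrr mul0mx => /(_ erefl).
by rewrite -colE => /matrixP/(_ i 0); rewrite mxE [RHS]mxE => ->; rewrite mxE.
Qed.

End KodairaSpencer.

(** * The basis, the period matrix and the differential relations between its blocks *)

Theorem theorem2p2 (p : nat) (p_prime : prime p) (p_gt3 : (3 < p)%N)
    (k : closedFieldType) (char_k : p \in [pchar k]) (W : wittRing p k)
    (n h : nat) (H : fcrystal W n) (U Fil : nat -> H -> Prop)
    (B : {biscalar H}) (CY : ordinary_CY3 h U Fil B) :
  exists e : 'I_((1 + h) + (h + 1)) -> H,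
  exists (Z : mfps n {fraction W}) (tau23 tau13 : 'cV[mfps n {fraction W}]_h)
    (tau12 : 'M[mfps n {fraction W}]_h)
    (T : 'M[mfps n {fraction W}]_((1 + h) + (h + 1))),
  let J : 'M[mfps n {fraction W}]_(h, n) :=
    \matrix_(i, j) mfps_deriv j (tau23 i 0) in
  [/\ [/\ is_basis (@everything H) e,
          forall i : 'I__, i = 0%N :> nat -> hodge_part U Fil 0 (e i),
          forall i : 'I__, (1 <= i <= h)%N -> hodge_part U Fil 1 (e i),
          forall i : 'I__, (h + 1 <= i <= 2 * h)%N -> hodge_part U Fil 2 (e i)
        & forall i : 'I__, i = (2 * h + 1)%N :> nat -> hodge_part U Fil 3 (e i)],
      (\matrix_(i, j) B (e i) (e j)) =
        block4 0 0 0 (- 1%:M)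
               0 0 1%:M 0
               0 (- 1%:M) 0 0
               1%:M 0 0 0,
      (forall j : 'I_n, exists2 M : 'M[mfps n W]_((1 + h) + (h + 1)),
         is_matrix_of e (fun x => nabla x j) M &
         map_mx (@toKT _ _ W n) M = invmx T *m map_mx (mfps_deriv j) T) /\
      (forall psi : frobLift W n,
         exists (M : 'M[mfps n W]_((1 + h) + (h + 1)))
           (psiT : 'M[mfps n {fraction W}]_((1 + h) + (h + 1))),
         [/\ is_matrix_of e (Frob psi) M,
             forall a b, frob_image psi (T a b) (psiT a b)
           & map_mx (@toKT _ _ W n) M =
               invmx T
               *m block4 1%:M 0 0 0
                         0 (p%:R)%:M 0 0
                         0 0 (p%:R ^+ 2)%:M 0
                         0 0 0 (p%:R ^+ 3)%:M
               *m psiT]),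
      T = block4 1%:M tau23^T 0 0
                 0 1%:M 0 0
                 0 0 1%:M tau23
                 0 0 0 1%:M
          *m
          block4 1%:M 0 (- tau13^T) Z%:M
                 0 1%:M tau12 tau13
                 0 0 1%:M 0
                 0 0 0 1%:M
    & kodaira_spencer_iso U Fil ->
      n = h /\
      (* Jinv is the matrix of the dt_j / dtau_i *)
      exists Jinv : 'M[mfps n {fraction W}]_(n, h),
        let dtau (i : 'I_h) (f : mfps n {fraction W}) :=
          \sum_j Jinv j i * mfps_deriv j f in
        [/\ J *m Jinv = 1%:M,
            Jinv *m J = 1%:M,
            tau13 = - 2%:R^-1 *: (\row_i dtau i Z)^T
          & tau12 = - 2%:R^-1 *: \matrix_(i, j) dtau i (dtau j Z)]].
Proof.
have p_gt2 : (2 < p)%N by apply: ltnW.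
have [e [basis_e e_part e_flat e_frob e_gram]] := cy3_basis char_k CY.
have [T0 [uniT0 frobT0 sympT0]] :=
  slope_splitting CY basis_e e_part e_frob e_gram.
pose T := period basis_e T0.
have uniT : forall a b, (cy_deg b <= cy_deg a)%N -> T a b = (a == b)%:R :=
  period_unipotent char_k CY basis_e e_part e_flat uniT0.
have derivT : forall j, map_mx (mfps_deriv j) T
    = T *m map_mx (@toKT p k W n) (connection_matrix basis_e j) :=
  period_deriv char_k basis_e T0.
have frobT := fun psi => period_frob p_gt2 frobT0 psi.
have sympT := period_symplectic char_k CY basis_e e_gram sympT0.
rewrite -/T in frobT sympT; clearbody T.
pose G := cy_gram (mfps n {fraction W}) h.
(* As G^2 = -1, the congruence provides an explicit inverse of T. *)
have TT' : T *m (G *m T^T *m - G) = 1%:M.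
  by rewrite !mulmxA sympT mulmxN cy_gram_sqr opprK.
have [unitT _] := mulmx1_unit TT'.
have [b12 b23 b13] := symplectic_blocks uniT sympT.
pose w := blk34 T; pose v := blk24 T; pose Bm := blk23 T.
pose Z := T (idx0 h) (idx3 h) - \sum_i w i 0 * v i 0.
exists e, Z, w, v, Bm, T => J.
have [_ _ d2 _] := cy_deg_idx h.
have col3 j c : mfps_deriv j (T c (idx3 h)) =
    \sum_i T c (idx2 i) * toKT (ks_matrix basis_e i j).
  rewrite -(sum_connection_idx3 CY basis_e e_part e_flat (@toKT p k W n) (T c)).
  move/matrixP/(_ c (idx3 h)): (derivT j); rewrite [LHS]mxE => ->.
  by rewrite mxE; apply: eq_bigr => a' _; rewrite !mxE.
(* The degree 2 diagonal block of T is the identity, so the Jacobian of tau_23 is the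
   Kodaira-Spencer matrix itself. *)
have deriv_w i j : mfps_deriv j (w i 0) = toKT (ks_matrix basis_e i j).
  rewrite [w i 0]mxE col3 (bigD1 i) //= uniT ?eqxx ?mul1r ?big1 ?addr0 // => l ne_li.
  rewrite uniT ?d2 // /idx2 eq_rshift eq_lshift.
  by rewrite eq_sym (negPf ne_li) mul0r.
have derivE j a : mfps_deriv j (T a (idx3 h)) =
    \sum_i T a (idx2 i) * mfps_deriv j (w i 0).
  by rewrite col3; apply: eq_bigr => i _; rewrite deriv_w.
have deriv_v j i : mfps_deriv j (v i 0) = \sum_l Bm i l * mfps_deriv j (w l 0).
  by rewrite mxE derivE; apply: eq_bigr => l _; rewrite [Bm i l]mxE.
have symB i l : Bm i l = Bm l i.
  by have /matrixP/(_ l i) := b23; rewrite [LHS]mxE.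
(* The corner of T has differential (w^T Bm - v^T) dw, and d(w . v) = v . dw + w^T Bm dw; in the
   difference the terms with Bm cancel. *)
have deriv_Z j : mfps_deriv j Z = - 2%:R * \sum_i v i 0 * mfps_deriv j (w i 0).
  rewrite /Z raddfB /= derivE raddf_sum.
  have row0 i : T (idx0 h) (idx2 i) = \sum_l w l 0 * Bm l i - v i 0.
    move/matrixP/(_ 0 i): b13; rewrite [LHS]mxE => ->; rewrite mxE [in X in _ + X]mxE.
    rewrite [X in _ + - X]mxE; congr (_ - _); rewrite mxE; apply: eq_bigr => l _.
    by rewrite [_^T 0 l]mxE.
  have -> : \sum_i T (idx0 h) (idx2 i) * mfps_deriv j (w i 0) =
      \sum_i (\sum_l w l 0 * Bm l i) * mfps_deriv j (w i 0)
      - \sum_i v i 0 * mfps_deriv j (w i 0).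
    by rewrite -sumrB; apply: eq_bigr => i _; rewrite row0 mulrBl.
  have -> : \sum_i mfps_deriv j (w i 0 * v i 0) =
      \sum_i v i 0 * mfps_deriv j (w i 0)
      + \sum_i (\sum_l w l 0 * Bm l i) * mfps_deriv j (w i 0).
    under eq_bigr do rewrite mfps_derivM mulrC deriv_v mulr_sumr.
    rewrite big_split exchange_big; congr (_ + _); apply: eq_bigr => l _.
    by rewrite mulr_suml; apply: eq_bigr => i _; rewrite mulrA.
  by rewrite opprD addrC addrA subrK mulNr mulr2n mulrDl mul1r opprD.
split.
- have valP := @cy_deg_valP h.
  split=> // i.
  + by move/eqP; case: (valP i) => -> _ _ _ /eqP <-.
  + by case: (valP i) => _ -> _ _ /eqP <-.
  + by case: (valP i) => _ _ -> _ /eqP <-.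
  + by move/eqP; case: (valP i) => _ _ _ -> /eqP <-.
- by rewrite e_gram cy_gramE.
- split=> [j|psi].
    exists (connection_matrix basis_e j) => [b|].
      rewrite {1}(coord_ofE basis_e (nabla (e b) j)).
      by apply: eq_bigr => a _; rewrite mxE.
    by rewrite derivT mulKmx.
  have [psiT [imT TpsiT]] := frobT psi.
  exists (frobenius_matrix basis_e psi), psiT; split=> // [b|].
    rewrite {1}(coord_ofE basis_e (Frob psi (e b))).
    by apply: eq_bigr => a _; rewrite mxE.
  by rewrite -mulmxA mul_slope_block4 -TpsiT mulKmx.
- exact: symplectic_factor uniT sympT.
move=> ks; have [D [KD DK]] := ks_invertible CY basis_e e_part e_flat ks.
split; first exact: (inverse_mx_size (@residue p k W n) DK KD).
have JE : J = map_mx (@toKT p k W n) (ks_matrix basis_e).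
  by apply/matrixP => i j; rewrite [LHS]mxE [RHS]mxE deriv_w.
pose Jinv := map_mx (@toKT p k W n) D.
have JJ : J *m Jinv = 1%:M by rewrite JE -map_mxM KD map_mx1.
exists Jinv => dtau.
have dtau_w i l : dtau i (w l 0) = (l == i)%:R.
  have /matrixP/(_ l i) := JJ; rewrite [RHS]mxE => <-; rewrite [RHS]mxE.
  by apply: eq_bigr => j _; rewrite mulrC [J l j]mxE.
(* If df is the sum of the c_l d tau_l, the c_l are the partial derivatives of f in the coordinates
   tau. *)
have dtauE i (f : mfps n {fraction W}) (c : 'I_h -> mfps n {fraction W}) :
    (forall j, mfps_deriv j f = \sum_l c l * mfps_deriv j (w l 0)) -> dtau i f = c i.
  move=> df; rewrite /dtau; under eq_bigr do rewrite df mulr_sumr.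
  have -> : c i = \sum_l c l * dtau i (w l 0).
    rewrite (bigD1 i) //= dtau_w eqxx mulr1 big1 ?addr0 // => l ne_li.
    by rewrite dtau_w (negPf ne_li) mulr0.
  rewrite exchange_big; apply: eq_bigr => l _; rewrite mulr_sumr.
  by apply: eq_bigr => j _; rewrite mulrCA.
have unit2 : 2%:R \is a @GRing.unit (mfps n {fraction W}).
  apply/unitrPr; exists (mfps_const n 2%:R^-1).
  rewrite -(rmorph_nat (@mfps_const n {fraction W})) -rmorphM mulfV ?rmorph1 //.
  exact: (fracK_nat_neq0 p_prime char_k).
have dtauZ i : dtau i Z = - 2%:R * v i 0.
  apply: (dtauE i Z (fun l => - 2%:R * v l 0)) => j; rewrite deriv_Z mulr_sumr.
  by apply: eq_bigr => l _; rewrite mulrA.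
have half_cancel (x : mfps n {fraction W}) : - 2%:R^-1 * (- 2%:R * x) = x.
  by rewrite mulrA mulrNN mulVr ?mul1r.
split=> //.
- by rewrite JE -map_mxM DK map_mx1.
- by apply/matrixP => i j; rewrite (ord1 j) !mxE dtauZ half_cancel [v i 0]mxE.
apply/matrixP => i j; rewrite [RHS]mxE [X in _ * X]mxE dtauZ.
(* The second derivative comes out as the entry (j, i) of -2 Bm, whence the appeal to the symmetry
   of Bm. *)
rewrite (_ : dtau i _ = - 2%:R * Bm j i) ?half_cancel; first exact: symB.
apply: (dtauE i _ (fun l => - 2%:R * Bm j l)) => l.
have -> : mfps_deriv l (- 2%:R * v j 0) = - 2%:R * mfps_deriv l (v j 0).
  by rewrite !mulNr !mulr_natl raddfN raddfMn.
rewrite deriv_v mulr_sumr.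
by apply: eq_bigr => l' _; rewrite mulrA.
Qed.
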